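(* Let $m\ge2$ and let $(M^{2m+1},\phi,\xi,\eta,g)$ be a Sasakian spin manifold. Let $\psi$ be a Sasakian quasi-Killing spinor of type $(\pm\frac12,b)$ with $b\ne0$. Then $\psi$ is a WK-spinor if and only if $$b=\mp\frac{2m^2-m-2}{4(m-1)}$$ (upper signs together, lower signs together).
   Context: Manifolds are connected, smooth, oriented, without boundary, with a fixed spin structure. $\nabla$ is the Levi-Civita connection and the induced connection on the complex spinor bundle; $X\cdot\psi$ is Clifford multiplication with $X\cdot Y\cdot\psi+Y\cdot X\cdot\psi=-2g(X,Y)\psi$; vectors and 1-forms are identified via $g$; $Ric$ is the Ricci tensor (as $(0,2)$- or $(1,1)$-tensor), $S$ the scalar curvature. Sasakian structure on $M^{2m+1}$: a $(1,1)$-tensor field $\phi$, a vector field $\xi$, a 1-form $\eta$ and a Riemannian metric $g$ with $\eta(\xi)=1$, $\phi^2(X)=-X+\eta(X)\xi$, $g(\phi X,\phi Y)=g(X,Y)-\eta(X)\eta(Y)$ and $(\nabla_X\phi)(Y)=g(X,Y)\xi-\eta(Y)X$ for all vector fields $X,Y$. Sasakian quasi-Killing spinor of type $(a,b)$ ($a,b\in\mathbb{R}$): a spinor field $\psi\not\equiv0$ with $\nabla_X\psi=aX\cdot\psi+b\,\eta(X)\,\xi\cdot\psi$ for all $X$. WK-spinor: on a Riemannian spin manifold $(M^n,g)$ of dimension $n\ge3$ with nowhere vanishing scalar curvature $S$, a spinor field $\psi\not\equiv 0$ is a weak Killing spinor (WK-spinor) with WK-number $\lambda\in\mathbb{R}$,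 $\lambda\neq0$, if for all $X$ $$\nabla_X\psi=\frac{n}{2(n-1)S}\,dS(X)\psi+\frac{2\lambda}{(n-2)S}\,Ric(X)\cdot\psi-\frac{\lambda}{n-2}\,X\cdot\psi+\frac{1}{2(n-1)S}\,X\cdot dS\cdot\psi .$$ ''$\psi$ is a WK-spinor'' means that this holds (and $S$ vanishes nowhere) for some WK-number $\lambda$. *)

(* Defs.v *)
From mathcomp Require Export all_boot all_order all_algebra.
From mathcomp Require Export complex.
From mathcomp Require Export all_classical all_reals all_analysis.

Set Implicit Arguments.
Unset Strict Implicit.
Unset Printing Implicit Defensive.

Import Order.TTheory GRing.Theory Num.Theory.
Import numFieldNormedType.Exports.

Local Open Scope classical_set_scope.
Local Open Scope ring_scope.
Local Open Scope complex_scope.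

(* Conventions.  Differential geometry is done in local coordinates.  A tensor
   field on M is a family, indexed by the charts c, of component functions
   M -> 'M[R]_(_, _), of which only the values on the domain of c matter, and
   which obeys the tensor transformation rule from chart to chart.  A tangent
   vector is the ROW of its components, a covector is a COLUMN, and an
   endomorphism A acts on tangent vectors by v |-> v *m A. *)

Section EuclideanSmoothness.
Variables (R : realType) (n : nat).

Definition coord_vec (k : 'I_n) : 'rV[R]_n := delta_mx 0 k.

(* f is C^r on the open set V: all iterated partial derivatives of order at
   most r exist and are continuous on V. *)
Fixpoint Cr_on (r : nat) (V : set 'rV[R]_n) (f : 'rV[R]_n -> R) : Prop :=
  {in V, continuous f} /\
  (if r is r'.+1 then
     forall k, (forall x, V x -> derivable f x (coord_vec k)) /\
               Cr_on r' V ('D_(coord_vec k) f)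
   else True).

Definition Cinfty_on (V : set 'rV[R]_n) (f : 'rV[R]_n -> R) : Prop :=
  forall r, Cr_on r V f.

End EuclideanSmoothness.

Section Manifolds.
Variables (R : realType) (n : nat) (M : topologicalType).

(* [inv c] is the inverse of [chart c], with junk values outside the image. *)
Record atlas := Atlas {
  idx : Type;
  dom : idx -> set M;
  chart : idx -> M -> 'rV[R]_n;
  inv : idx -> 'rV[R]_n -> M }.

Variable A : atlas.
Implicit Types (c d : idx A) (p : M) (k l : 'I_n).

Definition pd c k (f : M -> R) (p : M) : R :=
  'D_(coord_vec R k) (f \o inv c) (chart c p).

(* f is smooth on the intersection of U (open) with the domain of c *)
Definition smooth_in c (U : set M) (f : M -> R) : Prop :=
  Cinfty_on (chart c @` (U `&` dom c)) (f \o inv c).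

Definition smooth_mx_in c (U : set M) r s (F : M -> 'M[R]_(r, s)) : Prop :=
  forall i j, smooth_in c U (fun p => F p i j).

Definition smooth_cmx_in c (U : set M) r s (F : M -> 'M[R[i]]_(r, s)) : Prop :=
  forall i j, smooth_in c U (fun p => complex.Re (F p i j)) /\
              smooth_in c U (fun p => complex.Im (F p i j)).

(* (jac c d p) k l = d y^l / d x^k, with x the coordinates of c, y those of d *)
Definition jac c d p : 'M[R]_n :=
  \matrix_(k, l) pd c k (fun q => chart d q 0 l) p.

Record oriented_manifold : Prop := OrientedManifold {
  mfd_hausdorff : hausdorff_space M;
  mfd_second_countable : @second_countable M;
  mfd_connected : connected [set: M];
  mfd_dom_open : forall c, open (dom c);
  mfd_cover : forall p, exists c, dom c p;
  mfd_img_open : forall c, open (chart c @` dom c);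
  mfd_chartK : forall c p, dom c p -> inv c (chart c p) = p;
  mfd_chart_cont : forall c, {in dom c, continuous (chart c)};
  mfd_inv_cont : forall c, {in chart c @` dom c, continuous (inv c)};
  mfd_smooth : forall c d, smooth_mx_in c (dom d) (chart d);
  mfd_oriented : forall c d p, dom c p -> dom d p -> 0 < \det (jac c d p) }.

Definition vector_field (X : idx A -> M -> 'rV[R]_n) : Prop :=
  (forall c, smooth_mx_in c setT (X c)) /\
  (forall c d p, dom c p -> dom d p -> X d p = X c p *m jac c d p).

Definition one_form (w : idx A -> M -> 'cV[R]_n) : Prop :=
  (forall c, smooth_mx_in c setT (w c)) /\
  (forall c d p, dom c p -> dom d p -> w c p = jac c d p *m w d p).

Definition endo_field (F : idx A -> M -> 'M[R]_n) : Prop :=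
  (forall c, smooth_mx_in c setT (F c)) /\
  (forall c d p, dom c p -> dom d p ->
     F c p *m jac c d p = jac c d p *m F d p).

Record riemannian_metric (g : idx A -> M -> 'M[R]_n) : Prop := RiemMetric {
  metric_smooth : forall c, smooth_mx_in c setT (g c);
  metric_tensor : forall c d p, dom c p -> dom d p ->
    g c p = jac c d p *m g d p *m (jac c d p)^T;
  metric_sym : forall c p, dom c p -> (g c p)^T = g c p;
  metric_pos : forall c p, dom c p -> forall v : 'rV[R]_n, v != 0 ->
    0 < (v *m g c p *m v^T) 0 0 }.

Section Riemannian.
Variable g : idx A -> M -> 'M[R]_n.

Definition ip c p (v w : 'rV[R]_n) : R := (v *m g c p *m w^T) 0 0.

(* christoffel c p i j l = Gamma^l_{ij} *)
Definition christoffel c p (i j l : 'I_n) : R :=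
  2^-1 * \sum_(k < n) invmx (g c p) l k *
    (pd c i (fun q => g c q j k) p + pd c j (fun q => g c q i k) p
     - pd c k (fun q => g c q i j) p).

(* Levi-Civita derivative, at p, of the local vector field Y along v *)
Definition nabla c (v : 'rV[R]_n) (Y : M -> 'rV[R]_n) p : 'rV[R]_n :=
  \row_l (\sum_k v 0 k * pd c k (fun q => Y q 0 l) p
          + \sum_i \sum_j v 0 i * Y p 0 j * christoffel c p i j l).

Definition nabla_endo c (v : 'rV[R]_n) (F : M -> 'M[R]_n)
    (Y : M -> 'rV[R]_n) p : 'rV[R]_n :=
  nabla c v (fun q => Y q *m F q) p - nabla c v Y p *m F p.

(* curvature c p i j k l is the component on d_l of
   R(d_i, d_j) d_k = nabla_i nabla_j d_k - nabla_j nabla_i d_k. *)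
Definition curvature c p (i j k l : 'I_n) : R :=
  pd c i (fun q => christoffel c q j k l) p
  - pd c j (fun q => christoffel c q i k l) p
  + \sum_r (christoffel c p i r l * christoffel c p j k r
            - christoffel c p j r l * christoffel c p i k r).

(* Ric(Y, Z) = tr (X |-> R(X, Y) Z); positive on round spheres *)
Definition ricci c p : 'M[R]_n :=
  \matrix_(j, k) \sum_i curvature c p i j k i.

Definition Ric c p (v : 'rV[R]_n) : 'rV[R]_n :=
  v *m ricci c p *m invmx (g c p).

Definition scal c p : R := \tr (ricci c p *m invmx (g c p)).

Definition dscal c p (v : 'rV[R]_n) : R := \sum_k v 0 k * pd c k (scal c) p.

(* the 1-form dS seen as a tangent vector *)
Definition grad_scal c p : 'rV[R]_n :=
  (\row_k pd c k (scal c) p) *m invmx (g c p).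

Record sasakian (phi : idx A -> M -> 'M[R]_n) (xi : idx A -> M -> 'rV[R]_n)
    (eta : idx A -> M -> 'cV[R]_n) : Prop := Sasakian {
  sas_metric : riemannian_metric g;
  sas_phi : endo_field phi;
  sas_xi : vector_field xi;
  sas_eta : one_form eta;
  sas_eta_xi : forall c p, dom c p -> (xi c p *m eta c p) 0 0 = 1;
  sas_phi2 : forall c p, dom c p -> forall v : 'rV[R]_n,
    v *m phi c p *m phi c p = - v + (v *m eta c p) 0 0 *: xi c p;
  sas_compat : forall c p, dom c p -> forall v w : 'rV[R]_n,
    ip c p (v *m phi c p) (w *m phi c p) =
    ip c p v w - (v *m eta c p) 0 0 * (w *m eta c p) 0 0;
  sas_nabla_phi : forall c p, dom c p ->
    forall (v : 'rV[R]_n) (Y : M -> 'rV[R]_n), smooth_mx_in c setT Y ->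
    nabla_endo c v (phi c) Y p =
    ip c p v (Y p) *: xi c p - (Y p *m eta c p) 0 0 *: v }.

End Riemannian.

End Manifolds.

(* Complex dimension of the spinor module in dimension n. *)
Definition spin_dim (n : nat) : nat := (2 ^ n./2)%N.

Section SpinGroup.
Variables (R : realType) (n : nat).

(* A unitary complex representation, of the minimal dimension, of the Clifford
   algebra of R^n; for odd n there are two of them up to equivalence. *)
Record clifford_rep (E : 'I_n -> 'M[R[i]]_(spin_dim n)) : Prop := CliffordRep {
  cliff_rel : forall a b, E a *m E b + E b *m E a = (- 2 * (a == b)%:R)%:M;
  cliff_skew : forall a, (map_mx (@conjc R) (E a))^T = - E a }.

Variable E : 'I_n -> 'M[R[i]]_(spin_dim n).

Definition cliff (x : 'rV[R]_n) : 'M[R[i]]_(spin_dim n) :=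
  \sum_a (x 0 a)%:C *: E a.

(* Spin(n) as the group of products of evenly many unit vectors, in its (faithful)
   spin representation. *)
Inductive in_Spin : 'M[R[i]]_(spin_dim n) -> Prop :=
| in_Spin1 : in_Spin 1%:M
| in_SpinM s (u v : 'rV[R]_n) : in_Spin s ->
    u *m u^T = 1%:M -> v *m v^T = 1%:M ->
    in_Spin (s *m (cliff u *m cliff v)).

End SpinGroup.

Section SpinGeometry.
Variables (R : realType) (n : nat) (M : topologicalType) (A : atlas R n M).
Variable g : idx A -> M -> 'M[R]_n.
Variable E : 'I_n -> 'M[R[i]]_(spin_dim n).

(* Cech data of a spin structure: an open cover (sdom j), on each member of it
   an orthonormal frame (row a of [frame j c p] has the components of e_a in the
   chart c), and a Spin(n)-valued cocycle. *)
Record spin_data := SpinData {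
  sidx : Type;
  sdom : sidx -> set M;
  frame : sidx -> idx A -> M -> 'M[R]_n;
  strans : sidx -> sidx -> M -> 'M[R[i]]_(spin_dim n) }.

Variable P : spin_data.
Implicit Types (c d : idx A) (p : M) (h j k : sidx P).

(* Clifford multiplication by the tangent vector v, in the spin frame j *)
Definition cmul j c p (v : 'rV[R]_n) : 'M[R[i]]_(spin_dim n) :=
  cliff E (\row_a ip g c p v (row a (frame j c p))).

(* The last field says that the cocycle lifts the transition functions of the
   orthonormal frames through the double cover Spin(n) -> SO(n). *)
Record spin_structure : Prop := SpinStructure {
  spin_open : forall j, open (sdom j);
  spin_cover : forall p, exists j, sdom j p;
  spin_frame_smooth : forall j c, smooth_mx_in c (sdom j) (frame j c);
  spin_frame_tensor : forall j c d p, sdom j p -> dom c p -> dom d p ->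
    frame j d p = frame j c p *m jac c d p;
  spin_frame_orthonormal : forall j c p, sdom j p -> dom c p ->
    frame j c p *m g c p *m (frame j c p)^T = 1%:M;
  spin_frame_oriented : forall j c p, sdom j p -> dom c p ->
    0 < \det (frame j c p);
  spin_trans_smooth : forall j k c,
    smooth_cmx_in c (sdom j `&` sdom k) (strans j k);
  spin_trans_Spin : forall j k p, sdom j p -> sdom k p ->
    in_Spin E (strans j k p);
  spin_cocycle : forall h j k p, sdom h p -> sdom j p -> sdom k p ->
    strans h j p *m strans j k p = strans h k p;
  spin_lift : forall j k c p, sdom j p -> sdom k p -> dom c p -> forall a,
    cmul j c p (row a (frame k c p)) *m strans j k p = strans j k p *m E a }.

Definition spinor_field (psi : sidx P -> M -> 'cV[R[i]]_(spin_dim n)) : Prop :=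
  (forall j c, smooth_cmx_in c (sdom j) (psi j)) /\
  (forall j k p, sdom j p -> sdom k p -> psi j p = strans j k p *m psi k p).

Definition nonzero_spinor (psi : sidx P -> M -> 'cV[R[i]]_(spin_dim n)) : Prop :=
  exists j p, sdom j p /\ psi j p != 0.

Definition pdC c (l : 'I_n) (f : M -> R[i]) p : R[i] :=
  pd c l (fun q => complex.Re (f q)) p +i* pd c l (fun q => complex.Im (f q)) p.

(* nabla_v psi = v(psi) + 1/4 sum_{a,b} g(nabla_v e_a, e_b) e_a . e_b . psi *)
Definition nabla_spinor j c (v : 'rV[R]_n)
    (psi : sidx P -> M -> 'cV[R[i]]_(spin_dim n)) p : 'cV[R[i]]_(spin_dim n) :=
  (\col_r \sum_l (v 0 l)%:C * pdC c l (fun q => psi j q r 0) p)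
  + (4^-1)%:C *: \sum_a \sum_b
      (ip g c p (nabla g c v (fun q => row a (frame j c q)) p)
                (row b (frame j c p)))%:C *: (E a *m E b *m psi j p).

Definition quasi_killing (xi : idx A -> M -> 'rV[R]_n)
    (eta : idx A -> M -> 'cV[R]_n) (a b : R)
    (psi : sidx P -> M -> 'cV[R[i]]_(spin_dim n)) : Prop :=
  [/\ spinor_field psi, nonzero_spinor psi &
    forall j c p, sdom j p -> dom c p -> forall v : 'rV[R]_n,
      nabla_spinor j c v psi p =
        a%:C *: (cmul j c p v *m psi j p)
        + (b * (v *m eta c p) 0 0)%:C *: (cmul j c p (xi c p) *m psi j p)].

Definition wk_equation (lambda : R)
    (psi : sidx P -> M -> 'cV[R[i]]_(spin_dim n)) : Prop :=
  forall j c p, sdom j p -> dom c p -> forall v : 'rV[R]_n,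
    let S := scal g c p in
    nabla_spinor j c v psi p =
      (n%:R / (2 * (n%:R - 1) * S) * dscal g c p v)%:C *: psi j p
      + (2 * lambda / ((n%:R - 2) * S))%:C *:
          (cmul j c p (Ric g c p v) *m psi j p)
      - (lambda / (n%:R - 2))%:C *: (cmul j c p v *m psi j p)
      + (1 / (2 * (n%:R - 1) * S))%:C *:
          (cmul j c p v *m (cmul j c p (grad_scal g c p) *m psi j p)).

Definition wk_spinor (psi : sidx P -> M -> 'cV[R[i]]_(spin_dim n)) : Prop :=
  [/\ (3 <= n)%N,
      forall c p, dom c p -> scal g c p != 0,
      spinor_field psi,
      nonzero_spinor psi &
      exists lambda : R, lambda != 0 /\ wk_equation lambda psi].

End SpinGeometry.

(* Main.v *)
(* Put al = +-1/2.  Differentiating the quasi-Killing equation shows how the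
   curvature, seen as a Clifford bivector, acts on psi.  A Clifford contraction
   (first Bianchi identity) turns this into a formula for Ric(X).psi in terms of
   X.psi, eta(X) xi.psi and phi(X).xi.psi; at X = xi, where Ric(xi) = 2m xi, it
   says that psi is an eigenvector of the fundamental 2-form for an extremal
   eigenvalue.  Extremality forces phi(X).xi.psi = 2 al (X - eta(X) xi).psi,
   because the sum over a frame of the squared norms of the differences
   vanishes.  Hence Ric = k g - d eta (x) eta with d = 8 al b and k = 2m + d
   where psi does not vanish, that is everywhere: |psi|^2 is locally constant
   and M is connected.  Now S is constant, and the weak Killing equation says
   that (u X + v eta(X) xi).psi = 0 for all X with u and v constant, i.e. that
   u = v = 0; eliminating the WK-number from these two equations gives b.

   The local computations take place in the commutative ring of smooth complex
   functions on an open subset of a chart, with the partial derivatives as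
   commuting derivations; vectors and forms are matrices over this ring. *)

From HB Require Import structures.
Require Import Defs.
From mathcomp Require Import ring lra.
Import Order.TTheory GRing.Theory Num.Theory.
Import numFieldNormedType.Exports.
Local Open Scope ring_scope.
Set Implicit Arguments.
Unset Strict Implicit.
Unset Printing Implicit Defensive.

(** * Clifford algebra and curvature tensors *)

(** Smooth functions have zero divisors, and their ring is even zero when the domain of a spin frame
    misses the chart. Hence the algebra is done over a [comPzRingType], where 1/2, 1/3 and 1/4 are
    given as elements [h], [t], [q] with their defining equations. Cancelling b and arguing by
    positivity must wait until everything is evaluated at a point, so the Ricci identities keep
    their factors [be] up to [ricci_form]. The value al = +-1/2 enters through e = 2 al with e^2 =
    1: the sum of squared norms is 2(n-1)(1 - e^2)|psi|^2, so it vanishes exactly because the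
    eigenvalue is extremal. The norm |psi|^2 is locally constant because, in a spin frame, the
    partial derivatives of psi are matrices applied to psi that combine Clifford vectors and skew
    bivectors with real coefficients; such matrices are skew-Hermitian. *)

Section CliffordAlgebra.
Variables (K : comPzRingType) (n N : nat) (E : 'I_n -> 'M[K]_N).
Hypothesis cliff : forall a b, E a *m E b + E b *m E a = (- 2 * (a == b)%:R)%:M.

Implicit Types (v w x : 'rV[K]_n) (A B f : 'M[K]_n) (a b c d : 'I_n).

Definition gam v : 'M[K]_N := \sum_a v 0 a *: E a.
(** The sum runs over all ordered pairs without a factor 1/2; hence the 4 in the commutators below
    and the 1/4 in the spin connection. *)
Definition bivec A : 'M[K]_N := \sum_a \sum_b A a b *: (E a *m E b).

Fact gam_is_linear : linear gam.
Proof.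
move=> k v w; rewrite /gam scaler_sumr -big_split; apply: eq_bigr => a _.
by rewrite !mxE scalerDl scalerA.
Qed.
HB.instance Definition _ := GRing.isLinear.Build K 'rV[K]_n 'M[K]_N _ gam
  gam_is_linear.

Fact bivec_is_linear : linear bivec.
Proof.
move=> k A B; rewrite /bivec scaler_sumr -big_split; apply: eq_bigr => a _.
rewrite scaler_sumr -big_split; apply: eq_bigr => b _.
by rewrite !mxE scalerDl scalerA.
Qed.
HB.instance Definition _ := GRing.isLinear.Build K 'M[K]_n 'M[K]_N _ bivec
  bivec_is_linear.

Lemma mulmx_gam p (P : 'M[K]_(p, N)) v :
  P *m gam v = \sum_a v 0 a *: (P *m E a).
Proof. by rewrite mulmx_sumr; apply: eq_bigr => a _; rewrite -scalemxAr. Qed.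

Lemma gam_mulmx p (P : 'M[K]_(N, p)) v :
  gam v *m P = \sum_a v 0 a *: (E a *m P).
Proof. by rewrite mulmx_suml; apply: eq_bigr => a _; rewrite -scalemxAl. Qed.

Lemma sum_delta (W : lmodType K) (s : 'I_n -> W) a :
  \sum_b (b == a)%:R *: s b = s a.
Proof.
rewrite (bigD1 a) //= eqxx scale1r big1 ?addr0 // => b /negPf ->.
by rewrite scale0r.
Qed.

Lemma gam_delta a : gam (delta_mx 0 a) = E a.
Proof.
rewrite /gam; under eq_bigr => b _ do rewrite mxE /=.
by rewrite sum_delta.
Qed.

Lemma gam_mul v A : gam (v *m A) = \sum_a v 0 a *: gam (row a A).
Proof.
rewrite mulmx_sum_row linear_sum; apply: eq_bigr => a _.
by rewrite linearZ.
Qed.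

Lemma gam_row a A : gam (row a A) = \sum_b A a b *: E b.
Proof. by apply: eq_bigr => b _; rewrite mxE. Qed.

Lemma bivecE A : bivec A = \sum_a E a *m gam (row a A).
Proof.
apply: eq_bigr => a _; rewrite gam_row mulmx_sumr.
by apply: eq_bigr => b _; rewrite scalemxAr.
Qed.

Lemma cliffC a b : E a *m E b = (- 2 * (a == b)%:R)%:M - E b *m E a.
Proof. by rewrite -cliff addrK. Qed.

(** Moving [E c] past two generators costs two signs, so the leading term is unchanged and only
    contractions are added. *)
Lemma cliff3 a b c : E a *m E b *m E c =
  E c *m (E a *m E b) + 2 *: ((a == c)%:R *: E b - (b == c)%:R *: E a).
Proof.
rewrite -mulmxA (cliffC b c) mulmxBr mul_mx_scalar.
rewrite [E a *m (_ *m _)]mulmxA (cliffC a c).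
rewrite mulmxBl mul_scalar_mx -[E c *m _ *m _]mulmxA.
move: (E c *m _) => P; apply/matrixP => i j; rewrite !mxE; ring.
Qed.

Lemma skewE A a b : A^T = - A -> A b a = - A a b.
Proof.
by move=> skA; have := congr1 (fun B : 'M[K]_n => B a b) skA; rewrite !mxE.
Qed.

Lemma sum_row_delta A c :
  \sum_a \sum_b A a b *: ((a == c)%:R *: E b) = gam (row c A).
Proof.
rewrite -(sum_delta (fun a => gam (row a A))); apply: eq_bigr => a _.
rewrite gam_row scaler_sumr; apply: eq_bigr => b _.
by rewrite !scalerA mulrC.
Qed.

Lemma sum_col_delta A c :
  \sum_a \sum_b A a b *: ((b == c)%:R *: E a) = gam (row c A^T).
Proof.
rewrite exchange_big -sum_row_delta; apply: eq_bigr => a _.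
by apply: eq_bigr => b _; rewrite mxE.
Qed.

(** Infinitesimal form of the covering of SO(n) by Spin(n): a quarter of [bivec A] acts on vectors,
    by commutator, as [A]. The two contractions of [cliff3] give a row of [A] and one of its
    transpose, which skewness adds up. *)
Lemma bivec_comm_E A c : A^T = - A ->
  bivec A *m E c - E c *m bivec A = 4 *: gam (row c A).
Proof.
move=> skA; transitivity (2 *: (gam (row c A) - gam (row c A^T))); last first.
  rewrite skA linearN linearN opprK -mulr2n -scaler_nat scalerA.
  by rewrite -natrM.
rewrite /bivec mulmx_suml mulmx_sumr -sumrB -sum_row_delta -sum_col_delta.
rewrite -sumrB scaler_sumr; apply: eq_bigr => a _.
rewrite mulmx_suml mulmx_sumr -!sumrB scaler_sumr; apply: eq_bigr => b _.
rewrite -scalemxAl -scalemxAr -scalerBr cliff3 addrC addKr.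
by rewrite [LHS]scalerA [A a b * _]mulrC -scalerA scalerBr.
Qed.

Lemma bivec_comm_gam A v : A^T = - A ->
  bivec A *m gam v - gam v *m bivec A = 4 *: gam (v *m A).
Proof.
move=> skA; rewrite gam_mul scaler_sumr mulmx_gam gam_mulmx -sumrB.
apply: eq_bigr => a _.
by rewrite -scalerBr bivec_comm_E // !scalerA mulrC.
Qed.

(** The commutator with [bivec A] is a derivation. Applied to [bivec B], written as the sum of the
    [E c *m gam (row c B)], it gives one term per factor, and [E1] evaluates the first. The bracket
    is reversed because matrices act on row vectors from the right. *)
Lemma bivec_comm A B : A^T = - A -> B^T = - B ->
  bivec A *m bivec B - bivec B *m bivec A = 4 *: bivec (B *m A - A *m B).
Proof.
move=> skA skB.
have E1 : \sum_a gam (row a A) *m gam (row a B) = - bivec (A *m B).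
  transitivity (\sum_a \sum_c A a c *: (E c *m gam (row a B))).
    apply: eq_bigr => a _; rewrite gam_row mulmx_suml; apply: eq_bigr => c _.
    by rewrite -scalemxAl.
  rewrite exchange_big bivecE -sumrN; apply: eq_bigr => c _ /=.
  rewrite row_mul gam_mul mulmx_sumr -sumrN; apply: eq_bigr => a _.
  by rewrite !mxE (skewE _ _ skA) scaleNr scalemxAr.
rewrite linearB /= scalerBr -scalerN -E1 [RHS]addrC.
have -> : bivec A *m bivec B = \sum_c bivec A *m E c *m gam (row c B).
  by rewrite [bivec B]bivecE mulmx_sumr; under eq_bigr do rewrite mulmxA.
have -> : bivec B *m bivec A = \sum_c E c *m gam (row c B) *m bivec A.
  by rewrite [bivec B]bivecE mulmx_suml.
rewrite -sumrB [bivec (B *m A)]bivecE.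
rewrite !scaler_sumr -big_split; apply: eq_bigr => c _ /=.
rewrite row_mul [4 *: (E c *m _)]scalemxAr -bivec_comm_gam //.
rewrite [4 *: (gam _ *m _)]scalemxAl -bivec_comm_E //.
rewrite mulmxBr mulmxBl !mulmxA.
move: (_ *m _ *m _) (_ *m _ *m _) (_ *m _ *m _) => P Q S.
by apply/matrixP => i j; rewrite !mxE; ring.
Qed.

(** * Clifford contraction of a tensor with the Bianchi symmetry *)

Section Contraction.
Variables (t : K) (t3 : t * 3 = 1).
Variable r : 'I_n -> 'I_n -> 'I_n -> K.
Hypothesis r_skew : forall d a b, r d b a = - r d a b.
Hypothesis r_diag : forall d a, r d a a = 0.
Hypothesis r_cycl : forall d a b, r d a b + r a b d + r b d a = 0.

Let trip (q : 'I_n -> 'I_n -> 'I_n -> K) : 'M[K]_N :=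
  \sum_d \sum_a \sum_b q d a b *: (E d *m E a *m E b).
Let ctr : 'M[K]_N := \sum_a (\sum_d r d a d) *: E a.

Let rot (W : nmodType) (X : 'I_n -> 'I_n -> 'I_n -> W) :
  \sum_d \sum_a \sum_b X a b d = \sum_d \sum_a \sum_b X d a b.
Proof.
rewrite exchange_big; apply: eq_bigr => a _.
by rewrite exchange_big.
Qed.

Let tripD2 (q : 'I_n -> 'I_n -> 'I_n -> K) (X : 'I_n -> 'I_n -> 'I_n -> 'M[K]_N)
    Y Z k :
  (forall d a b, E d *m E a *m E b = X d a b + k *: (Y d a b - Z d a b)) ->
  trip q = \sum_d \sum_a \sum_b q d a b *: X d a b +
    k *: (\sum_d \sum_a \sum_b q d a b *: Y d a b -
          \sum_d \sum_a \sum_b q d a b *: Z d a b).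
Proof.
move=> H; rewrite /trip.
rewrite -sumrB scaler_sumr -big_split; apply: eq_bigr => d _ /=.
rewrite -sumrB scaler_sumr -big_split; apply: eq_bigr => a _ /=.
rewrite -sumrB scaler_sumr -big_split; apply: eq_bigr => b _ /=.
by rewrite H scalerDr -scalerBr !scalerA mulrC.
Qed.

Let dl1 (X : 'I_n -> 'I_n -> 'I_n -> K) :
  \sum_d \sum_a \sum_b X d a b *: ((a == d)%:R *: E b) =
  \sum_b (\sum_d X d d b) *: E b.
Proof.
under [RHS]eq_bigr do rewrite scaler_suml.
rewrite [RHS]exchange_big; apply: eq_bigr => d _ /=.
rewrite -(sum_delta (fun a => \sum_b X d a b *: E b)).
apply: eq_bigr => a _; rewrite scaler_sumr; apply: eq_bigr => b _.
by rewrite !scalerA mulrC.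
Qed.

Let dl2 (X : 'I_n -> 'I_n -> 'I_n -> K) :
  \sum_d \sum_a \sum_b X d a b *: ((b == d)%:R *: E a) =
  \sum_a (\sum_d X d a d) *: E a.
Proof.
rewrite -(dl1 (fun d a b => X d b a)); apply: eq_bigr => d _.
by rewrite exchange_big.
Qed.

Let dl3 (X : 'I_n -> 'I_n -> 'I_n -> K) :
  \sum_d \sum_a \sum_b X d a b *: ((a == b)%:R *: E d) =
  \sum_a (\sum_d X a d d) *: E a.
Proof.
rewrite -(dl1 (fun d a b => X b a d)) exchange_big [RHS]exchange_big /=.
apply: eq_bigr => d _.
by rewrite exchange_big.
Qed.

(** Renaming the summation indices moves the rotation from the coefficients to the generators;
    [cliff3] restores their order at the price of contractions. *)
Let trip1 : trip (fun d a b => r a b d) = trip r - 2 *: ctr.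
Proof.
rewrite (@tripD2 _ (fun d a b => E a *m E b *m E d)
  (fun d a b => (a == d)%:R *: E b) (fun d a b => (b == d)%:R *: E a) (- 2));
  last by move=> d a b; rewrite (cliff3 a b d) -mulmxA scaleNr addrK.
rewrite (rot (fun d a b => r d a b *: (E d *m E a *m E b))) dl1 dl2 scaleNr.
congr (_ - _ *: _); rewrite [X in _ - X]big1 ?subr0 // => a _.
by rewrite big1 ?scale0r // => d _; rewrite r_diag.
Qed.

Let trip2 : trip (fun d a b => r b d a) = trip r - 4 *: ctr.
Proof.
rewrite (@tripD2 _ (fun d a b => E b *m E d *m E a)
  (fun d a b => (b == d)%:R *: E a) (fun d a b => (a == b)%:R *: E d) 2);
  last by move=> d a b; rewrite (cliff3 d a b) mulmxA [d == b]eq_sym.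
rewrite -[X in X + _](rot (fun d a b => r b d a *: (E b *m E d *m E a))).
rewrite dl2 dl3; congr (_ + _).
have -> : \sum_a (\sum_d r d d a) *: E a = - ctr.
  rewrite /ctr -sumrN; apply: eq_bigr => a _; rewrite -scaleNr -sumrN.
  by congr (_ *: _); apply: eq_bigr => d _; rewrite r_skew.
by rewrite -opprD scalerN -mulr2n -scaler_nat scalerA -natrM.
Qed.

(** The three rotations of the coefficients add up to zero, while each rotated triple sum is
    [trip r] minus a multiple of [ctr]. So 3 [trip r] = (2 + 4) [ctr], and [t] divides by 3. *)
Lemma contract3 : \sum_d \sum_a \sum_b r d a b *: (E d *m E a *m E b) =
  2 *: \sum_a (\sum_d r d a d) *: E a.
Proof.
rewrite -/(trip r) -/ctr.
have : trip r + trip (fun d a b => r a b d) + trip (fun d a b => r b d a) = 0.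
  rewrite /trip -!big_split big1 // => d _.
  rewrite -!big_split big1 // => a _; rewrite -!big_split big1 // => b _ /=.
  by rewrite -!scalerDl r_cycl scale0r.
rewrite trip1 trip2; move: (trip r) ctr => T C H.
rewrite -[T]scale1r -t3 -scalerA.
have -> : 3 *: T = 6 *: C.
  apply/eqP; rewrite -subr_eq0 -H; apply/eqP/matrixP => i j.
  rewrite !mxE; ring.
rewrite scalerA; have -> : t * 6 = t * 3 * 2 by ring.
by rewrite t3 mul1r.
Qed.

End Contraction.

End CliffordAlgebra.

(** * Algebraic curvature tensors and their Ricci contraction *)

Section AlgebraicCurvature.
Variables (K : comPzRingType) (n : nat) (Rm : 'I_n -> 'I_n -> 'M[K]_n).
Variables (h t : K).
Hypotheses (h2 : h * 2 = 1) (t3 : t * 3 = 1).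
Hypothesis Rm_anti : forall a b, Rm b a = - Rm a b.
Hypothesis Rm_skew : forall a b, (Rm a b)^T = - Rm a b.
Hypothesis Rm_bianchi :
  forall a b c d, Rm a b c d + Rm b c a d + Rm c a b d = 0.

(** With [Rm a b c d] read as g(R(e_a, e_b) e_c, e_d), this is the Ricci tensor in an orthonormal
    frame. *)
Definition contraction : 'M[K]_n := \matrix_(b, c) \sum_d Rm d b c d.

Let anti a b c d : Rm b a c d = - Rm a b c d.
Proof. by rewrite Rm_anti mxE. Qed.

Let skew a b c d : Rm a b d c = - Rm a b c d.
Proof. exact: skewE. Qed.

Lemma half_inj (x y : K) : x *+ 2 = y *+ 2 -> x = y.
Proof.
by move=> xy; rewrite -[x]mul1r -[y]mul1r -h2 -!mulrA ![2 * _]mulr_natl xy.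
Qed.

(** Four instances of the Bianchi identity, combined with suitable signs, leave twice the difference
    of the two sides. *)
Lemma curv_pair_sym a b c d : Rm a b c d = Rm c d a b.
Proof.
have := Rm_bianchi a b c d; rewrite (anti a c) => e1.
have := Rm_bianchi a b d c; rewrite (skew a b c d) (anti a d) => e2.
have := Rm_bianchi a c d b.
rewrite (skew a c b d) (anti a d) (skew a d b c) => e3.
have := Rm_bianchi b c d a.
rewrite (skew b c a d) (skew c d a b) (anti b d) (skew b d a c) => e4.
move: e1 e2 e3 e4; set u := Rm a b c d; set u' := Rm c d a b.
set v := Rm a c b d; set v' := Rm b d a c; set w := Rm a d b c.
set w' := Rm b c a d => e1 e2 e3 e4.
apply: half_inj; apply/eqP; rewrite -subr_eq0; apply/eqP.
transitivity ((u + w' - v) - (- u + v' - w) - (- v + u' - - w)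
  + (- w' - u' - - v')); first by ring.
by rewrite e1 e2 e3 e4 !subr0 addr0.
Qed.

Lemma contraction_sym : contraction^T = contraction.
Proof.
apply/matrixP => b c; rewrite !mxE; apply: eq_bigr => d _.
by rewrite curv_pair_sym anti skew opprK.
Qed.

(** Since the contraction is symmetric, entry b of the left side is the sum over d of entry d of
    [x *m Rm d b]. The hypothesis turns it into n x_b from the first term, less x_b from the
    second. *)
Lemma contraction_mul (x : 'rV[K]_n) :
  (forall a b, x *m Rm a b = x 0 b *: delta_mx 0 a - x 0 a *: delta_mx 0 b) ->
  x *m contraction = (n%:R - 1) *: x.
Proof.
move=> xR; rewrite -contraction_sym; apply/rowP => b; rewrite !mxE.
transitivity (\sum_d (x *m Rm d b) 0 d).
  under eq_bigr => c _ do rewrite !mxE mulr_sumr.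
  rewrite exchange_big; apply: eq_bigr => d _; rewrite mxE.
  by apply: eq_bigr.
transitivity (\sum_d (x 0 b - x 0 d * (b == d)%:R)).
  apply: eq_bigr => d _; rewrite xR !mxE !eqxx /= mulr1.
  by rewrite eq_sym.
rewrite sumrB sumr_const card_ord mulrBl mul1r mulr_natl; congr (_ - _).
rewrite (bigD1 b) //= eqxx mulr1 big1 ?addr0 // => d db.
by rewrite eq_sym (negPf db) mulr0.
Qed.

Variables (N : nat) (E : 'I_n -> 'M[K]_N).
Hypothesis cliff : forall a b, E a *m E b + E b *m E a = (- 2 * (a == b)%:R)%:M.

(** For fixed [a] this is [contract3] in the last three indices. [Rm_bianchi] cycles the first
    three; [flip] transports it by pair symmetry. *)
Lemma contract_curv a :
  \sum_b E b *m bivec E (Rm a b) = - 2 *: gam E (row a contraction).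
Proof.
transitivity (\sum_d \sum_b \sum_c Rm a d b c *: (E d *m E b *m E c)).
  apply: eq_bigr => d _; rewrite /bivec mulmx_sumr; apply: eq_bigr => b _.
  by rewrite mulmx_sumr; apply: eq_bigr => c _; rewrite -scalemxAr mulmxA.
rewrite (contract3 cliff t3 (r := fun d b c => Rm a d b c)) => [|d b c|d b|d b c].
- rewrite gam_row scaleNr -scalerN -sumrN; congr (_ *: _).
  apply: eq_bigr => b _; rewrite -scaleNr; congr (_ *: _).
  by rewrite mxE -sumrN; apply: eq_bigr => d _; exact: anti.
- exact: skew.
- by apply: half_inj; rewrite mulr2n {1}skew addNr mul0rn.
- have flip u v w : Rm a u v w = - Rm v w u a.
    by rewrite curv_pair_sym skew.
  by rewrite !(flip d, flip b, flip c) -!opprD Rm_bianchi oppr0.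
Qed.

End AlgebraicCurvature.

(** * Contraction of the curvature of a quasi-Killing spinor *)

Section CliffordContractions.
Variables (K : comPzRingType) (n N : nat) (E : 'I_n -> 'M[K]_N).
Variables (h : K) (h2 : h * 2 = 1).
Hypothesis cliff : forall a b, E a *m E b + E b *m E a = (- 2 * (a == b)%:R)%:M.
Implicit Types (v w x : 'rV[K]_n).
Notation gam := (gam E).

Lemma cliff_gam v w :
  gam v *m gam w + gam w *m gam v = (- 2 * (v *m w^T) 0 0)%:M.
Proof.
rewrite !mulmx_gam.
under eq_bigr => b _ do rewrite gam_mulmx scaler_sumr.
under [X in _ + X]eq_bigr => a _ do rewrite gam_mulmx scaler_sumr.
rewrite [X in _ + X]exchange_big -big_split /=.
under eq_bigr => b _.
  rewrite -big_split /=; under eq_bigr => a _.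
    rewrite !scalerA [v 0 a * _]mulrC -scalerDr cliff scale_scalar_mx.
    over.
  over.
rewrite mxE mulr_sumr raddf_sum; apply: eq_bigr => b _ /=.
rewrite (bigD1 b) //= big1 ?addr0 => [|a /negPf ->]; last first.
  by rewrite !mulr0 raddf0.
by rewrite eqxx mxE /=; congr (_%:M); ring.
Qed.

Lemma gam_sq x : gam x *m gam x = (- (x *m x^T) 0 0)%:M.
Proof.
have := cliff_gam x x; move: (gam x *m gam x) ((x *m x^T) 0 0) => P y e.
rewrite -[P]scale1r -h2 -scalerA -[2 *: P]/(2%:R *: P) scaler_nat mulr2n e.
by rewrite scale_scalar_mx mulrA mulrN h2 mulN1r.
Qed.

Lemma gamE_sq a : E a *m E a = (- 1)%:M.
Proof.
rewrite -gam_delta gam_sq; congr ((- _)%:M).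
by rewrite trmx_delta mul_delta_mx mxE !eqxx.
Qed.

Lemma gam_anticomm v w : v *m w^T = 0 -> gam v *m gam w = - (gam w *m gam v).
Proof.
move=> vw; apply/eqP; rewrite -addr_eq0 cliff_gam vw mxE mulr0.
by rewrite raddf0.
Qed.

Lemma sum_gam_gam : \sum_b E b *m E b = (- n%:R)%:M.
Proof.
under eq_bigr => b _ do rewrite gamE_sq.
by rewrite sumr_const card_ord -raddfMn /= mulNrn.
Qed.

Lemma gam_swap v b : E b *m gam v = - (gam v *m E b) - (2 * v 0 b)%:M.
Proof.
have := cliff_gam (delta_mx 0 b) v; rewrite gam_delta => /eqP.
rewrite -[X in _ == X]addr0 eq_sym -subr_eq => /eqP <-.
rewrite addr0 addrC; congr (- _ + _).
rewrite -rmorphN -mulNr; congr (_%:M); congr (_ * _).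
rewrite mxE (bigD1 b) //= big1 => [|c /negPf cb]; rewrite !mxE ?cb.
  by rewrite !eqxx mul1r addr0.
by rewrite andbF mul0r.
Qed.

Lemma sum_gam_conj v : \sum_b E b *m gam v *m E b = (n%:R - 2) *: gam v.
Proof.
under eq_bigr => b _.
  rewrite gam_swap mulmxBl mulNmx -mulmxA gamE_sq mul_mx_scalar mul_scalar_mx.
  rewrite -scalerA; over.
rewrite sumrB sumr_const card_ord -scaler_sumr scalerBl; congr (_ - _).
by rewrite scaleN1r opprK scaler_nat.
Qed.

Variables (x : 'rV[K]_n) (f : 'M[K]_n) (al be : K).
Hypotheses (xx : x *m x^T = 1%:M) (fx : f *m x^T = 0).
(** [x] and [f] stand for xi and phi in the frame; the quasi-Killing equation in the direction e_a
    is then nabla_a psi = [q a] psi. *)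
Let q a : 'M[K]_N := al *: E a + (be * x 0 a) *: gam x.

(** The summand without [E b] is the action of the spinor curvature on psi: the bracket after [be]
    comes from differentiating [q] with nabla_X xi = - phi X, the commutator from applying [q]
    twice. *)
Lemma contract_qk a :
  \sum_b E b *m (be *: (- (2 * f a b) *: gam x - x 0 b *: gam (row a f)
       + x 0 a *: gam (row b f)) + (q b *m q a - q a *m q b)) =
  - (2 * (n%:R - 1) * al ^+ 2 + 2 * al * be) *: E a
  - (2 * al * be * (n%:R - 2) * x 0 a) *: gam x
  - be *: (gam (row a f) *m gam x) + (be * x 0 a) *: bivec E f.
Proof.
have gx2 : gam x *m gam x = (- 1)%:M by rewrite gam_sq xx mxE.
(* The [be ^+ 2] terms cancel, both being multiples of the square of [gam x]. *)
have qc b : q b *m q a - q a *m q b = al ^+ 2 *: (E b *m E a - E a *m E b)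
  + (al * be * x 0 a) *: (E b *m gam x - gam x *m E b)
  + (al * be * x 0 b) *: (gam x *m E a - E a *m gam x).
  rewrite /q !mulmxDl !mulmxDr -!scalemxAl -!scalemxAr !scalerA.
  move: (E b *m E a) (E a *m E b) (E b *m gam x) (gam x *m E b).
  move: (gam x *m E a) (E a *m gam x) (gam x *m gam x) => P1 P2 P3 P4 P5 P6 P7.
  by apply/matrixP => i j; rewrite !mxE; ring.
have T1 : \sum_b f a b *: (E b *m gam x) = gam (row a f) *m gam x.
  by rewrite gam_row mulmx_suml; apply: eq_bigr => b _; rewrite scalemxAl.
have T2 : \sum_b x 0 b *: (E b *m gam (row a f)) = - (gam (row a f) *m gam x).
  rewrite -gam_mulmx gam_anticomm //; apply: trmx_inj.
  by rewrite trmx_mul trmxK -row_mul fx row0 trmx0.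
have TE v : \sum_b E b *m (E b *m gam v - gam v *m E b) =
    (- 2 * (n%:R - 1)) *: gam v.
  under eq_bigr => b _ do rewrite mulmxBr !mulmxA.
  rewrite sumrB -mulmx_suml sum_gam_gam sum_gam_conj mul_scalar_mx -scalerBl.
  by congr (_ *: _); ring.
have T6 : \sum_b x 0 b *: (E b *m (gam x *m E a - E a *m gam x)) =
    - 2 *: E a + (2 * x 0 a) *: gam x.
  rewrite -gam_mulmx mulmxBr mulmxA gx2 mul_scalar_mx gam_swap mulmxBr mulmxN.
  rewrite mulmxA gx2 mul_scalar_mx mul_mx_scalar.
  by apply/matrixP => i j; rewrite !mxE; ring.
have aux (P A1 A2 A3 A4 A5 A6 : 'M[K]_N) c1 c2 c3 c4 :
    P *m (be *: (- (2 * c1) *: A1 - c2 *: A2 + c3 *: A3) +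
          (al ^+ 2 *: A4 + c4 *: A5 + (al * be * c2) *: A6)) =
    be *: (- 2 *: (c1 *: (P *m A1)) - c2 *: (P *m A2) + c3 *: (P *m A3)) +
      al ^+ 2 *: (P *m A4) + c4 *: (P *m A5) +
      (al * be) *: (c2 *: (P *m A6)).
  rewrite !(mulmxDr, mulmxN) -!scalemxAr !(mulmxDr, mulmxN) -!scalemxAr.
  move: (P *m A1) (P *m A2) (P *m A3) (P *m A4) (P *m A5) (P *m A6).
  move=> ? ? ? ? ? ?.
  by apply/matrixP => i j; rewrite !mxE; ring.
transitivity (be *: (- 2 *: \sum_b f a b *: (E b *m gam x)
    - \sum_b x 0 b *: (E b *m gam (row a f))
    + x 0 a *: bivec E f)
  + al ^+ 2 *: \sum_b E b *m (E b *m E a - E a *m E b)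
  + (al * be * x 0 a) *: \sum_b E b *m (E b *m gam x - gam x *m E b)
  + (al * be) *: \sum_b x 0 b *: (E b *m (gam x *m E a - E a *m gam x))).
  rewrite bivecE !scaler_sumr -sumrB -big_split /= scaler_sumr -!big_split /=.
  by apply: eq_bigr => b _; rewrite qc aux.
rewrite T1 T2 -gam_delta !TE gam_delta T6.
by apply/matrixP => i j; rewrite !mxE; ring.
Qed.

Variables (Rm : 'I_n -> 'I_n -> 'M[K]_n) (t : K) (t3 : t * 3 = 1).
Hypothesis Rm_anti : forall a b, Rm b a = - Rm a b.
Hypothesis Rm_skew : forall a b, (Rm a b)^T = - Rm a b.
Hypothesis Rm_bianchi :
  forall a b c d, Rm a b c d + Rm b c a d + Rm c a b d = 0.
Hypothesis Rm_x :
  forall a b, x *m Rm a b = x 0 b *: delta_mx 0 a - x 0 a *: delta_mx 0 b.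
Variables (p : nat) (psi : 'M[K]_(N, p)).
Hypothesis al2 : 4 * al ^+ 2 = 1.
Hypothesis f_skew : f^T = - f.
Hypothesis Rm_psi : forall a b, bivec E (Rm a b) *m psi =
  4 *: ((be *: (- (2 * f a b) *: gam x - x 0 b *: gam (row a f)
       + x 0 a *: gam (row b f)) + (q b *m q a - q a *m q b)) *m psi).
Notation rho := (contraction Rm).

Let ricci_pre a : gam (row a rho) *m psi =
  (n%:R - 1 + 4 * al * be) *: (E a *m psi)
  + (4 * al * be * (n%:R - 2) * x 0 a) *: (gam x *m psi)
  + (2 * be) *: (gam (row a f) *m (gam x *m psi))
  - (2 * be * x 0 a) *: (bivec E f *m psi).
Proof.
have := contract_curv h2 t3 Rm_anti Rm_skew Rm_bianchi cliff a.
move/(congr1 (fun P => - h *: (P *m psi))).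
rewrite -scalemxAl scalerA mulrNN h2 scale1r => <-.
rewrite mulmx_suml; under eq_bigr => b _ do
  rewrite -mulmxA Rm_psi -scalemxAr mulmxA.
rewrite -scaler_sumr -mulmx_suml contract_qk scalerA.
have -> : - h * 4 = - 2 by rewrite -[4]/((2 * 2)%:R) natrM mulrA mulNr h2 mulN1r.
(* Inserting 4 al^2 = 1 matches the [al ^+ 2] term produced by [contract_qk]. *)
have -> : n%:R - 1 + 4 * al * be = (n%:R - 1) * (4 * al ^+ 2) + 4 * al * be.
  by rewrite al2 mulr1.
rewrite !mulmxDl !mulNmx -!scalemxAl -mulmxA.
move: (E a *m psi) (gam x *m psi) (gam _ *m _) (bivec _ _ *m _).
by move=> P1 P2 P3 P4; apply/matrixP => i j; rewrite !mxE; ring.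
Qed.

(** [ricci_pre] is summed against [x]: the left side is known from [contraction_mul], the phi term
    dies because [x *m f = 0], and what remains isolates the bivector. *)
Lemma bivec_qk : (2 * be) *: (bivec E f *m psi) =
  (4 * al * be * (n%:R - 1)) *: (gam x *m psi).
Proof.
have xf : x *m f = 0.
  by apply: trmx_inj; rewrite trmx_mul f_skew mulNmx fx oppr0 trmx0.
have := contraction_mul h2 Rm_anti Rm_skew Rm_bianchi Rm_x.
move/(congr1 (fun v => gam v *m psi)); rewrite linearZ /= -scalemxAl.
have sx : \sum_a x 0 a * x 0 a = 1.
  transitivity ((x *m x^T) 0 0); last by rewrite xx mxE.
  by rewrite mxE; apply: eq_bigr => a _; rewrite mxE.
have -> : gam (x *m rho) *m psi =
    (n%:R - 1 + 4 * al * be) *: (\sum_a x 0 a *: (E a *m psi))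
  + (\sum_a x 0 a * x 0 a) *: ((4 * al * be * (n%:R - 2)) *: (gam x *m psi))
  + (2 * be) *: ((\sum_a x 0 a *: gam (row a f)) *m (gam x *m psi))
  - (\sum_a x 0 a * x 0 a) *: ((2 * be) *: (bivec E f *m psi)).
  have := ricci_pre; move: (gam x *m psi) (bivec E f *m psi) => G B ricE.
  rewrite gam_mul !mulmx_suml !scaler_suml !scaler_sumr -!big_split -sumrB /=.
  apply: eq_bigr => a _; rewrite -!scalemxAl ricE.
  move: (E a *m psi) (gam _ *m _) => P1 P2.
  by apply/matrixP => i j; rewrite !mxE; ring.
rewrite sx -gam_mul xf linear0 -gam_mulmx mul0mx scaler0 addr0 !scale1r.
move/eqP; rewrite subr_eq => /eqP H.
move: H; move: (gam x *m psi) (bivec _ _ *m _) => P Q H.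
have -> : (2 * be) *: Q = (n%:R - 1) *: P + (2 * be) *: Q - (n%:R - 1) *: P.
  by rewrite addrC addKr.
rewrite -H; apply/matrixP => i j; rewrite !mxE; ring.
Qed.

Lemma ricci_qk a : gam (row a rho) *m psi =
  (n%:R - 1 + 4 * al * be) *: (E a *m psi)
  - (4 * al * be * x 0 a) *: (gam x *m psi)
  + (2 * be) *: (gam (row a f) *m (gam x *m psi)).
Proof.
rewrite ricci_pre [2 * be * x 0 a]mulrC -[(x 0 a * _) *: _]scalerA bivec_qk.
move: (E a *m psi) (gam x *m psi) (gam _ *m _) => P1 P2 P3.
by apply/matrixP => i j; rewrite !mxE; ring.
Qed.

End CliffordContractions.

(** * Connections over a ring with commuting derivations *)

Section Connections.
Variables (K : comPzRingType) (n : nat) (D : 'I_n -> {additive K -> K}).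
Hypothesis DM : forall k a b, D k (a * b) = D k a * b + a * D k b.
Hypothesis DC : forall k l a, D k (D l a) = D l (D k a).

Definition dmx k p q (A : 'M[K]_(p, q)) : 'M[K]_(p, q) := map_mx (D k) A.

Lemma dmxD k p q (A B : 'M[K]_(p, q)) : dmx k (A + B) = dmx k A + dmx k B.
Proof. exact: map_mxD. Qed.

Lemma dmxN k p q (A : 'M[K]_(p, q)) : dmx k (- A) = - dmx k A.
Proof. exact: map_mxN. Qed.

Lemma dmxC k l p q (A : 'M[K]_(p, q)) : dmx k (dmx l A) = dmx l (dmx k A).
Proof. by apply/matrixP => i j; rewrite !mxE. Qed.

Lemma dmxM k p q r (A : 'M[K]_(p, q)) (B : 'M[K]_(q, r)) :
  dmx k (A *m B) = dmx k A *m B + A *m dmx k B.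
Proof.
apply/matrixP => i j; rewrite !mxE raddf_sum -big_split.
by apply: eq_bigr => l _; rewrite !mxE DM.
Qed.

Lemma dmx_tr k p q (A : 'M[K]_(p, q)) : dmx k A^T = (dmx k A)^T.
Proof. by rewrite /dmx map_trmx. Qed.

Lemma D1 k : D k 1 = 0.
Proof. by apply: (addrI (D k 1)); rewrite addr0 -{3}[1]mulr1 DM mul1r mulr1. Qed.

Lemma dmx1 k p : dmx k (1%:M : 'M[K]_p) = 0.
Proof.
by apply/matrixP => i j; rewrite !mxE; case: eqP; rewrite ?D1 ?raddf0.
Qed.

(* Covariant derivative of a section of Hom(L, A): the connection form [L i]
   acts on the left and [A i] on the right. *)
Definition cov p q (L : 'I_n -> 'M[K]_p) (A : 'I_n -> 'M[K]_q) i
  (Y : 'M[K]_(p, q)) : 'M[K]_(p, q) := dmx i Y + L i *m Y + Y *m A i.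

Definition lcurv p (L : 'I_n -> 'M[K]_p) i j : 'M[K]_p :=
  dmx i (L j) - dmx j (L i) + (L i *m L j - L j *m L i).

(** Forms acting on the right compose in the opposite order, hence the quadratic term reversed with
    respect to [lcurv]. *)
Definition curv q (A : 'I_n -> 'M[K]_q) i j : 'M[K]_q :=
  dmx i (A j) - dmx j (A i) + (A j *m A i - A i *m A j).

(** Ricci identity. The mixed terms with one form on each side of [Y] are symmetric in i and j, so
    they drop out. *)
Lemma cov_comm p q (L : 'I_n -> 'M[K]_p) (A : 'I_n -> 'M[K]_q) i j
    (Y : 'M[K]_(p, q)) :
  cov L A i (cov L A j Y) - cov L A j (cov L A i Y) =
  lcurv L i j *m Y + Y *m curv A i j.
Proof.
rewrite /cov !dmxD !dmxM (dmxC i j) /lcurv /curv.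
rewrite !(mulmxDl, mulmxDr, mulmxBl, mulmxBr, mulmxN, mulNmx) !mulmxA.
move: (dmx _ _ *m Y) (dmx _ _ *m Y) (L i *m dmx j Y) (L j *m dmx i Y).
move: (dmx _ _ *m A _) (dmx _ _ *m A _) (Y *m dmx _ _) (Y *m dmx _ _).
move: (_ *m _ *m Y) (_ *m _ *m Y) (_ *m _ *m A _) (_ *m _ *m A _).
move: (dmx _ (dmx _ _)) (Y *m _ *m _) (Y *m _ *m _) => *.
by apply/matrixP => k l; rewrite !mxE; ring.
Qed.

Lemma cov0 p q (L : 'I_n -> 'M[K]_p) (A : 'I_n -> 'M[K]_q) i :
  cov L A i (0 : 'M[K]_(p, q)) = 0.
Proof.
rewrite /cov mulmx0 mul0mx !addr0.
by apply/matrixP => k l; rewrite !mxE raddf0.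
Qed.

Lemma lcurv0 p i j : lcurv (fun=> 0 : 'M[K]_p) i j = 0.
Proof.
by apply/matrixP => k l; rewrite /lcurv !mulmx0 !mxE !raddf0; ring.
Qed.

Lemma lcurvN p (A : 'I_n -> 'M[K]_p) i j :
  lcurv (fun k => - A k) i j = - curv A i j.
Proof.
rewrite /lcurv /curv !dmxN !mulNmx !mulmxN !opprK.
move: (dmx _ _) (dmx _ _) (_ *m _) (_ *m _) => P Q S T.
by apply/matrixP => k l; rewrite !mxE; ring.
Qed.

Lemma curv_anti q (A : 'I_n -> 'M[K]_q) i j : curv A j i = - curv A i j.
Proof. by rewrite /curv opprD !opprB. Qed.

Lemma curv_skew q (A : 'I_n -> 'M[K]_q) i j :
  (forall k, (A k)^T = - A k) -> (curv A i j)^T = - curv A i j.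
Proof.
move=> skA; rewrite /curv !linearD !linearN /= !trmx_mul -!dmx_tr !skA.
rewrite !dmxN !mulNmx !mulmxN.
move: (dmx _ _) (dmx _ _) (_ *m _) (_ *m _) => *.
by apply/matrixP => k l; rewrite !mxE; ring.
Qed.

(** * The Levi-Civita connection in coordinates and in an orthonormal frame *)

Section LeviCivita.
Variables (F G H : 'M[K]_n) (h : K).
Hypotheses (h2 : h * 2 = 1) (Dh : forall k, D k h = 0).
Hypotheses (FGF : F *m G *m F^T = 1%:M) (Gsym : G^T = G).
Hypotheses (HE : H = G *m F^T) (HF : H *m F = 1%:M).

(* (lc i) j l is the Christoffel symbol Gamma^l_{ij} of the metric G, whose
   inverse is F^T F for an orthonormal frame F. *)
Definition lc i : 'M[K]_n := \matrix_(j, l) (h * \sum_k (F^T *m F) l k *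
  (D i (G j k) + D j (G i k) - D k (G i j))).

(** [H] is the inverse of the frame obtained without inverting a matrix over the ring; row i of [H]
    holds the frame components of the coordinate field d_i. *)
Lemma FH : F *m H = 1%:M. Proof. by rewrite HE mulmxA. Qed.

Lemma lc_tors i j : row j (lc i) = row i (lc j).
Proof.
apply/rowP => l; rewrite !mxE; congr (_ * _); apply: eq_bigr => k _.
congr (_ * (_ - _)); first by rewrite addrC.
by rewrite -{1}Gsym mxE.
Qed.

Lemma lc_lower i j k : (lc i *m G) j k =
  h * (D i (G j k) + D j (G i k) - D k (G i j)).
Proof.
pose C : 'M[K]_n := \matrix_(j, k) (D i (G j k) + D j (G i k) - D k (G i j)).
have HF' : F^T *m F *m G = 1%:M.
  by apply: trmx_inj; rewrite trmx1 !trmx_mul trmxK Gsym mulmxA -HE.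
have -> : lc i = h *: (C *m (F^T *m F)).
  apply/matrixP => a b; rewrite !mxE; congr (_ * _); apply: eq_bigr => c _.
  rewrite [C _ _]mxE mulrC; congr (_ * _).
  by rewrite !mxE; apply: eq_bigr => d _; rewrite !mxE mulrC.
by rewrite -scalemxAl -mulmxA HF' mulmx1 !mxE.
Qed.

Lemma lc_compat i : dmx i G = lc i *m G + (lc i *m G)^T.
Proof.
apply/matrixP => j k; rewrite [in RHS]mxE [_^T _ _]mxE !lc_lower mxE.
have sG a b : G a b = G b a by rewrite -{1}Gsym mxE.
rewrite -mulrDr (sG k j) -[LHS]mul1r -h2 -mulrA.
by congr (_ * _); ring.
Qed.

(** Torsion-freeness identifies rows of the different [lc]; the terms of the cyclic sum then cancel
    in pairs. *)
Lemma lc_bianchi i j k : row k (curv lc i j) + row i (curv lc j k)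
  + row j (curv lc k i) = 0.
Proof.
have rd a b c : row a (dmx b (lc c)) = dmx b (row a (lc c)).
  by apply/rowP => l; rewrite !mxE.
rewrite /curv !(linearD, linearN) /= !rd !row_mul.
rewrite (lc_tors j k) (lc_tors i k) (lc_tors i j).
move: (dmx _ _) (dmx _ _) (dmx _ _) (_ *m _) (_ *m _) (_ *m _).
move=> *; apply/rowP => l; rewrite !mxE; ring.
Qed.

(* The connection form of the frame F: nabla_i e_a = sum_b (Om i) a b e_b. *)
Definition Om i : 'M[K]_n := (dmx i F + F *m lc i) *m H.

Lemma cov_frame i : cov (fun i => - Om i) lc i F = 0.
Proof.
by rewrite /cov /Om mulNmx -mulmxA HF mulmx1 addrAC subrr.
Qed.

Lemma Om_skew i : (Om i)^T = - Om i.
Proof.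
have : dmx i (F *m G *m F^T) = 0 by rewrite FGF dmx1.
rewrite !dmxM dmx_tr lc_compat /Om HE.
move=> E0; apply/eqP; rewrite -addr_eq0 -{}E0; apply/eqP.
rewrite !(mulmxDl, mulmxDr, trmx_mul, linearD) /= !trmxK Gsym !trmx_mul !mulmxA.
move: (_ *m _) (_ *m _) (_ *m _) (_ *m _) => *.
by apply/matrixP => k l; rewrite !mxE; ring.
Qed.

Lemma dH i : dmx i H = lc i *m H - H *m Om i.
Proof.
have : dmx i (H *m F) = 0 by rewrite HF dmx1.
rewrite dmxM => /(congr1 (fun P => P *m H)).
rewrite mul0mx mulmxDl -mulmxA FH mulmx1 => /eqP.
rewrite addr_eq0 => /eqP ->.
rewrite /Om mulmxDl mulmxDr !mulmxA HF mul1mx opprD addrCA subrr addr0.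
by [].
Qed.

(** The frame is parallel for [- Om] on its left and [lc] on its right, so the Ricci identity for
    [F] has left side 0. *)
Lemma F_curv i j : F *m curv lc i j = curv Om i j *m F.
Proof.
have := cov_comm (fun i => - Om i) lc i j F.
rewrite !cov_frame !cov0 subrr lcurvN mulNmx.
by move/esym/eqP; rewrite addrC subr_eq0 => /eqP.
Qed.

Lemma cov_H i : cov (fun i => - lc i) Om i H = 0.
Proof. by rewrite /cov dH mulNmx addrAC subrK subrr. Qed.

(** Leibniz rule with a free intermediate connection [B]: its contributions to the two factors are
    opposite. *)
Lemma cov_mul p q r (L : 'I_n -> 'M[K]_p) (B : 'I_n -> 'M[K]_q)
    (A : 'I_n -> 'M[K]_r) i (X : 'M[K]_(p, q)) (Y : 'M[K]_(q, r)) :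
  cov L A i (X *m Y) = cov L B i X *m Y + X *m cov (fun i => - B i) A i Y.
Proof.
rewrite /cov dmxM !(mulmxDl, mulmxDr, mulNmx, mulmxN) !mulmxA.
move: (_ *m _) (_ *m _) (_ *m _) (_ *m _) (_ *m _) => *.
by apply/matrixP => k l; rewrite !mxE; ring.
Qed.

Lemma dmx_ip p q i (v : 'M[K]_(p, n)) (w : 'M[K]_(q, n)) :
  dmx i (v *m w^T) =
  cov (fun=> 0) Om i v *m w^T + v *m (cov (fun=> 0) Om i w)^T.
Proof.
rewrite dmxM dmx_tr /cov !mul0mx !addr0 [(_ + _)^T]linearD /= trmx_mul Om_skew.
rewrite mulmxDl mulmxDr mulNmx mulmxN !mulmxA addrACA -[LHS]addr0.
by congr (_ + _); rewrite subrr.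
Qed.

Lemma cov_y i j : cov (fun=> 0) Om i (row j H) = row j (lc i *m H).
Proof.
have e : dmx i (row j H) = row j (dmx i H) by apply/rowP => k; rewrite !mxE.
by rewrite /cov mul0mx addr0 e -row_mul -linearD /= dH subrK.
Qed.

Section Sasaki.
Variables (phi : 'M[K]_n) (xi : 'rV[K]_n) (eta : 'cV[K]_n).
Hypotheses (phi2 : phi *m phi = - 1%:M + eta *m xi) (xi_eta : xi *m eta = 1%:M).
Hypotheses (xi_phi : xi *m phi = 0) (phi_eta : phi *m eta = 0).
Hypotheses (G_xi : G *m xi^T = eta) (phiG : (phi *m G)^T = - (phi *m G)).
Hypothesis nabla_phi : forall i, cov (fun i => - lc i) lc i phi =
  col i G *m xi - eta *m delta_mx 0 i.

(** Frame components of xi, phi and the coordinate fields. *)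
Let x := xi *m H.
Let f := F *m phi *m H.
Let y i := row i H.

Lemma HHt : H *m H^T = G.
Proof. by rewrite HE trmx_mul trmxK -HE Gsym mulmxA HF mul1mx. Qed.

Lemma x_tr : x^T = F *m eta.
Proof. by rewrite -G_xi /x HE !trmx_mul trmxK Gsym mulmxA. Qed.

Lemma f_skew : f^T = - f.
Proof.
rewrite /f HE !mulmxA -[F *m phi *m G]mulmxA 2!trmx_mul trmxK phiG.
by rewrite mulNmx mulmxN !mulmxA.
Qed.

Lemma x_unit : x *m x^T = 1%:M.
Proof. by rewrite x_tr /x !mulmxA -[xi *m H *m F]mulmxA HF mulmx1. Qed.

Lemma f_x : f *m x^T = 0.
Proof.
rewrite x_tr /f -mulmxA [H *m _]mulmxA HF mul1mx -mulmxA phi_eta.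
by rewrite mulmx0.
Qed.

Lemma x_f : x *m f = 0.
Proof. by apply: trmx_inj; rewrite trmx_mul f_skew mulNmx f_x oppr0 trmx0. Qed.

Lemma f_sq : f *m f = - 1%:M + x^T *m x.
Proof.
rewrite /f !mulmxA -[F *m phi *m H *m F]mulmxA HF mulmx1.
rewrite -[F *m phi *m phi]mulmxA phi2 mulmxDr mulmxDl mulmxN mulmx1 mulNmx.
by rewrite FH x_tr /x !mulmxA.
Qed.

(** [F] and [H] are parallel for the mixed connections, so conjugating by them carries [nabla_phi]
    to the frame unchanged. *)
Lemma cov_f i : cov (fun i => - Om i) Om i f = (y i)^T *m x - x^T *m y i.
Proof.
rewrite /f -mulmxA (cov_mul _ lc) cov_frame mul0mx add0r.
rewrite (cov_mul _ lc) cov_H mulmx0 addr0 nabla_phi.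
rewrite mulmxBl mulmxBr !mulmxA -x_tr /x -[x^T *m _ *m H]mulmxA -rowE.
have -> : F *m col i G = (y i)^T by rewrite /y tr_row HE trmx_mul trmxK Gsym !colE mulmxA.
by [].

Qed.

End Sasaki.

Lemma scal11 p (a : 'M[K]_1) (Z : 'M[K]_(1, p)) : a *m Z = a 0 0 *: Z.
Proof. by rewrite {1}[a]mx11_scalar mul_scalar_mx. Qed.

(* From coordinate to frame indices. *)
Definition fr (W : lmodType K) (Z : 'I_n -> 'I_n -> W) a b : W :=
  \sum_i \sum_j (F a i * F b j) *: Z i j.

Lemma eq_fr (W : lmodType K) (Z Z' : 'I_n -> 'I_n -> W) a b :
  (forall i j, Z i j = Z' i j) -> fr Z a b = fr Z' a b.
Proof. by move=> e; do 2 apply: eq_bigr => ? _; rewrite e. Qed.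

Lemma fr_linear (W W' : lmodType K) (g : {linear W -> W'})
    (Z : 'I_n -> 'I_n -> W) a b :
  g (fr Z a b) = fr (fun i j => g (Z i j)) a b.
Proof.
rewrite linear_sum; apply: eq_bigr => i _; rewrite linear_sum.
by apply: eq_bigr => j _; rewrite linearZ.
Qed.

Lemma frD (W : lmodType K) (Z Z' : 'I_n -> 'I_n -> W) a b :
  fr (fun i j => Z i j + Z' i j) a b = fr Z a b + fr Z' a b.
Proof.
rewrite -big_split; apply: eq_bigr => i _; rewrite -big_split.
by apply: eq_bigr => j _; rewrite scalerDr.
Qed.

Lemma frN (W : lmodType K) (Z : 'I_n -> 'I_n -> W) a b :
  fr (fun i j => - Z i j) a b = - fr Z a b.
Proof.
rewrite -sumrN; apply: eq_bigr => i _; rewrite -sumrN.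
by apply: eq_bigr => j _; rewrite scalerN.
Qed.

Lemma fr_swap (W : lmodType K) (Z : 'I_n -> 'I_n -> W) a b :
  fr (fun i j => Z j i) a b = fr Z b a.
Proof.
rewrite /fr exchange_big; apply: eq_bigr => i _; apply: eq_bigr => j _.
by rewrite mulrC.
Qed.

Lemma fr_sep (W : lmodType K) (u : 'cV[K]_n) (y : 'I_n -> W) a b :
  fr (fun i j => u j 0 *: y i) a b = (F *m u) b 0 *: \sum_i F a i *: y i.
Proof.
rewrite scaler_sumr; apply: eq_bigr => i _.
rewrite mxE scaler_suml; apply: eq_bigr => j _.
by rewrite !scalerA; congr (_ *: _); ring.
Qed.

Lemma fr_bil (W : lmodType K) (A : 'M[K]_n) (y : W) a b :
  fr (fun i j => A i j *: y) a b = (F *m A *m F^T) a b *: y.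
Proof.
rewrite /fr exchange_big mxE scaler_suml; apply: eq_bigr => j _.
rewrite !mxE mulr_suml scaler_suml; apply: eq_bigr => i _.
by rewrite scalerA; congr (_ *: _); ring.
Qed.

Lemma fr_mul N (X Y : 'I_n -> 'M[K]_N) a b :
  fr (fun i j => X j *m Y i) a b =
  (\sum_j F b j *: X j) *m (\sum_i F a i *: Y i).
Proof.
rewrite mulmx_sumr; apply: eq_bigr => i _.
rewrite mulmx_suml; apply: eq_bigr => j _.
by rewrite -scalemxAl -scalemxAr scalerA mulrC.
Qed.

Lemma fr_mulmxr N p (X : 'I_n -> 'I_n -> 'M[K]_N) (psi : 'M[K]_(N, p)) a b :
  fr X a b *m psi = fr (fun i j => X i j *m psi) a b.
Proof. exact: (fr_linear (mulmxr psi)). Qed.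

Lemma frZ (W : lmodType K) (Z : 'I_n -> 'I_n -> W) k a b :
  fr (fun i j => k *: Z i j) a b = k *: fr Z a b.
Proof. by rewrite (fr_linear (GRing.scale k)). Qed.

Lemma sum_rowH a : \sum_i F a i *: row i H = delta_mx 0 a.
Proof.
rewrite -[RHS]mulmx1 -FH mulmxA -rowE mulmx_sum_row.
by apply: eq_bigr => i _; rewrite mxE.
Qed.

Definition Rm a b : 'M[K]_n := fr (curv Om) a b.

Lemma Rm_anti a b : Rm b a = - Rm a b.
Proof.
rewrite /Rm -[LHS]fr_swap -frN; apply: eq_fr => i j; exact: curv_anti.
Qed.

Lemma Rm_skew a b : (Rm a b)^T = - Rm a b.
Proof.
rewrite /Rm fr_linear -frN; apply: eq_fr => i j.
exact/curv_skew/Om_skew.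
Qed.

Lemma Om_curv i j : curv Om i j = F *m curv lc i j *m H.
Proof. by rewrite F_curv -mulmxA FH mulmx1. Qed.

(** The coordinate identity [lc_bianchi] is contracted with three frame vectors; the second and
    third triple sums are reindexed so that all three share the same coefficient. *)
Lemma Rm_bianchi a b c d : Rm a b c d + Rm b c a d + Rm c a b d = 0.
Proof.
pose B i j k := row k (curv lc i j) *m H.
have RE a' b' c' : row c' (Rm a' b') =
    \sum_i \sum_j \sum_k (F a' i * F b' j * F c' k) *: B i j k.
  rewrite /Rm /fr !linear_sum; apply: eq_bigr => i _.
  rewrite !linear_sum; apply: eq_bigr => j _; rewrite linearZ /= Om_curv.
  rewrite -mulmxA rowE mulmxA -rowE mulmx_sum_row scaler_sumr.
  by apply: eq_bigr => k _; rewrite scalerA mxE row_mul.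
suff: row c (Rm a b) + row a (Rm b c) + row b (Rm c a) = 0.
  by move/rowP/(_ d); rewrite !mxE.
rewrite !RE.
have -> : \sum_i \sum_j \sum_k (F b i * F c j * F a k) *: B i j k =
    \sum_i \sum_j \sum_k (F a i * F b j * F c k) *: B j k i.
  rewrite exchange_big; under eq_bigr do rewrite exchange_big /=.
  rewrite exchange_big; apply: eq_bigr => i _; rewrite exchange_big.
  apply: eq_bigr => j _; apply: eq_bigr => k _.
  by congr (_ *: _); ring.
have -> : \sum_i \sum_j \sum_k (F c i * F a j * F b k) *: B i j k =
    \sum_i \sum_j \sum_k (F a i * F b j * F c k) *: B k i j.
  rewrite exchange_big; apply: eq_bigr => i _; rewrite exchange_big.
  apply: eq_bigr => j _; apply: eq_bigr => k _.
  by congr (_ *: _); ring.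
rewrite -!big_split big1 // => i _; rewrite -!big_split big1 // => j _.
rewrite -!big_split big1 // => k _; rewrite /= -!scalerDr /B -!mulmxDl.
by rewrite lc_bianchi mul0mx scaler0.
Qed.

Definition ric_mx : 'M[K]_n := \matrix_(j, k) \sum_i curv lc i j k i.

(** Summing over the traced frame index multiplies [curv Om] by [F] on the right; [F_curv] turns
    this into the coordinate curvature, and the trace becomes a coordinate trace. *)
Lemma contraction_Rm : contraction Rm = F *m ric_mx *m F^T.
Proof.
apply/matrixP => b c; rewrite !mxE.
transitivity (\sum_i \sum_j F b j * (curv Om i j *m F) c i).
  rewrite /Rm /fr; under eq_bigr => d _.
    rewrite summxE; under eq_bigr => i _.
      rewrite summxE; under eq_bigr do rewrite mxE; over.
    over.
  rewrite exchange_big; apply: eq_bigr => i _ /=.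
  rewrite exchange_big; apply: eq_bigr => j _ /=.
  by rewrite mxE mulr_sumr; apply: eq_bigr => d _; ring.
rewrite exchange_big; under [RHS]eq_bigr => k _ do rewrite !mxE mulr_suml.
rewrite [RHS]exchange_big; apply: eq_bigr => j _ /=.
under [RHS]eq_bigr do rewrite -mulrA.
rewrite -!mulr_sumr; congr (_ * _).
under eq_bigr => i _ do rewrite -F_curv mxE.
rewrite exchange_big; apply: eq_bigr => k _; rewrite mxE mulr_suml.
by apply: eq_bigr => i _; rewrite mulrC.
Qed.

(** * Curvature acting on xi and on a quasi-Killing spinor *)

Section SasakiFrame.
Variables (x : 'rV[K]_n) (f : 'M[K]_n).
Hypotheses (x_unit : x *m x^T = 1%:M) (f_skew : f^T = - f).
Hypotheses (x_f : x *m f = 0) (f_sq : f *m f = - 1%:M + x^T *m x).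
Hypothesis cov_f : forall i,
  cov (fun i => - Om i) Om i f = (row i H)^T *m x - x^T *m row i H.

(** The Sasakian formula nabla_X xi = - phi X follows from the derivative of phi: differentiate
    [x *m f = 0] and multiply by [f]. As |xi| = 1 makes the derivative [N] orthogonal to [x],
    [f *m f] acts on it as -1. *)
Lemma cov_x i : cov (fun=> 0) Om i x = - (row i H *m f).
Proof.
have : dmx i (x *m x^T) = 0 by rewrite x_unit dmx1.
rewrite dmx_ip.
have : cov (fun=> 0) Om i (x *m f) = 0 by rewrite x_f cov0.
rewrite (cov_mul _ Om) cov_f.
set N := cov _ _ _ x => e1 e2.
have Nx : N *m x^T = 0.
  have e : N *m x^T + (N *m x^T)^T = 0 by rewrite trmx_mul trmxK.
  apply/matrixP => a b; rewrite !ord1 [RHS]mxE.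
  have := congr1 (fun P : 'M[K]_1 => P 0 0) e; rewrite mxE [_^T _ _]mxE [RHS]mxE.
  by move=> e'; apply: (half_inj h2); rewrite mulr2n mul0rn.
move: e1 => /(congr1 (fun P => P *m f)); rewrite mul0mx mulmxDl -[N *m f *m f]mulmxA f_sq.
rewrite [N *m (_ + _)]mulmxDr mulmxN mulmx1 [N *m (_ *m _)]mulmxA Nx mul0mx addr0.
rewrite mulmxBr mulmxBl !mulmxA -[x *m _ *m x *m f]mulmxA x_f mulmx0.
rewrite x_unit mul1mx add0r => /eqP.
by rewrite -opprD oppr_eq0 addr_eq0 => /eqP.
Qed.

(** Ricci identity for xi. In the second derivatives computed by [E], the Christoffel terms and the
    multiple of [x] are symmetric in the two directions; only the last term survives. *)
Lemma x_curv i j : x *m curv Om i j =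
  (H *m x^T) j 0 *: row i H - (H *m x^T) i 0 *: row j H.
Proof.
have := cov_comm (fun=> 0) Om i j x.
rewrite lcurv0 mul0mx add0r => <-.
have E k l : cov (fun=> 0) Om k (- (row l H *m f)) =
    - (row l (lc k *m H) *m f) - (row l H *m (row k H)^T) *m x
    + (H *m x^T) l 0 *: row k H.
  rewrite -mulNmx (cov_mul _ Om) cov_f.
  have -> : cov (fun=> 0) Om k (- row l H) = - row l (lc k *m H).
    by rewrite -cov_y /cov !mul0mx !addr0 dmxN mulNmx opprD.
  rewrite !mulNmx mulmxBr opprB !mulmxA addrA addrAC.
  by rewrite -[row l H *m x^T]row_mul (scal11 (row l _)) [row l _ 0 0]mxE.
rewrite !cov_x !E !(row_mul _ (lc _)) (lc_tors j i).
have -> : row j H *m (row i H)^T = row i H *m (row j H)^T.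
  have tr1 (a : 'M[K]_1) : a^T = a by apply/matrixP => u v; rewrite !ord1 mxE.
  by rewrite -[LHS]tr1 trmx_mul trmxK.
move: (_ *m f) (_ *m x) => P Q.
by apply/rowP => l; rewrite !mxE; ring.
Qed.

Lemma x_Rm a b :
  x *m Rm a b = x 0 b *: delta_mx 0 a - x 0 a *: delta_mx 0 b.
Proof.
rewrite /Rm -[LHS]/(mulmx x (fr _ _ _)) fr_linear.
rewrite (eq_fr _ _ x_curv) frD frN.
rewrite -[X in _ - X]fr_swap !(fr_sep (H *m x^T) (fun i => row i H)).
by rewrite !mulmxA FH mul1mx !mxE !sum_rowH.
Qed.

Variables (N : nat) (E : 'I_n -> 'M[K]_N).
Hypothesis cliff : forall a b, E a *m E b + E b *m E a = (- 2 * (a == b)%:R)%:M.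
Hypothesis DE : forall k a, dmx k (E a) = 0.
Variables (q al be : K).
Hypotheses (q4 : q * 4 = 1) (Dq : forall k, D k q = 0).
Hypotheses (Dal : forall k, D k al = 0) (Dbe : forall k, D k be = 0).

(* The spin connection; q stands for 1/4. *)
Definition som i : 'M[K]_N := q *: bivec E (Om i).

Lemma dmxZ k p r (a : K) (A : 'M[K]_(p, r)) :
  dmx k (a *: A) = D k a *: A + a *: dmx k A.
Proof. by apply/matrixP => i j; rewrite !mxE DM. Qed.

Lemma dmx_sum k p r (I : finType) (A : I -> 'M[K]_(p, r)) :
  dmx k (\sum_i A i) = \sum_i dmx k (A i).
Proof.
by apply/matrixP => i j; rewrite !mxE !summxE raddf_sum; apply: eq_bigr => ? _;
  rewrite !mxE.
Qed.

Lemma dmx_gam k v : dmx k (gam E v) = gam E (dmx k v).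
Proof.
rewrite dmx_sum; apply: eq_bigr => a _.
by rewrite dmxZ DE scaler0 addr0 mxE.
Qed.

Lemma dmx_bivec k A : dmx k (bivec E A) = bivec E (dmx k A).
Proof.
rewrite dmx_sum; apply: eq_bigr => a _; rewrite dmx_sum; apply: eq_bigr => b _.
by rewrite dmxZ dmxM !DE mul0mx mulmx0 addr0 scaler0 addr0 mxE.
Qed.

(** The quadratic term carries q^2 and [bivec_comm] supplies a 4, leaving [q]; the reversed bracket
    there is the one in [curv]. *)
Lemma som_curv i j : lcurv som i j = q *: bivec E (curv Om i j).
Proof.
rewrite /lcurv /som !dmxZ !Dq !scale0r !add0r !dmx_bivec.
rewrite -!scalemxAl -!scalemxAr -!scalerBr bivec_comm ?Om_skew //.
by rewrite [q *: (4 *: _)]scalerA q4 scale1r -scalerDr -!linearB -linearD.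
Qed.

(** Clifford multiplication is parallel: the commutator with [som i] is the action of [Om i] on the
    vector. *)
Lemma cov_gam i v : cov som (fun i => - som i) i (gam E v) =
  gam E (cov (fun=> 0) Om i v).
Proof.
rewrite /cov mul0mx addr0 dmx_gam linearD /= mulmxN -addrA; congr (_ + _).
rewrite -scalemxAl -scalemxAr -scalerBr bivec_comm_gam ?Om_skew //.
by rewrite scalerA q4 scale1r.
Qed.

(** The coordinate components of eta, and below them the quasi-Killing endomorphism in the direction
    d_i. *)
Let u := H *m x^T.
Let Q i := al *: gam E (row i H) + (be * u i 0) *: gam E x.

Lemma D_u i j : D i (u j 0) =
  (row j (lc i) *m u) 0 0 + (row j H *m f *m (row i H)^T) 0 0.
Proof.
have -> : u j 0 = (row j H *m x^T) 0 0 by rewrite -row_mul [RHS]mxE.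
transitivity (dmx i (row j H *m x^T) 0 0); first by rewrite [RHS]mxE.
rewrite dmx_ip cov_y cov_x [LHS]mxE; congr (_ + _).
  by rewrite row_mul /u mulmxA.
by rewrite linearN /= trmx_mul f_skew mulNmx opprK mulmxA.
Qed.

Lemma cov_Q i j : cov som (fun i => - som i) i (Q j) =
  al *: gam E (row j (lc i) *m H)
  + (be * (row j (lc i) *m u) 0 0) *: gam E x
  + (be * (row j H *m f *m (row i H)^T) 0 0) *: gam E x
  - (be * u j 0) *: gam E (row i H *m f).
Proof.
have covD p r (L : 'I_n -> 'M[K]_p) (A : 'I_n -> 'M[K]_r) k X Y :
    cov L A k (X + Y) = cov L A k X + cov L A k Y.
  rewrite /cov dmxD mulmxDl mulmxDr.
  by move: (_ *m _) (_ *m _) (_ *m _) (_ *m _) => *;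
    apply/matrixP => ? ?; rewrite !mxE; ring.
have covZ p r (L : 'I_n -> 'M[K]_p) (A : 'I_n -> 'M[K]_r) k a X :
    cov L A k (a *: X) = D k a *: X + a *: cov L A k X.
  rewrite /cov dmxZ -scalemxAl -scalemxAr.
  by move: (_ *m _) (_ *m _) => *; apply/matrixP => ? ?; rewrite !mxE; ring.
rewrite covD !covZ !cov_gam Dal scale0r add0r cov_y cov_x row_mul DM Dbe D_u.
rewrite linearN /=; move: (gam E _) (gam E _) (gam E _) => *.
by apply/matrixP => ? ?; rewrite !mxE; ring.
Qed.

Variables (p : nat) (psi : 'M[K]_(N, p)).
Hypothesis qk : forall i, cov som (fun=> 0) i psi = Q i *m psi.

(** Ricci identity for psi with the quasi-Killing equation used twice. Differentiating [Q j *m psi]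
    along i leaves [Q j *m Q i], whence the order in the commutator; the Christoffel terms of
    [cov_Q] cancel by [lc_tors]. *)
Lemma lcurv_qk i j : lcurv som i j *m psi =
  (be *: (((row j H *m f *m (row i H)^T) 0 0 -
           (row i H *m f *m (row j H)^T) 0 0) *: gam E x
    - u j 0 *: gam E (row i H *m f) + u i 0 *: gam E (row j H *m f))
   + (Q j *m Q i - Q i *m Q j)) *m psi.
Proof.
have := cov_comm som (fun=> 0) i j psi.
have -> : curv (fun=> 0 : 'M[K]_p) i j = 0.
  by apply/matrixP => k l; rewrite /curv !mulmx0 !mxE !raddf0; ring.
rewrite mulmx0 addr0 => <-.
rewrite !qk !(cov_mul _ (fun i => - som i)).
have e k (Y : 'M[K]_(N, p)) :
  cov (fun i0 => - - som i0) (fun=> 0) k Y = cov som (fun=> 0) k Y.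
  by rewrite /cov opprK.
rewrite !e !qk !cov_Q (lc_tors j i).
rewrite !mulmxA -!mulmxDl -mulmxBl; congr (_ *m psi).
move: (gam E (row j (lc i) *m H)) (gam E x) (gam E (row i H *m f)) => Y1 Y2 Y3.
move: (gam E (row j H *m f)) (Q j *m Q i) (Q i *m Q j) => Y4 Y5 Y6.
by apply/matrixP => ? ?; rewrite !mxE; ring.
Qed.

(** [lcurv_qk] contracted with two frame vectors; the 4 undoes the factor [q] of the spin
    connection. *)
Lemma Rm_qk a b : bivec E (Rm a b) *m psi =
  4 *: ((be *: (- (2 * f a b) *: gam E x - x 0 b *: gam E (row a f)
       + x 0 a *: gam E (row b f))
   + ((al *: E b + (be * x 0 b) *: gam E x) *m
        (al *: E a + (be * x 0 a) *: gam E x)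
    - (al *: E a + (be * x 0 a) *: gam E x) *m
        (al *: E b + (be * x 0 b) *: gam E x))) *m psi).
Proof.
have sumQ c : \sum_i F c i *: Q i = al *: E c + (be * x 0 c) *: gam E x.
  have -> : x 0 c = \sum_i F c i * u i 0.
    have <- : (F *m u) c 0 = \sum_i F c i * u i 0 by rewrite mxE.
    by rewrite /u mulmxA FH mul1mx mxE.
  have -> : E c = \sum_i F c i *: gam E (row i H).
    rewrite -gam_delta -sum_rowH linear_sum; apply: eq_bigr => i _.
    by rewrite linearZ.
  rewrite /Q; move: (gam E x) => X.
  rewrite scaler_sumr mulr_sumr scaler_suml -big_split.
  apply: eq_bigr => i _ /=; move: (gam E _) => *.
  by apply/matrixP => ? ?; rewrite !mxE; ring.
have gamf c : \sum_i F c i *: gam E (row i H *m f) = gam E (row c f).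
  transitivity (gam E ((\sum_i F c i *: row i H) *m f)).
    rewrite mulmx_suml linear_sum; apply: eq_bigr => i _.
    by rewrite -scalemxAl linearZ.
  by rewrite sum_rowH -rowE.
have FfF : F *m (H *m f *m H^T) *m F^T = f.
  by rewrite !mulmxA FH mul1mx -mulmxA -trmx_mul FH trmx1 mulmx1.
have -> : bivec E (Rm a b) *m psi =
    4 *: fr (fun i j => lcurv som i j *m psi) a b.
  rewrite -frZ /Rm (fr_linear (bivec E)) fr_mulmxr; apply: eq_fr => i j.
  by rewrite som_curv -scalemxAl scalerA [4 * q]mulrC q4 scale1r.
rewrite (eq_fr _ _ lcurv_qk) -fr_mulmxr; congr (4 *: (_ *m psi)).
rewrite frD frZ 2!frD !frN.
congr (be *: (_ - _ + _) + _).
- have bilE i j : (row j H *m f *m (row i H)^T) 0 0 = (H *m f *m H^T) j i.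
    rewrite -row_mul !mxE; apply: eq_bigr => k _.
    by rewrite !mxE.
  transitivity (fr (fun i j => (H *m f *m H^T)^T i j *: gam E x
      - (H *m f *m H^T) i j *: gam E x) a b).
    by apply: eq_fr => i j; rewrite !bilE scalerBl [_^T i j]mxE.
  rewrite frD frN !fr_bil FfF -scalerBl; congr (_ *: _).
  have -> : F *m (H *m f *m H^T)^T *m F^T = f^T.
    by rewrite -[in RHS]FfF [RHS]trmx_mul (trmx_mul F) trmxK mulmxA.
  by rewrite f_skew mxE; ring.
- rewrite (fr_sep u (fun i => gam E (row i H *m f))) gamf.
  by rewrite /u mulmxA FH mul1mx mxE.
- rewrite -[LHS]fr_swap (fr_sep u (fun i => gam E (row i H *m f))) gamf.
  by rewrite /u mulmxA FH mul1mx mxE.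
- rewrite frD frN -[X in _ - X]fr_swap !(fr_mul Q Q).
  by rewrite !sumQ.
Qed.

End SasakiFrame.

End LeviCivita.

End Connections.

(** * The extremal eigenvalue of the fundamental 2-form *)

Lemma sum_shift_sq (K : comPzRingType) (n N : nat) (E : 'I_n -> 'M[K]_N)
    (s : 'I_n -> K) (X : 'M[K]_N) :
  \sum_a (E a - s a *: X) *m (E a - s a *: X) =
  \sum_a E a *m E a - (\sum_a s a *: E a) *m X - X *m (\sum_a s a *: E a)
    + (\sum_a s a * s a) *: (X *m X).
Proof.
rewrite mulmx_sumr mulmx_suml scaler_suml -!sumrB -big_split.
apply: eq_bigr => a _ /=; rewrite mulmxBl !mulmxBr.
rewrite -!scalemxAl -!scalemxAr scalerA.
by rewrite opprB addrA addrAC.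
Qed.

Lemma sum_mul_pm (K : comPzRingType) (n N : nat) (C B : 'I_n -> 'M[K]_N)
    (e : K) (X : 'M[K]_N) :
  \sum_a (X *m C a + e *: B a) *m (C a *m X - e *: B a) =
  X *m (\sum_a C a *m C a) *m X - e *: (X *m \sum_a C a *m B a)
  + e *: ((\sum_a B a *m C a) *m X) - (e * e) *: \sum_a B a *m B a.
Proof.
rewrite mulmx_sumr mulmx_suml mulmx_sumr mulmx_suml !scaler_sumr.
rewrite -!sumrB -big_split -sumrB.
apply: eq_bigr => a _ /=; rewrite mulmxDl !mulmxBr.
by rewrite -!scalemxAl -!scalemxAr scalerA !mulmxA addrA.
Qed.

Section Adjoint.
Variables (K : comPzRingType) (cj : {rmorphism K -> K}).

(** The conjugation is a parameter because the adjoint is taken both over the complex numbers and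
    over the ring of smooth functions. *)
Definition adj p q (A : 'M[K]_(p, q)) : 'M[K]_(q, p) := (map_mx cj A)^T.

Lemma adjM p q r (A : 'M[K]_(p, q)) (B : 'M[K]_(q, r)) :
  adj (A *m B) = adj B *m adj A.
Proof. by rewrite /adj map_mxM trmx_mul. Qed.

Lemma adjD p q (A B : 'M[K]_(p, q)) : adj (A + B) = adj A + adj B.
Proof. by rewrite /adj map_mxD linearD. Qed.

Lemma adjN p q (A : 'M[K]_(p, q)) : adj (- A) = - adj A.
Proof. by rewrite /adj map_mxN linearN. Qed.

Lemma adjZ p q a (A : 'M[K]_(p, q)) : adj (a *: A) = cj a *: adj A.
Proof. by rewrite /adj map_mxZ linearZ. Qed.

Lemma adj_sum p q (I : finType) (A : I -> 'M[K]_(p, q)) :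
  adj (\sum_i A i) = \sum_i adj (A i).
Proof.
apply/matrixP => k l; rewrite !mxE !summxE rmorph_sum; apply: eq_bigr => i _.
by rewrite !mxE.
Qed.

Variables (n N : nat) (E : 'I_n -> 'M[K]_N).
Hypothesis E_skew : forall a, adj (E a) = - E a.

Lemma adj_gam (v : 'rV[K]_n) : map_mx cj v = v -> adj (gam E v) = - gam E v.
Proof.
move=> cv; rewrite adj_sum -sumrN; apply: eq_bigr => a _.
by rewrite adjZ E_skew scalerN -{2}cv mxE.
Qed.

Lemma adj_bivec (A : 'M[K]_n) : map_mx cj A = A -> A^T = - A ->
  adj (bivec E A) = - bivec E A.
Proof.
move=> cA skA; rewrite -linearN /= -skA /bivec adj_sum exchange_big /=.
apply: eq_bigr => a _; rewrite adj_sum; apply: eq_bigr => b _.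
have cAE u v : cj (A u v) = A u v by rewrite -[in RHS]cA mxE.
by rewrite adjZ adjM !E_skew mulNmx mulmxN opprK cAE mxE.
Qed.

Variables (h : K) (h2 : h * 2 = 1).
Hypothesis cliff : forall a b, E a *m E b + E b *m E a = (- 2 * (a == b)%:R)%:M.
Variables (x : 'rV[K]_n) (f : 'M[K]_n).
Hypotheses (cx : map_mx cj x = x) (cf : map_mx cj f = f).
Hypotheses (xx : x *m x^T = 1%:M) (f_skew : f^T = - f) (x_f : x *m f = 0).
Hypothesis (f_sq : f *m f = - 1%:M + x^T *m x).
Variables (e : K) (e2 : e * e = 1) (ce : cj e = e).

Let xi a := x 0 a *: gam E x.
(** With e = 2 al, [chi a] kills psi exactly when phi(X).xi.psi = 2 al (X - eta(X) xi).psi holds for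
    X = e_a. *)
Let chi a := gam E (row a f) *m gam E x - e *: (E a - xi a).

Let cxE a : cj (x 0 a) = x 0 a. Proof. by rewrite -[in RHS]cx mxE. Qed.

Let adj_chi a : adj (chi a) = gam E x *m gam E (row a f) + e *: (E a - xi a).
Proof.
rewrite /chi /xi adjD adjN adjZ adjD adjN adjZ adjM cxE ce !adj_gam //;
  last by rewrite map_row cf.
rewrite E_skew mulNmx mulmxN opprK; congr (_ + _).
by move: (E a) (gam E x) => Y Z; apply/matrixP => i j; rewrite !mxE; ring.
Qed.

Let f_x : f *m x^T = 0.
Proof. by rewrite -[f]opprK -f_skew mulNmx -trmx_mul x_f trmx0 oppr0. Qed.

Lemma bivec_gam_comm : bivec E f *m gam E x = gam E x *m bivec E f.
Proof.
apply/eqP; rewrite -subr_eq0 bivec_comm_gam // x_f.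
by rewrite (linear0 (gam E)) scaler0.
Qed.

(* The right-hand side kills the eigenvectors of [bivec E f] with extremal
   eigenvalue, hence so does every [chi a]. *)
Lemma sum_chi_sq : \sum_a adj (chi a) *m chi a =
  (2 * (n%:R - 1))%:M + (2 * e) *: (gam E x *m bivec E f).
Proof.
set X := gam E x.
have XX : X *m X = (- 1)%:M by rewrite (gam_sq h2 cliff) xx mxE.
have sx : \sum_a x 0 a * x 0 a = 1.
  transitivity ((x *m x^T) 0 0); last by rewrite xx mxE.
  by rewrite mxE; apply: eq_bigr => a _; rewrite mxE.
have S1 : \sum_a gam E (row a f) *m gam E (row a f) = (- (n%:R - 1))%:M.
  (* [f *m f^T] is the projection onto the orthogonal complement of [x], of trace n - 1. *)
  have -> : n%:R - 1 = \sum_a (row a f *m (row a f)^T) 0 0.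
    transitivity (\tr (f *m f^T)); last first.
      apply: eq_bigr => a _; rewrite !mxE; apply: eq_bigr => b _.
      by rewrite !mxE.
    rewrite f_skew mulmxN f_sq opprD opprK mxtraceD mxtrace1 linearN /=.
    by rewrite mxtrace_mulC xx mxtrace1.
  rewrite -sumrN raddf_sum; apply: eq_bigr => a _.
  by rewrite (gam_sq h2 cliff).
have S2 : \sum_a gam E (row a f) *m (E a - xi a) = - bivec E f.
  transitivity (\sum_a gam E (row a f) *m E a
      - (\sum_a x 0 a *: gam E (row a f)) *m X).
    rewrite mulmx_suml -sumrB; apply: eq_bigr => a _.
    by rewrite mulmxBr /xi -scalemxAr scalemxAl.
  rewrite -gam_mul x_f linear0 mul0mx subr0.
  rewrite -linearN /= -f_skew /bivec exchange_big; apply: eq_bigr => a _ /=.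
  rewrite gam_mulmx; apply: eq_bigr => b _.
  by rewrite !mxE.
have S3 : \sum_a (E a - xi a) *m gam E (row a f) = bivec E f.
  transitivity (\sum_a E a *m gam E (row a f)
      - X *m (\sum_a x 0 a *: gam E (row a f))).
    rewrite mulmx_sumr -sumrB; apply: eq_bigr => a _.
    by rewrite mulmxBl /xi -scalemxAl scalemxAr.
  by rewrite -gam_mul x_f linear0 mulmx0 subr0 -bivecE.
have S4 : \sum_a (E a - xi a) *m (E a - xi a) = (- (n%:R - 1))%:M.
  rewrite /xi sum_shift_sq.
  rewrite sx -/(gam E x) -/X XX scale1r (sum_gam_gam h2 cliff).
  by rewrite -!raddfN -!raddfD /=; congr (_%:M); ring.
under eq_bigr do rewrite adj_chi.
rewrite /chi (sum_mul_pm (fun a => gam E (row a f)) (fun a => E a - xi a)).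
rewrite S1 S2 S3 S4 bivec_gam_comm -/X e2 mul_mx_scalar -scalemxAl XX.
rewrite mulmxN; move: (X *m _) => Y.
rewrite scale_scalar_mx scale1r.
by apply/matrixP => i j; rewrite !mxE; case: (i == j); ring.
Qed.

Variable psi : 'cV[K]_N.
Hypothesis bivec_psi : bivec E f *m psi = (e * (n%:R - 1)) *: (gam E x *m psi).

(** On such a psi the operator of [sum_chi_sq] is the scalar 2(n-1)(1 - e^2), that is 0. *)
Lemma sum_chi_psi : \sum_a adj (chi a *m psi) *m (chi a *m psi) = 0.
Proof.
transitivity (adj psi *m (\sum_a adj (chi a) *m chi a) *m psi).
  rewrite mulmx_sumr mulmx_suml; apply: eq_bigr => a _.
  by rewrite adjM !mulmxA.
rewrite sum_chi_sq -mulmxA mulmxDl -scalemxAl -mulmxA bivec_psi -scalemxAr.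
rewrite mulmxA (gam_sq h2 cliff) xx !mul_scalar_mx !scalerA -scalerDl mxE /=.
have -> : 2 * (n%:R - 1) + 2 * e * (e * (n%:R - 1) * - 1%:R) =
  2 * (n%:R - 1) * (1 - e * e) :> K by ring.
by rewrite e2 subrr mulr0 scale0r mulmx0.
Qed.

End Adjoint.

Local Open Scope complex_scope.

(** * Positivity over the complex numbers and the Ricci tensor at a point *)

Section PointwiseSpinor.
Variables (R : rcfType) (n N : nat).
Notation C := R[i].
Notation cpx := (map_mx (real_complex R)).
Notation adjc := (adj (@conjc R)).

Lemma adjc_mul_ge0 (v : 'cV[C]_N) : 0 <= (adjc v *m v) 0 0.
Proof.
rewrite mxE; apply: sumr_ge0 => i _; rewrite !mxE mulrC; exact: mulcJ_ge0.
Qed.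

Lemma adjc_mul_eq0 (v : 'cV[C]_N) : (adjc v *m v) 0 0 = 0 -> v = 0.
Proof.
rewrite mxE => /eqP; rewrite psumr_eq0 => [/allP v0|i _]; last first.
  by rewrite !mxE mulrC; exact: mulcJ_ge0.
apply/colP => i; have := v0 i (mem_index_enum i).
by rewrite !mxE mulf_eq0 /= conjc_eq0 orbb => /eqP.
Qed.

Lemma adjc_mul_Re_eq0 (v : 'cV[C]_N) :
  (v == 0) = (complex.Re ((adjc v *m v) 0 0) == 0).
Proof.
apply/eqP/eqP => [->|e]; first by rewrite mulmx0 mxE.
apply: adjc_mul_eq0; have := ger0_Im (adjc_mul_ge0 v).
by move: e; case: ((adjc v *m v) 0 0) => a b /= -> ->.
Qed.

Lemma sum_adjc_mul_eq0 (I : finType) (v : I -> 'cV[C]_N) :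
  \sum_i adjc (v i) *m v i = 0 -> forall i, v i = 0.
Proof.
move=> /(congr1 (fun P : 'M[C]_1 => P 0 0)); rewrite summxE mxE => /eqP.
rewrite psumr_eq0 => [/allP v0 i|i _]; last exact: adjc_mul_ge0.
by apply: adjc_mul_eq0; apply/eqP/(v0 i); rewrite mem_index_enum.
Qed.

Variable E : 'I_n -> 'M[C]_N.
Hypothesis cliff : forall a b, E a *m E b + E b *m E a = (- 2 * (a == b)%:R)%:M.
Hypothesis E_skew : forall a, adjc (E a) = - E a.

Let h2 : (2^-1 : C) * 2 = 1.
Proof. by rewrite mulVf // pnatr_eq0. Qed.

Lemma real_cpx p q (A : 'M[R]_(p, q)) : map_mx (@conjc R) (cpx A) = cpx A.
Proof. by apply/matrixP => i j; rewrite !mxE /= oppr0. Qed.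

Variables (psi : 'cV[C]_N).
Hypothesis psi0 : psi != 0.

(** Clifford multiplication by [v] squares to -|v|^2. Reality of [v] is essential, as complex
    isotropic vectors can kill nonzero spinors. *)
Lemma gam_psi_inj (v : 'rV[R]_n) : gam E (cpx v) *m psi = 0 -> v = 0.
Proof.
move=> /(congr1 (mulmx (gam E (cpx v)))).
rewrite mulmx0 mulmxA (gam_sq h2 cliff) mul_scalar_mx => /eqP.
rewrite scaler_eq0 (negPf psi0) orbF oppr_eq0 => /eqP.
rewrite map_trmx -map_mxM mxE => /complexI vv.
apply/rowP => i; rewrite mxE; apply/eqP.
have : \sum_j v 0 j ^+ 2 = 0.
  by rewrite -[RHS]vv mxE; apply: eq_bigr => j _; rewrite mxE expr2.
move/eqP; rewrite psumr_eq0 => [/allP/(_ i (mem_index_enum i))|j _].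
  by rewrite /= sqrf_eq0.
exact: sqr_ge0.
Qed.

Variables (x : 'rV[R]_n) (f rho : 'M[R]_n) (al be : R).
Hypotheses (xx : x *m x^T = 1%:M) (f_skew : f^T = - f) (x_f : x *m f = 0).
Hypotheses (f_sq : f *m f = - 1%:M + x^T *m x).
Hypotheses (al2 : 4 * al ^+ 2 = 1) (be0 : be != 0).
Let xc : 'rV[C]_n := cpx x.
Let fc : 'M[C]_n := cpx f.
Let alc : C := al%:C.
Let bec : C := be%:C.
Hypothesis bivec_hyp : (2 * bec) *: (bivec E fc *m psi) =
  (4 * alc * bec * (n%:R - 1)) *: (gam E xc *m psi).
Hypothesis ricci_hyp : forall a, gam E (row a (cpx rho)) *m psi =
  (n%:R - 1 + 4 * alc * bec) *: (E a *m psi)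
  - (4 * alc * bec * xc 0 a) *: (gam E xc *m psi)
  + (2 * bec) *: (gam E (row a fc) *m (gam E xc *m psi)).

Lemma ricci_form : rho =
  (n%:R - 1 + 8 * al * be)%:M - (8 * al * be) *: (x^T *m x).
Proof.
pose e : C := 2 * alc.
have alc2 : 4 * alc ^+ 2 = 1.
  rewrite /alc -rmorphXn -[4](rmorph_nat (real_complex R)) -rmorphM /= al2.
  by [].
have e2 : e * e = 1 by rewrite -[RHS]alc2 /e; ring.
have ce : conjc e = e.
  have -> : e = (2 * al)%:C by rewrite /e [RHS]rmorphM [in RHS]rmorph_nat.
  exact: conjc_real.
have bec0 : 2 * bec != 0.
  by rewrite mulf_neq0 ?pnatr_eq0 // /bec (inj_eq (@complexI R)).
have bpsi : bivec E fc *m psi = (e * (n%:R - 1)) *: (gam E xc *m psi).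
  apply: (scalerI bec0); rewrite bivec_hyp scalerA; congr (_ *: _).
  by rewrite /e; ring.
have xxc : xc *m xc^T = 1%:M by rewrite map_trmx -map_mxM xx map_mx1.
have fsc : fc^T = - fc by rewrite map_trmx f_skew map_mxN.
have xfc : xc *m fc = 0 by rewrite -map_mxM x_f map_mx0.
have ffc : fc *m fc = - 1%:M + xc^T *m xc.
  by rewrite map_trmx -!map_mxM f_sq map_mxD map_mxN map_mx1.
have := sum_chi_psi E_skew h2 cliff (real_cpx x) (real_cpx f) xxc fsc xfc ffc
  e2 ce bpsi.
move=> /sum_adjc_mul_eq0 chi0.
apply/row_matrixP => a; apply/eqP; rewrite -subr_eq0; apply/eqP.
apply: gam_psi_inj.
have {chi0} := chi0 a; rewrite mulmxBl -scalemxAl mulmxBl -scalemxAl.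
move=> /eqP; rewrite subr_eq0 => /eqP H.
rewrite -mulmxA in H.
have -> : row a ((n%:R - 1 + 8 * al * be)%:M - (8 * al * be) *: (x^T *m x)) =
    (n%:R - 1 + 8 * al * be) *: delta_mx 0 a - (8 * al * be * x 0 a) *: x.
  rewrite linearB linearZ /= row_mul (mx11_scalar (row a x^T)) mul_scalar_mx.
  rewrite !mxE scalerA; congr (_ - _).
  by apply/rowP => j; rewrite !mxE !eqxx /= mulr_natr eq_sym.
have cZ k (v : 'rV[R]_n) : cpx (k *: v) = k%:C *: cpx v.
  by apply/rowP => j; rewrite !mxE rmorphM.
rewrite !map_mxB !cZ map_delta_mx -/xc map_row.
have gB v w : gam E (v - w) = gam E v - gam E w by exact: linearB.
have gZ k v : gam E (k *: v) = k *: gam E v by exact: linearZ.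
rewrite !gB !gZ !mulmxBl -!scalemxAl gam_delta.
have -> : (n%:R - 1 + 8 * al * be)%:C = n%:R - 1 + 8 * alc * bec.
  by rewrite !(rmorphM, rmorphD, rmorphN) rmorph1 !rmorph_nat.
have -> : (8 * al * be * x 0 a)%:C = 8 * alc * bec * xc 0 a.
  by rewrite !rmorphM rmorph_nat [xc 0 a]mxE.
(* By [H] the phi term is 2 be e = 4 al be times (E_a - x_a xi).psi, which raises both coefficients
   4 al be to 8 al be. *)
rewrite ricci_hyp H /e.
move: (xc 0 a) (E a *m psi) (gam E xc *m psi) => y P Q.
by apply/matrixP => i j; rewrite !mxE; ring.
Qed.

End PointwiseSpinor.

Local Open Scope classical_set_scope.
Local Open Scope ring_scope.
Local Open Scope complex_scope.

(** * Smooth functions *)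

Section SmoothFunctions.
Variables (R : realType) (n : nat) (V : set 'rV[R]_n).
Implicit Types (f g : 'rV[R]_n -> R).
Notation e_ k := (coord_vec R k).

Lemma Cinfty_cont f : Cinfty_on V f -> {in V, continuous f}.
Proof. by move=> /(_ 0%N)[]. Qed.

Lemma Cinfty_derivable f k x :
  Cinfty_on V f -> V x -> derivable f x (e_ k).
Proof. by move=> /(_ 1%N)[_ /(_ k)[+ _]]; apply. Qed.

Lemma Cinfty_D f k : Cinfty_on V f -> Cinfty_on V ('D_(e_ k) f).
Proof. by move=> Cf r; case: (Cf r.+1) => _ /(_ k)[]. Qed.

Lemma Cinfty_sub (U : set 'rV[R]_n) f :
  U `<=` V -> Cinfty_on V f -> Cinfty_on U f.
Proof.
move=> UV Cf r; move: (Cf r) => {Cf}; elim: r f => [|r IH] f [cf Df].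
  by split=> // x; rewrite inE => /UV Vx; apply: cf; rewrite inE.
split=> [x|k]; first by rewrite inE => /UV Vx; apply: cf; rewrite inE.
by case: (Df k) => dv Cr; split=> [x /UV|]; [exact: dv|exact: IH].
Qed.

Hypothesis oV : open V.

Lemma near_eq_on f g x : {in V, f =1 g} -> V x -> \forall y \near x, f y = g y.
Proof.
move=> fg Vx; near=> y; apply: fg; rewrite inE; near: y.
by apply: open_nbhs_nbhs.
Unshelve. all: by end_near. Qed.

Lemma derive_eq_on f g k :
  {in V, f =1 g} -> {in V, 'D_(e_ k) f =1 'D_(e_ k) g}.
Proof.
by move=> fg x; rewrite inE => Vx; exact: (near_eq_derive _ (near_eq_on fg Vx)).
Qed.

Lemma continuous_eq_on f g :
  {in V, f =1 g} -> {in V, continuous f} -> {in V, continuous g}.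
Proof.
move=> fg cf x xV; have Vx : V x by move: xV; rewrite inE.
have nfg := near_eq_cvg (near_eq_on fg Vx).
rewrite /continuous_at -(fg x xV).
exact: cvg_trans (nfg _) (cf x xV).
Qed.

(** Coinduction: a class of continuous functions stable under partial derivatives consists of smooth
    functions. Equality is asked only on [V], because the rules of differentiation are available
    only there. *)
Lemma Cinfty_coind (P : set ('rV[R]_n -> R)) :
  (forall f, P f -> {in V, continuous f}) ->
  (forall f k, P f -> (forall x, V x -> derivable f x (e_ k)) /\
     exists2 g, P g & {in V, 'D_(e_ k) f =1 g}) ->
  forall f g, P g -> {in V, f =1 g} -> Cinfty_on V f.
Proof.
move=> Pc Pd f g Pg fg r; elim: r f g Pg fg => [|r IH] f g Pg fg.
  split=> //; apply: continuous_eq_on (Pc _ Pg) => x xV.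
  by rewrite fg.
split=> [|k].
  by apply: continuous_eq_on (Pc _ Pg) => x xV; rewrite fg.
have [dg [h Ph gh]] := Pd _ k Pg; split=> [x Vx|].
  apply: near_eq_derivable (dg x Vx).
  by apply: near_eq_on => // y yV; rewrite fg.
apply: IH Ph _ => x xV; rewrite -gh //.
exact: derive_eq_on.
Qed.

Lemma Cinfty_eq_on f g : {in V, f =1 g} -> Cinfty_on V g -> Cinfty_on V f.
Proof.
move=> fg Cg; apply: (@Cinfty_coind (Cinfty_on V)) Cg fg => h.
  exact: Cinfty_cont.
move=> k Ch; split=> [x Vx|]; first exact: Cinfty_derivable.
by exists ('D_(e_ k) h) => //; exact: Cinfty_D.
Qed.

Lemma Cinfty_cst (a : R) : Cinfty_on V (cst a).
Proof.
apply: (@Cinfty_coind [set f | exists a, f = cst a] _ _ _ (cst a)) => //;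
  last by exists a.
- by move=> _ [c ->] x _; exact: cst_continuous.
- move=> _ k [c ->]; split=> [x _|]; first exact: derivable_cst.
  by exists (cst 0) => [|x _]; [by exists 0|rewrite derive_cst].
Qed.

Lemma Cinfty_add f g :
  Cinfty_on V f -> Cinfty_on V g -> Cinfty_on V (f + g).
Proof.
move=> Cf Cg; pose P := [set h | exists f g, [/\ Cinfty_on V f,
  Cinfty_on V g & h = f + g]].
apply: (@Cinfty_coind P _ _ _ (f + g)) => //; last by exists f, g.
- move=> _ [f1 [g1 [C1 C2 ->]]] x xV.
  by apply: continuousD; apply: Cinfty_cont xV.
- move=> _ k [f1 [g1 [C1 C2 ->]]]; split=> [x Vx|].
    by apply: derivableD; exact: Cinfty_derivable.
  exists ('D_(e_ k) f1 + 'D_(e_ k) g1).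
    by exists ('D_(e_ k) f1), ('D_(e_ k) g1); split=> //; exact: Cinfty_D.
  by move=> x; rewrite inE => Vx; rewrite deriveD //; exact: Cinfty_derivable.
Qed.

(* Unlike the plain products, these are stable under differentiation, as
   Cinfty_coind requires. *)
Inductive sum_of_products : ('rV[R]_n -> R) -> Prop :=
| sop_mul f g : Cinfty_on V f -> Cinfty_on V g -> sum_of_products (f * g)
| sop_add f g : sum_of_products f -> sum_of_products g ->
    sum_of_products (f + g).

Lemma Cinfty_mul f g :
  Cinfty_on V f -> Cinfty_on V g -> Cinfty_on V (f * g).
Proof.
move=> Cf Cg.
apply: (@Cinfty_coind sum_of_products _ _ _ (f * g)) => //; last exact: sop_mul.
- move=> h; elim=> {h} [h1 h2 C1 C2|h1 h2 _ C1 _ C2] x xV.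
    by apply: continuousM; apply: Cinfty_cont xV.
  by apply: continuousD; [exact: C1|exact: C2].
- move=> h k; elim=> {h} [h1 h2 C1 C2|h1 h2 _ [d1 [g1 s1 e1]] _ [d2 [g2 s2 e2]]].
    split=> [x Vx|]; first by apply: derivableM; exact: Cinfty_derivable.
    exists (h1 * 'D_(e_ k) h2 + h2 * 'D_(e_ k) h1).
      by apply: sop_add; apply: sop_mul => //; exact: Cinfty_D.
    move=> x; rewrite inE => Vx.
    by rewrite deriveM //; exact: Cinfty_derivable.
  split=> [x Vx|]; first by apply: derivableD; [exact: d1|exact: d2].
  exists (g1 + g2); first exact: sop_add.
  move=> x xV; have Vx : V x by move: xV; rewrite inE.
  by rewrite deriveD; [rewrite e1 // e2|exact: d1|exact: d2].
Qed.

End SmoothFunctions.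

(** * Mean value arguments: symmetry of mixed partials, functions with zero gradient *)

Section MixedPartials.
Variables (R : realType) (W : normedModType R).
Implicit Types (f : W -> R) (x u v : W).

Lemma is_derive_line f x v (t : R) : derivable f (t *: v + x) v ->
  is_derive t 1 (fun s => f (s *: v + x)) ('D_v f (t *: v + x)).
Proof.
move=> df.
have E : (fun h : R => h^-1 *: (((fun s => f (s *: v + x)) \o shift t) (h *: 1)
    - f (t *: v + x)))
  = (fun h : R => h^-1 *: ((f \o shift (t *: v + x)) (h *: v)
    - f (t *: v + x))).
  by apply/funext => h /=; rewrite [h *: 1]mulr1 scalerDl addrA.
by apply: DeriveDef; rewrite /derivable /derive E.
Qed.

Lemma MVT_line f x v (h : R) : 0 < h ->
  (forall t : R, 0 <= t <= h -> derivable f (t *: v + x) v) ->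
  exists2 c : R, 0 < c < h & f (h *: v + x) - f x = h * 'D_v f (c *: v + x).
Proof.
move=> h0 df.
have [| |c] := @MVT R (fun s => f (s *: v + x))
    (fun s => 'D_v f (s *: v + x)) 0 h h0.
- move=> t; rewrite in_itv /= => /andP[t0 th]; apply: is_derive_line.
  by apply: df; rewrite !ltW.
- apply: derivable_within_continuous => t; rewrite in_itv /= => tI.
  by have [] := is_derive_line (df t tI).
rewrite in_itv /= => cI; rewrite scale0r add0r subr0 mulrC => E.
by exists c.
Qed.

(** The mean value theorem along u is applied to the increment [F] of f in the direction h v, and
    then along v to the derivative of f along u. *)
Lemma second_difference f x u v (h : R) : 0 < h ->
  (forall s t : R, 0 <= s <= h -> 0 <= t <= h ->
     derivable f (s *: u + (t *: v + x)) u /\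
     derivable ('D_u f) (t *: v + (s *: u + x)) v) ->
  exists s t : R, [/\ 0 < s < h, 0 < t < h &
    f (h *: u + (h *: v + x)) - f (h *: u + x) - (f (h *: v + x) - f x) =
    h ^+ 2 * 'D_v ('D_u f) (t *: v + (s *: u + x))].
Proof.
move=> h0 df; have hI : 0 <= h <= h by rewrite lexx ltW.
have zI : 0 <= (0 : R) <= h by rewrite lexx ltW.
pose F := (f \o shift (h *: v)) - f.
have dS (t : R) : 0 <= t <= h ->
    derivable (f \o shift (h *: v)) (t *: u + x) u /\
    'D_u (f \o shift (h *: v)) (t *: u + x) =
    'D_u f (t *: u + (h *: v + x)).
  move=> tI.
  have [D _] := df _ _ tI hI.
  have E : (fun k : R => k^-1 *: (((f \o shift (h *: v)) \o shift (t *: u + x))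
       (k *: u) - (f \o shift (h *: v)) (t *: u + x)))
    = (fun k : R => k^-1 *: ((f \o shift (t *: u + (h *: v + x))) (k *: u)
       - f (t *: u + (h *: v + x)))).
    apply/funext => k /=; congr (_ *: (f _ - f _)).
      by rewrite -!addrA [x + _]addrC.
    by rewrite -addrA [x + _]addrC.
  by rewrite /derivable /derive E.
have dF (t : R) : 0 <= t <= h -> derivable F (t *: u + x) u /\
    'D_u F (t *: u + x) =
    'D_u f (t *: u + (h *: v + x)) - 'D_u f (t *: u + x).
  move=> tI; have [D1 D2] := dS t tI.
  have [D3 _] := df _ _ tI zI; rewrite scale0r add0r in D3.
  by split; [apply: derivableB|rewrite deriveB // D2].
have [t tI|s sI E] := MVT_line h0 (x := x) (v := u) (f := F).
  by have [] := dF t tI.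
have sI' : 0 <= s <= h by case/andP: sI => *; rewrite !ltW.
have [t tI|t tI E'] := MVT_line h0 (x := s *: u + x) (v := v) (f := 'D_u f).
  by have [] := df _ _ sI' tI.
exists s, t; split=> //.
rewrite expr2 -mulrA -E'.
have -> : h *: v + (s *: u + x) = s *: u + (h *: v + x) by rewrite addrCA.
have [_ <-] := dF s sI'; rewrite -E /F.
by rewrite !fctE /= -[h *: u + x + _]addrA ![x + h *: v]addrC.
Qed.

Lemma near_cube (P : set W) x u v : (\forall y \near x, P y) ->
  exists2 h : R, 0 < h & forall s t : R, 0 <= s <= h -> 0 <= t <= h ->
    P (s *: u + (t *: v + x)).
Proof.
move=> /nbhs_ballP[r /= r0 rP].
have N : 0 < `|u| + `|v| + 1 by rewrite ltr_wpDl // addr_ge0.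
(* The 1 in the denominator keeps it positive when u = v = 0. *)
pose h := r / 2 / (`|u| + `|v| + 1).
have h0 : 0 < h by rewrite !divr_gt0.
exists h => // s t /andP[s0 sh] /andP[t0 th].
apply: rP; rewrite -ball_normE /ball_ /= distrC addrA addrK.
apply: le_lt_trans (ler_normD _ _) _; rewrite !normrZ !ger0_norm //.
apply: (@le_lt_trans _ _ (h * (`|u| + `|v| + 1))).
  rewrite !mulrDr mulr1 -[leLHS]addr0; apply: lerD; last exact: ltW.
  by apply: lerD; apply: ler_wpM2r.
by rewrite divfK ?gt_eqF // ltr_pdivrMr // ltr_pMr // ltr1n.
Qed.

(** The second difference over a small parallelogram is symmetric in u and v, so [second_difference]
    expresses it through either mixed derivative, at two possibly different points; continuity at x
    makes both values close to those at x. *)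
Lemma derive_sym (V : set W) f x u v : open V -> V x ->
  (forall y, V y -> derivable f y u) -> (forall y, V y -> derivable f y v) ->
  (forall y, V y -> derivable ('D_u f) y v) ->
  (forall y, V y -> derivable ('D_v f) y u) ->
  {for x, continuous ('D_v ('D_u f))} -> {for x, continuous ('D_u ('D_v f))} ->
  'D_v ('D_u f) x = 'D_u ('D_v f) x.
Proof.
move=> oV Vx du dv duv dvu c1 c2.
set a := 'D_v _ x; set b := 'D_u _ x; apply/eqP; rewrite -subr_eq0 -normr_le0.
apply/ler_addgt0Pl => e e0; rewrite addr0.
have e2 : 0 < e / 2 by rewrite divr_gt0.
have N1 : \forall y \near x, `|a - 'D_v ('D_u f) y| < e / 2.
  by move/cvgrPdist_lt: c1; apply.
have N2 : \forall y \near x, `|b - 'D_u ('D_v f) y| < e / 2.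
  by move/cvgrPdist_lt: c2; apply.
have N3 : \forall y \near x, V y by exact: open_nbhs_nbhs.
have [h h0 H] := near_cube u v (filterI N3 (filterI N1 N2)).
have hh (s : R) : 0 < s < h -> 0 <= s <= h by case/andP => *; rewrite !ltW.
have [s t sI tI|s [t [sI tI E]]] := @second_difference f x u v h h0.
  have [Vst _] := H s t sI tI.
  by split; [exact: du|apply: duv; rewrite addrCA].
have [s' t' sI' tI'|t' [s' [tI' sI' E']]] := @second_difference f x v u h h0.
  have [Vst _] := H t' s' tI' sI'.
  by split; [apply: dv; rewrite addrCA|exact: dvu].
have [_ [+ _]] := H s t (hh _ sI) (hh _ tI).
have [_ [_ +]] := H s' t' (hh _ sI') (hh _ tI').
rewrite [s *: u + _]addrCA.
have -> : 'D_u ('D_v f) (s' *: u + (t' *: v + x))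
        = 'D_v ('D_u f) (t *: v + (s *: u + x)).
  have h2 : h ^+ 2 != 0 by rewrite expf_eq0 /= gt_eqF.
  apply: (mulfI h2); apply: etrans (esym E') (etrans _ E).
  have aux (p q r s0 : R) : p - q - (r - s0) = p - r - (q - s0).
    by rewrite !opprD !opprK addrACA.
  by rewrite [h *: v + (h *: u + x)]addrCA; exact: aux.
set z := 'D_v _ _ => l1 l2.
have -> : a - b = (a - z) - (b - z) by rewrite opprB addrA subrK.
apply: le_trans (ler_normB _ _) _.
apply: ltW; apply: lt_le_trans (ltrD l2 l1) _; by rewrite -splitr.
Qed.

End MixedPartials.

Lemma Cinfty_D_sym (R : realType) (n : nat) (V : set 'rV[R]_n) f k l x :
  open V -> Cinfty_on V f -> V x ->
  'D_(coord_vec R k) ('D_(coord_vec R l) f) x =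
  'D_(coord_vec R l) ('D_(coord_vec R k) f) x.
Proof.
move=> oV Cf Vx; have xV : x \in V by rewrite inE.
apply: (derive_sym oV Vx).
- by move=> y; apply: Cinfty_derivable.
- by move=> y; apply: Cinfty_derivable.
- by move=> y; apply: Cinfty_derivable; apply: Cinfty_D.
- by move=> y; apply: Cinfty_derivable; apply: Cinfty_D.
- by apply: Cinfty_cont xV; do 2 apply: Cinfty_D.
- by apply: Cinfty_cont xV; do 2 apply: Cinfty_D.
Qed.

Lemma line_const (R : realType) (W : normedModType R) (f : W -> R) x v
    (a b : R) : a <= b ->
  (forall t, a <= t <= b -> derivable f (t *: v + x) v /\
     'D_v f (t *: v + x) = 0) ->
  f (b *: v + x) = f (a *: v + x).
Proof.
move=> ab df; apply/eqP; rewrite -subr_eq0; apply/eqP.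
have [| |c cI ->] := @MVT_segment R (fun s => f (s *: v + x))
    (fun s => 'D_v f (s *: v + x)) a b ab.
- move=> t; rewrite in_itv /= => /andP[ta tb]; apply: is_derive_line.
  by apply: (df _ _).1; rewrite !ltW.
- apply: derivable_within_continuous => t; rewrite in_itv /= => tI.
  by have [] := is_derive_line (df t tI).1.
by rewrite (df c _).2 ?mul0r.
Qed.

Lemma ball_rowP (R : realType) n (x y : 'rV[R]_n) (r : R) :
  0 < r -> ball x r y <-> forall i, `|x 0 i - y 0 i| < r.
Proof.
move=> r0; split=> [[_ xy] i|xy]; first exact: xy.
by split=> // i j; rewrite ord1; exact: xy.
Qed.

(** Balls of row vectors are cubes, so one can go from x to y inside the ball by changing one
    coordinate at a time; [z k] has the first k coordinates already changed. *)
Lemma cube_const (R : realType) n (f : 'rV[R]_n -> R) x (r : R) : 0 < r ->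
  (forall y k, ball x r y -> derivable f y (coord_vec R k) /\
     'D_(coord_vec R k) f y = 0) ->
  forall y, ball x r y -> f y = f x.
Proof.
move=> r0 df y /(ball_rowP _ _ r0) xy.
pose z (k : nat) : 'rV[R]_n := \row_i (if (i < k)%N then y 0 i else x 0 i).
have Ez k : (k <= n)%N -> f (z k) = f x.
  elim: k => [|k IH] kn.
    by congr f; apply/rowP => i; rewrite mxE.
  rewrite -IH 1?ltnW //; pose K := Ordinal kn.
  (* With coordinate K erased, [w] is the base point of the line through [z k] and [z k.+1]. *)
  pose w : 'rV[R]_n := \row_i (if i == K then 0 else z k 0 i).
  have zE (t : R) i : (t *: coord_vec R K + w) 0 i = if i == K then t else z k 0 i.
    rewrite !mxE /=; case: eqP => _; rewrite ?mulr1 ?mulr0 ?addr0 //.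
    by rewrite add0r.
  have zk : z k = x 0 K *: coord_vec R K + w.
    apply/rowP => i; rewrite zE; case: eqP => // ->.
    by rewrite mxE ltnn.
  have zk1 : z k.+1 = y 0 K *: coord_vec R K + w.
    apply/rowP => i; rewrite zE !mxE ltnS leq_eqVlt.
    have [->|iK] := eqVneq i K; first by rewrite /= eqxx.
    by have /negPf -> : (i : nat) != k by apply: contra iK.
  rewrite zk zk1.
  have B (t : R) : `|x 0 K - t| < r -> ball x r (t *: coord_vec R K + w).
    move=> tr; apply/(ball_rowP _ _ r0) => i; rewrite zE.
    case: eqP => [->//|_]; rewrite mxE; case: ifP => _; first exact: xy.
    by rewrite subrr normr0.
  have := xy K.
  have [le|lt] := leP (x 0 K) (y 0 K) => xyr.
    apply: line_const => // t /andP[t1 t2]; apply: df; apply: B.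
    by apply: le_lt_trans xyr; rewrite !ler0_norm ?subr_le0 // lerN2 lerB.
  apply/esym; apply: line_const; first exact: ltW.
  move=> t /andP[t1 t2]; apply: df; apply: B.
  by apply: le_lt_trans xyr; rewrite !ger0_norm ?subr_ge0 ?(ltW lt) // lerB.
by rewrite -(Ez n) //; congr f; apply/rowP => i; rewrite mxE ltn_ord.
Qed.

(* Open sets bundled with their proof, so that the ring [sfun V] of smooth
   functions on V is canonically determined by V. *)
Record open_set (T : topologicalType) := OpenSet {
  pts : set T;
  open_pts : open pts }.

(** * The ring of smooth complex functions and its derivations *)

Section SmoothRing.
Variables (R : realType) (n : nat) (V : open_set 'rV[R]_n).

Notation point := {x : 'rV[R]_n | pts V x}.
Notation e_ k := (coord_vec R k).
Implicit Types (f g : point -> R[i]).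

(** Ring elements live on the subtype of points of [V], so that equality ignores everything outside;
    derivatives need a function on the whole space, and the value 0 outside the open set [V] does
    not affect them. *)
Definition extend (h : R[i] -> R) f (x : 'rV[R]_n) : R :=
  if pselect (pts V x) is left Vx then h (f (exist _ x Vx)) else 0.

Definition smooth : {pred point -> R[i]} := fun f =>
  `[< Cinfty_on (pts V) (extend (@complex.Re R) f) /\
      Cinfty_on (pts V) (extend (@complex.Im R) f) >].

Lemma extendE h f (x : point) : extend h f (sval x) = h (f x).
Proof.
case: x => x Vx; rewrite /extend /=; case: pselect => // Vx'.
by rewrite (Prop_irrelevance Vx' Vx).
Qed.

Lemma eq_extend h f (F : 'rV[R]_n -> R) :
  (forall x : point, h (f x) = F (sval x)) -> {in pts V, extend h f =1 F}.
Proof.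
move=> E x; rewrite inE => Vx.
by rewrite -[x]/(sval (exist _ x Vx : point)) extendE E.
Qed.

Lemma smoothP f (F G : 'rV[R]_n -> R) :
  (forall x : point, f x = F (sval x) +i* G (sval x)) ->
  Cinfty_on (pts V) F -> Cinfty_on (pts V) G -> f \in smooth.
Proof.
move=> E CF CG; apply/asboolP.
split; [apply: Cinfty_eq_on CF|apply: Cinfty_eq_on CG];
  do [exact: (@open_pts _ V)|by apply: eq_extend => x; rewrite E].
Qed.

Lemma subring_smooth : subring_closed smooth.
Proof.
have oV := @open_pts _ V.
split=> [|f g|f g].
- by apply: (@smoothP _ (cst 1) (cst 0)) => //; exact: Cinfty_cst.
- move=> /asboolP[f1 f2] /asboolP[g1 g2].
  apply: (@smoothP _ (extend (@complex.Re R) f + cst (- 1) * extend (@complex.Re R) g)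
    (extend (@complex.Im R) f + cst (- 1) * extend (@complex.Im R) g)).
  + move=> x; rewrite !fctE !extendE /=.
    by case: (f x) (g x) => a b [c d]; simpc.
  + by apply: Cinfty_add => //; apply: Cinfty_mul => //; apply: Cinfty_cst.
  + by apply: Cinfty_add => //; apply: Cinfty_mul => //; apply: Cinfty_cst.
- move=> /asboolP[f1 f2] /asboolP[g1 g2].
  apply: (@smoothP _ (extend (@complex.Re R) f * extend (@complex.Re R) g
      + cst (- 1) * (extend (@complex.Im R) f * extend (@complex.Im R) g))
    (extend (@complex.Re R) f * extend (@complex.Im R) g
      + extend (@complex.Im R) f * extend (@complex.Re R) g)).
  + move=> x; rewrite !fctE !extendE /=.
    by case: (f x) (g x) => a b [c d]; simpc.
  + by apply: Cinfty_add => //; repeat apply: Cinfty_mul => //;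
      apply: Cinfty_cst.
  + by apply: Cinfty_add => //; apply: Cinfty_mul.
Qed.
HB.instance Definition _ :=
  GRing.isSubringClosed.Build (point -> R[i]) smooth subring_smooth.

Record sfun := SFun { sfun_val :> point -> R[i]; sfunP : sfun_val \in smooth }.
HB.instance Definition _ := [isSub for sfun_val].
HB.instance Definition _ := [Choice of sfun by <:].
HB.instance Definition _ :=
  GRing.SubChoice_isSubComPzRing.Build (point -> R[i]) smooth sfun
    subring_smooth.

Implicit Types (a b : sfun) (k l : 'I_n).

Lemma sfun_eq a b : (forall x, a x = b x) -> a = b.
Proof. by move=> ab; apply/val_inj/funext. Qed.

Lemma sfunD a b x : (a + b) x = a x + b x. Proof. by []. Qed.
Lemma sfunM a b x : (a * b) x = a x * b x. Proof. by []. Qed.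
Lemma sfunN a x : (- a) x = - a x. Proof. by []. Qed.

Lemma sfun_Re a : Cinfty_on (pts V) (extend (@complex.Re R) a).
Proof. by have /asboolP[] := sfunP a. Qed.

Lemma sfun_Im a : Cinfty_on (pts V) (extend (@complex.Im R) a).
Proof. by have /asboolP[] := sfunP a. Qed.

Fact sfun_cst_subproof (z : R[i]) : (fun=> z) \in smooth.
Proof.
apply: (@smoothP _ (cst (complex.Re z)) (cst (complex.Im z))).
- by move=> x /=; case: z.
- exact: Cinfty_cst (@open_pts _ V) _.
- exact: Cinfty_cst (@open_pts _ V) _.
Qed.
Definition sfun_cst z := SFun (sfun_cst_subproof z).

Fact sfun_cst_is_additive : additive sfun_cst.
Proof. by move=> y z; apply: sfun_eq. Qed.
Fact sfun_cst_is_multiplicative : multiplicative sfun_cst.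
Proof. by split=> [y z|]; apply: sfun_eq. Qed.
HB.instance Definition _ :=
  GRing.isAdditive.Build R[i] sfun sfun_cst sfun_cst_is_additive.
HB.instance Definition _ :=
  GRing.isMultiplicative.Build R[i] sfun sfun_cst sfun_cst_is_multiplicative.

Definition ev (x : point) a : R[i] := a x.
Fact ev_is_additive x : additive (ev x). Proof. by []. Qed.
Fact ev_is_multiplicative x : multiplicative (ev x). Proof. by []. Qed.
HB.instance Definition _ x :=
  GRing.isAdditive.Build sfun R[i] (ev x) (ev_is_additive x).
HB.instance Definition _ x :=
  GRing.isMultiplicative.Build sfun R[i] (ev x) (ev_is_multiplicative x).

Fact sfun_conj_subproof a : (fun x => (a x)^*) \in smooth.
Proof.
apply: (@smoothP _ (extend (@complex.Re R) a) (cst (- 1) * extend (@complex.Im R) a)).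
- by move=> x; rewrite !fctE !extendE; case: (a x) => u v /=; rewrite mulN1r.
- exact: sfun_Re.
- apply: Cinfty_mul (sfun_Im a); first exact: (@open_pts _ V).
  exact: Cinfty_cst (@open_pts _ V) _.
Qed.
Definition sfun_conj a := SFun (sfun_conj_subproof a).

Fact sfun_conj_is_additive : additive sfun_conj.
Proof.
move=> a b; apply: sfun_eq => x.
change (((a x) - (b x))^* = (a x)^* - (b x)^*).
by case: (a x) (b x) => ? ? [? ?]; simpc; rewrite [- _ + _]addrC. Qed.
Fact sfun_conj_is_multiplicative : multiplicative sfun_conj.
Proof.
split=> [a b|]; apply: sfun_eq => x; last exact: conjc1.
change (((a x) * (b x))^* = (a x)^* * (b x)^*).
by case: (a x) (b x) => ? ? [? ?]; simpc.
Qed.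
HB.instance Definition _ :=
  GRing.isAdditive.Build sfun sfun sfun_conj sfun_conj_is_additive.
HB.instance Definition _ :=
  GRing.isMultiplicative.Build sfun sfun sfun_conj sfun_conj_is_multiplicative.

Definition der k f (x : point) : R[i] :=
  'D_(e_ k) (extend (@complex.Re R) f) (sval x) +i*
  'D_(e_ k) (extend (@complex.Im R) f) (sval x).

Fact sder_subproof k a : der k a \in smooth.
Proof.
apply: (@smoothP _ ('D_(e_ k) (extend (@complex.Re R) a))
  ('D_(e_ k) (extend (@complex.Im R) a))) => //; apply: Cinfty_D.
  exact: sfun_Re.
exact: sfun_Im.
Qed.
Definition sder k a := SFun (sder_subproof k a).

Lemma sderE k a (F G : 'rV[R]_n -> R) :
  (forall x : point, a x = F (sval x) +i* G (sval x)) ->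
  forall x : point, sder k a x = 'D_(e_ k) F (sval x) +i* 'D_(e_ k) G (sval x).
Proof.
move=> E x; rewrite /= /der; have xV : sval x \in pts V.
  by rewrite inE; case: x.
by congr (_ +i* _); apply: (derive_eq_on (@open_pts _ V)) xV;
   apply: eq_extend => y; rewrite E.
Qed.

Lemma sderB k a b : sder k (a - b) = sder k a - sder k b.
Proof.
apply: sfun_eq => x; have Vx : pts V (sval x) by case: x.
rewrite (@sderE _ _ (extend (@complex.Re R) a - extend (@complex.Re R) b)
   (extend (@complex.Im R) a - extend (@complex.Im R) b)).
  rewrite !deriveB /=; try by apply: Cinfty_derivable Vx;
    (exact: sfun_Re || exact: sfun_Im).
  by rewrite /der; simpc.
move=> y; rewrite sfunD sfunN !fctE !extendE; case: (a y) (b y) => ? ? [? ?].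
by simpc.
Qed.

Lemma sderM k a b : sder k (a * b) = sder k a * b + a * sder k b.
Proof.
apply: sfun_eq => x; have Vx : pts V (sval x) by case: x.
rewrite (@sderE _ _
   (extend (@complex.Re R) a * extend (@complex.Re R) b
     - extend (@complex.Im R) a * extend (@complex.Im R) b)
   (extend (@complex.Re R) a * extend (@complex.Im R) b
     + extend (@complex.Im R) a * extend (@complex.Re R) b)); last first.
  move=> y; rewrite sfunM !fctE !extendE; case: (a y) (b y) => ? ? [? ?].
  by simpc.
have da := @Cinfty_derivable _ _ _ _ k _ (sfun_Re a) Vx.
have db := @Cinfty_derivable _ _ _ _ k _ (sfun_Re b) Vx.
have da' := @Cinfty_derivable _ _ _ _ k _ (sfun_Im a) Vx.
have db' := @Cinfty_derivable _ _ _ _ k _ (sfun_Im b) Vx.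
have dM (A B : 'rV[R]_n -> R) := @deriveM _ _ A B (sval x) (e_ k).
have dMd (A B : 'rV[R]_n -> R) := @derivableM _ _ A B (sval x) (e_ k).
rewrite (deriveB (dMd _ _ da db) (dMd _ _ da' db')).
rewrite (deriveD (dMd _ _ da db') (dMd _ _ da' db)).
rewrite (dM _ _ da db) (dM _ _ da' db') (dM _ _ da db') (dM _ _ da' db).
rewrite !extendE sfunD !sfunM /= /der /GRing.scale /=.
move: ('D_ _ _ _) ('D_ _ _ _) ('D_ _ _ _) ('D_ _ _ _) => p q r t.
case: (a x) (b x) => ? ? [? ?] /=; simpc; congr (_ +i* _); ring.
Qed.

Lemma sder_cst k z : sder k (sfun_cst z) = 0.
Proof.
apply: sfun_eq => x; rewrite (@sderE _ _ (cst (complex.Re z))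
  (cst (complex.Im z))); last by move=> y /=; case: z.
by rewrite !derive_cst.
Qed.

Lemma sder_conj k a : sder k (sfun_conj a) = sfun_conj (sder k a).
Proof.
apply: sfun_eq => x; have Vx : pts V (sval x) by case: x.
rewrite (@sderE _ _ (extend (@complex.Re R) a) (- extend (@complex.Im R) a)); last first.
  by move=> y; rewrite !fctE !extendE /=; case: (a y).
rewrite deriveN //; apply: Cinfty_derivable Vx; exact: sfun_Im.
Qed.

Lemma sderC k l a : sder k (sder l a) = sder l (sder k a).
Proof.
apply: sfun_eq => x; have Vx : pts V (sval x) by case: x.
have E i j := @sderE i (sder j a) ('D_(e_ j) (extend (@complex.Re R) a))
  ('D_(e_ j) (extend (@complex.Im R) a)) (fun=> erefl) x.
apply: etrans (E k l) (etrans _ (esym (E l k))).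
have oV := @open_pts _ V.
exact: (congr2 (@Complex R) (Cinfty_D_sym k l oV (sfun_Re a) Vx)
  (Cinfty_D_sym k l oV (sfun_Im a) Vx)).
Qed.

End SmoothRing.

Definition cmx (R : rcfType) p q (A : 'M[R]_(p, q)) : 'M[R[i]]_(p, q) :=
  map_mx (real_complex R) A.

Section RealMatrices.
Variables (R : rcfType) (p q r : nat).
Implicit Types (A : 'M[R]_(p, q)) (B : 'M[R]_(q, r)).

Lemma cmxE A i j : cmx A i j = (A i j)%:C. Proof. by rewrite mxE. Qed.
Lemma cmxD A A' : cmx (A + A') = cmx A + cmx A'. Proof. exact: map_mxD. Qed.
Lemma cmxN A : cmx (- A) = - cmx A. Proof. exact: map_mxN. Qed.
Lemma cmxM A B : cmx (A *m B) = cmx A *m cmx B. Proof. exact: map_mxM. Qed.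
Lemma cmx_tr A : cmx A^T = (cmx A)^T. Proof. by rewrite /cmx map_trmx. Qed.
Lemma cmx1 : cmx (1%:M : 'M[R]_p) = 1%:M. Proof. exact: map_mx1. Qed.
Lemma cmx0 : cmx (0 : 'M[R]_(p, q)) = 0. Proof. exact: map_mx0. Qed.
Lemma cmx_inj : injective (@cmx R p q).
Proof.
move=> A B AB; apply/matrixP => i j; apply: (@complexI R).
by rewrite -!cmxE AB.
Qed.
End RealMatrices.

Section SmoothRingMatrices.
Variables (R : realType) (n : nat) (V : open_set 'rV[R]_n).
Notation point := {x : 'rV[R]_n | pts V x}.

Fact sder_is_additive k : additive (@sder R n V k).
Proof. exact: sderB. Qed.
HB.instance Definition _ k :=
  GRing.isAdditive.Build (sfun V) (sfun V) (@sder R n V k) (sder_is_additive k).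

Definition dsfun k : {additive sfun V -> sfun V} := @sder R n V k.

(** The default 0 for a non-smooth [h] lets tensors be lifted first and their smoothness be proved
    only upon evaluation. *)
Definition mk_sfun (h : point -> R[i]) : sfun V := insubd 0 h.

Lemma mk_sfunE h x : h \in @smooth R n V -> mk_sfun h x = h x.
Proof. by move=> hs; rewrite /mk_sfun -[sfun_val _]/(val _) val_insubd hs. Qed.

Definition evmx x p q (A : 'M[sfun V]_(p, q)) : 'M[R[i]]_(p, q) :=
  map_mx (ev x) A.

Section Evaluation.
Variables (x : point) (p q r : nat).
Implicit Types (A : 'M[sfun V]_(p, q)) (B : 'M[sfun V]_(q, r)).

Lemma evmxE A i j : evmx x A i j = ev x (A i j). Proof. by rewrite mxE. Qed.
Lemma evmxD A A' : evmx x (A + A') = evmx x A + evmx x A'.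
Proof. exact: map_mxD. Qed.
Lemma evmxN A : evmx x (- A) = - evmx x A. Proof. exact: map_mxN. Qed.
Lemma evmxM A B : evmx x (A *m B) = evmx x A *m evmx x B.
Proof. exact: map_mxM. Qed.
Lemma evmxZ k A : evmx x (k *: A) = ev x k *: evmx x A.
Proof. exact: map_mxZ. Qed.
Lemma evmx_lin2 k1 k2 A A' : evmx x (k1 *: A + k2 *: A') =
  ev x k1 *: evmx x A + ev x k2 *: evmx x A'.
Proof. by rewrite evmxD !evmxZ. Qed.
Lemma evmx_lin3 k1 k2 k3 A A' A'' : evmx x (k1 *: A - k2 *: A' + k3 *: A'') =
  ev x k1 *: evmx x A - ev x k2 *: evmx x A' + ev x k3 *: evmx x A''.
Proof. by rewrite !evmxD evmxN !evmxZ. Qed.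
Lemma evmx_tr A : evmx x A^T = (evmx x A)^T. Proof. by rewrite /evmx map_trmx. Qed.
Lemma evmx1 : evmx x (1%:M : 'M[sfun V]_p) = 1%:M. Proof. exact: map_mx1. Qed.
Lemma evmx0 : evmx x (0 : 'M[sfun V]_(p, q)) = 0. Proof. exact: map_mx0. Qed.
End Evaluation.

Lemma sfun_mx_eq p q (A B : 'M[sfun V]_(p, q)) :
  (forall x, evmx x A = evmx x B) -> A = B.
Proof.
move=> e; apply/matrixP => i j; apply: sfun_eq => x.
by have /matrixP/(_ i j) := e x; rewrite !evmxE.
Qed.

End SmoothRingMatrices.

(** * Tensor fields in a chart *)

Section LocalGeometry.
Variables (R : realType) (n : nat) (M : topologicalType) (A : atlas R n M).
Hypothesis hM : oriented_manifold A.
Variables (c : idx A) (W : set M).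
Hypothesis oW : open W.
Notation cpx := (@cmx R _ _).

Definition chart_img : set 'rV[R]_n := chart c @` (W `&` dom c).

Lemma open_chart_img : open chart_img.
Proof.
rewrite openE => _ [p [Wp cp] <-].
have o1 : open (chart c @` dom c) by apply: mfd_img_open hM _.
have xI : (chart c @` dom c) (chart c p) by exists p.
have Ic : \forall y \near chart c p, (chart c @` dom c) y.
  exact: open_nbhs_nbhs.
have Iw : \forall y \near chart c p, W (inv c y).
  apply: (mfd_inv_cont hM); first by rewrite inE.
  by rewrite (mfd_chartK hM) //; exact: open_nbhs_nbhs.
near=> y.
have [q cq qy] : (chart c @` dom c) y by near: y.
exists q => //; split=> //.
by rewrite -(mfd_chartK hM cq) qy; near: y.
Unshelve. all: by end_near. Qed.

Definition locV := OpenSet open_chart_img.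
Notation point := {x : 'rV[R]_n | pts locV x}.
Notation K := (sfun locV).

Lemma pointP (x : point) : exists p (Wp : W p) (cp : dom c p),
  x = exist _ (chart c p) (ex_intro2 _ _ p (conj Wp cp) erefl).
Proof.
case: x => x Vx; case: (Vx) => p [Wp cp] e; exists p, Wp, cp.
by apply: eq_exist.
Qed.

Definition pt (x : point) : M := inv c (sval x).

Lemma pt_dom x : W (pt x) /\ dom c (pt x).
Proof.
by have [p [Wp [cp ->]]] := pointP x; rewrite /pt /= (mfd_chartK hM).
Qed.

Lemma chart_pt x : chart c (pt x) = sval x.
Proof.
by have [p [Wp [cp ->]]] := pointP x; rewrite /pt /= (mfd_chartK hM).
Qed.

Lemma pt_surj p : W p -> dom c p -> exists x, pt x = p.
Proof.
move=> Wp cp; exists (exist _ (chart c p) (ex_intro2 _ _ p (conj Wp cp) erefl)).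
by rewrite /pt /= (mfd_chartK hM).
Qed.

Lemma ev_sderC k (a : K) (f : M -> R[i]) : (forall x, ev x a = f (pt x)) ->
  forall x, ev x (dsfun locV k a) = pdC c k f (pt x) :> R[i].
Proof.
move=> af x; rewrite /ev -[dsfun _ _ _]/(sder k a) (sderE k (F := (fun q => complex.Re (f q)) \o inv c)
  (G := (fun q => complex.Im (f q)) \o inv c)).
  by rewrite /pdC /pd chart_pt.
by move=> y; have := af y; rewrite /ev /pt /= => ->; case: (f _).
Qed.

Lemma ev_sderR k (a : K) (f : M -> R) : (forall x, ev x a = (f (pt x))%:C) ->
  forall x, ev x (dsfun locV k a) = (pd c k f (pt x))%:C.
Proof.
move=> af x; rewrite (ev_sderC k (f := fun q => (f q)%:C) af) /pdC.
have -> : pd c k (fun q => complex.Im (f q)%:C) (pt x) = 0.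
  exact: derive_cst.
by [].
Qed.

Definition liftC p q (F : M -> 'M[R[i]]_(p, q)) : 'M[K]_(p, q) :=
  \matrix_(i, j) mk_sfun (fun x : point => F (pt x) i j).

Definition liftR p q (F : M -> 'M[R]_(p, q)) : 'M[K]_(p, q) :=
  liftC (fun q => cpx (F q)).

Variable U : set M.
Hypothesis WU : W `<=` U.

Lemma ev_liftC p q (F : M -> 'M[R[i]]_(p, q)) x :
  smooth_cmx_in c U F -> evmx x (liftC F) = F (pt x).
Proof.
move=> sF; apply/matrixP => i j; rewrite !mxE /ev mk_sfunE //.
have [sr si] := sF i j.
have sub : chart_img `<=` chart c @` (U `&` dom c).
  by move=> _ [r [Wr cr] <-]; exists r => //; split=> //; exact: WU.
apply: (@smoothP R n locV _ ((fun r => complex.Re (F r i j)) \o inv c)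
  ((fun r => complex.Im (F r i j)) \o inv c));
  [|exact: Cinfty_sub sub sr|exact: Cinfty_sub sub si].
move=> y.
by rewrite /pt /=; case: (F _ _ _).
Qed.

Lemma ev_liftR p q (F : M -> 'M[R]_(p, q)) x :
  smooth_mx_in c U F -> evmx x (liftR F) = cpx (F (pt x)).
Proof.
move=> sF; apply/matrixP => i j; rewrite evmxE !mxE /ev mk_sfunE ?mxE //.
have sub : chart_img `<=` chart c @` (U `&` dom c).
  by move=> _ [r [Wr cr] <-]; exists r => //; split=> //; exact: WU.
apply: (@smoothP R n locV _ ((fun r => F r i j) \o inv c) (cst 0));
  [|exact: Cinfty_sub sub (sF i j)|exact: Cinfty_cst open_chart_img 0].
move=> y.
by rewrite mxE.
Qed.

Lemma ev_dmxR k p q (X : 'M[K]_(p, q)) (F : M -> 'M[R]_(p, q)) :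
  (forall x, evmx x X = cpx (F (pt x))) ->
  forall x, evmx x (dmx (@dsfun R n locV) k X) =
            cpx (\matrix_(i, j) pd c k (fun q => F q i j) (pt x)).
Proof.
move=> XF x; apply/matrixP => i j; rewrite !mxE.
apply: (ev_sderR k (f := fun q => F q i j)) => y.
by have /matrixP/(_ i j) := XF y; rewrite !mxE.
Qed.

Lemma ev_dmxC k p q (X : 'M[K]_(p, q)) (F : M -> 'M[R[i]]_(p, q)) :
  (forall x, evmx x X = F (pt x)) ->
  forall x, evmx x (dmx (@dsfun R n locV) k X) =
            \matrix_(i, j) pdC c k (fun q => F q i j) (pt x).
Proof.
move=> XF x; apply/matrixP => i j; rewrite !mxE.
apply: (ev_sderC k (f := fun q => F q i j)) => y.
by have /matrixP/(_ i j) := XF y; rewrite !mxE.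
Qed.

Lemma ev_curv q (L : 'I_n -> 'M[K]_q) (T : 'I_n -> M -> 'M[R]_q) i k x :
  (forall i x, evmx x (L i) = cpx (T i (pt x))) ->
  evmx x (curv (@dsfun R n locV) L i k) = cpx (
    \matrix_(a, b) pd c i (fun q => T k q a b) (pt x)
    - \matrix_(a, b) pd c k (fun q => T i q a b) (pt x)
    + (T k (pt x) *m T i (pt x) - T i (pt x) *m T k (pt x))).
Proof.
move=> LT; rewrite /curv evmxD evmxD evmxN evmxD evmxN !evmxM !LT.
rewrite (ev_dmxR i (LT k)) (ev_dmxR k (LT i)).
by rewrite !(cmxD, cmxN, cmxM).
Qed.

End LocalGeometry.

(** * Pointwise linear algebra of frames and Sasakian structures *)

Section InverseMetric.
Variables (R : fieldType) (n : nat) (F g : 'M[R]_n).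
Hypothesis FgF : F *m g *m F^T = 1%:M.

Lemma frame_inv : g *m F^T *m F = 1%:M.
Proof. by apply: mulmx1C; rewrite mulmxA. Qed.

Lemma invmx_frame : invmx g = F^T *m F.
Proof.
have gFF : g *m (F^T *m F) = 1%:M by rewrite mulmxA frame_inv.
have [gu _] := mulmx1_unit gFF.
by rewrite -[RHS]mul1mx -(mulVmx gu) -mulmxA gFF mulmx1.
Qed.
End InverseMetric.

Section SasakianAlgebra.
Variables (R : fieldType) (n : nat) (g phi : 'M[R]_n).
Variables (xi : 'rV[R]_n) (eta : 'cV[R]_n).
Hypotheses (xi_eta : (xi *m eta) 0 0 = 1).
Hypothesis phi2 : forall v : 'rV[R]_n,
  v *m phi *m phi = - v + (v *m eta) 0 0 *: xi.
Hypothesis compat : forall v w : 'rV[R]_n,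
  (v *m phi *m g *m (w *m phi)^T) 0 0 =
  (v *m g *m w^T) 0 0 - (v *m eta) 0 0 * (w *m eta) 0 0.
Hypothesis gT : g^T = g.

Lemma sas_phi_sq : phi *m phi = - 1%:M + eta *m xi.
Proof.
apply/row_matrixP => i; rewrite rowE mulmxA phi2 [RHS]linearD /= linearN /=.
by rewrite row1 row_mul -scal11 rowE.
Qed.

Lemma sas_xi_eta_mx : xi *m eta = 1%:M.
Proof. by rewrite [LHS]mx11_scalar xi_eta. Qed.

Lemma sas_compat_mx : phi *m g *m phi^T = g - eta *m eta^T.
Proof.
apply/matrixP => i j.
have := compat (delta_mx 0 i) (delta_mx 0 j).
rewrite trmx_mul !mulmxA -!rowE -!row_mul trmx_delta -!colE.
by rewrite !mxE big_ord1 !mxE.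
Qed.

(** phi commutes with its square, hence with [eta *m xi]; therefore phi(xi) = k xi, and phi^2(xi) =
    0 forces k = 0. *)
Lemma sas_xi_phi : xi *m phi = 0.
Proof.
have e : phi *m (eta *m xi) = eta *m xi *m phi.
  have : phi *m (phi *m phi) = (phi *m phi) *m phi by rewrite mulmxA.
  rewrite sas_phi_sq mulmxDr mulmxDl mulmxN mulmx1 mulNmx mul1mx.
  by move/addrI.
have xc : xi *m phi = (xi *m phi *m eta) 0 0 *: xi.
  rewrite -scal11 -!mulmxA e !mulmxA sas_xi_eta_mx mul1mx.
  by [].
have [k kE] : exists k, xi *m phi = k *: xi by exists ((xi *m phi *m eta) 0 0).
have := phi2 xi; rewrite xi_eta scale1r addNr kE -scalemxAl kE scalerA => /eqP.
rewrite scaler_eq0 mulf_eq0 orbb => /orP[/eqP ->|/eqP ->].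
  by rewrite scale0r.
by rewrite scaler0.
Qed.

Lemma sas_phi_eta : phi *m eta = 0.
Proof.
have e : phi *m (eta *m xi) = eta *m xi *m phi.
  have : phi *m (phi *m phi) = (phi *m phi) *m phi by rewrite mulmxA.
  rewrite sas_phi_sq mulmxDr mulmxDl mulmxN mulmx1 mulNmx mul1mx.
  by move/addrI.
rewrite -[LHS]mulmx1 -sas_xi_eta_mx mulmxA -[phi *m eta *m xi]mulmxA e.
by rewrite -[eta *m xi *m phi]mulmxA sas_xi_phi mulmx0 mul0mx.
Qed.

(** Compatibility with xi as first argument: phi(xi) = 0 leaves g(xi, .) = eta. *)
Lemma sas_g_xi : g *m xi^T = eta.
Proof.
have := congr1 (mulmx xi) sas_compat_mx.
rewrite !mulmxA sas_xi_phi !mul0mx mulmxBr mulmxA sas_xi_eta_mx mul1mx.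
move=> /esym/eqP; rewrite subr_eq0 => /eqP /(congr1 (fun v => v^T)).
by rewrite trmx_mul trmxK gT.
Qed.

Lemma sas_phi_g : (phi *m g)^T = - (phi *m g).
Proof.
have := congr1 (mulmx phi) sas_compat_mx.
rewrite !mulmxA sas_phi_sq mulmxBr mulmxA sas_phi_eta mul0mx subr0.
rewrite !mulmxDl mulNmx mul1mx -[eta *m xi *m g]mulmxA.
have -> : xi *m g = eta^T by rewrite -sas_g_xi trmx_mul trmxK gT.
rewrite -mulmxA -[eta^T *m phi^T]trmx_mul sas_phi_eta trmx0 mulmx0 addr0 => pg.
by rewrite -[in RHS]pg mulNmx opprK trmx_mul gT.
Qed.
End SasakianAlgebra.

(** * Ricci curvature of a manifold with a quasi-Killing spinor *)

Section QuasiKilling.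
Variables (R : realType) (n : nat) (M : topologicalType) (A : atlas R n M).
Hypothesis hM : oriented_manifold A.
Variables (g phi : idx A -> M -> 'M[R]_n).
Variables (xi : idx A -> M -> 'rV[R]_n) (eta : idx A -> M -> 'cV[R]_n).
Hypothesis hsas : sasakian g phi xi eta.
Variable E : 'I_n -> 'M[R[i]]_(spin_dim n).
Hypothesis hE : clifford_rep E.
Variable P : spin_data A.
Hypothesis hP : spin_structure g E P.
Variable psi : sidx P -> M -> 'cV[R[i]]_(spin_dim n).
Variables al be : R.
Hypothesis hpsi : quasi_killing g E xi eta al be psi.
Hypotheses (al2 : 4 * al ^+ 2 = 1) (be0 : be != 0).

Notation cpx := (@cmx R _ _).

Lemma cmulE (j : sidx P) c p v :
  cmul g E j c p v = gam E (cpx (v *m (g c p *m (frame j c p)^T))).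
Proof.
apply: eq_bigr => a _; congr (_ *: _).
rewrite cmxE mxE /ip; congr (_%:C).
rewrite mulmxA !mxE; apply: eq_bigr => k _; congr (_ * _).
by rewrite !mxE.
Qed.

(** * Lifting the geometry to the function ring of a chart and a spin frame *)

Section Local.
Variables (j : sidx P) (c : idx A).
Let W := sdom j.
Let oW : open W := spin_open hP j.
Notation V := (locV hM c oW).
Notation K := (sfun V).
Notation point := {x : 'rV[R]_n | pts V x}.
Notation D := (@dsfun R n V).
Notation pt := (@pt R n M A hM c W oW).
Notation lift := (@liftR R n M A hM c W oW _ _).

Let G := lift (g c).
Let F := lift (frame j c).
Let Ph := lift (phi c).
Let X := lift (xi c).
Let Et := lift (eta c).
Let Ps := @liftC R n M A hM c W oW _ _ (psi j).
Let EK a : 'M[K]_(spin_dim n) := map_mx (sfun_cst V) (E a).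
Let cst (r : R) : K := sfun_cst V r%:C.
Let h := cst (2^-1).
Let H := G *m F^T.

Let DM k (a b : K) : D k (a * b) = D k a * b + a * D k b.
Proof. exact: sderM. Qed.
Let DC k l (a : K) : D k (D l a) = D l (D k a).
Proof. exact: sderC. Qed.
Let Dcst k (r : R) : D k (cst r) = 0. Proof. exact: sder_cst. Qed.

Let ev_lift U p q (T : M -> 'M[R]_(p, q)) x : W `<=` U -> smooth_mx_in c U T ->
  evmx x (lift T) = cpx (T (pt x)).
Proof. by move=> WU sT; exact: (ev_liftR WU x sT). Qed.

Let evG x : evmx x G = cpx (g c (pt x)).
Proof. exact: (ev_lift x (@subsetT _ _) (metric_smooth (sas_metric hsas) c)). Qed.
Let evF x : evmx x F = cpx (frame j c (pt x)).
Proof. exact: (ev_lift x (@subset_refl _ _) (spin_frame_smooth hP j c)). Qed.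
Let evPh x : evmx x Ph = cpx (phi c (pt x)).
Proof. exact: (ev_lift x (@subsetT _ _) ((sas_phi hsas).1 c)). Qed.
Let evX x : evmx x X = cpx (xi c (pt x)).
Proof. exact: (ev_lift x (@subsetT _ _) ((sas_xi hsas).1 c)). Qed.
Let evEt x : evmx x Et = cpx (eta c (pt x)).
Proof. exact: (ev_lift x (@subsetT _ _) ((sas_eta hsas).1 c)). Qed.
Let evPs x : evmx x Ps = psi j (pt x).
Proof.
have [[+ _] _ _] := hpsi => /(_ j c) sp.
exact: (ev_liftC (@subset_refl _ _) x sp).
Qed.
Let evcst x r : ev x (cst r) = r%:C. Proof. by []. Qed.

Let h2 : h * 2 = 1.
Proof.
apply: sfun_eq => x; rewrite sfunM -[_ x in LHS]/((2^-1)%:C).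
rewrite -[_ x in LHS]/(ev x 2) rmorph_nat.
by rewrite -(rmorph_nat (real_complex R)) -rmorphM mulVf ?pnatr_eq0 ?rmorph1.
Qed.

Let pt_in x : W (pt x) /\ dom c (pt x).
Proof. exact: pt_dom. Qed.

Let FgF x : frame j c (pt x) *m g c (pt x) *m (frame j c (pt x))^T = 1%:M.
Proof. by have [Wx cx] := pt_in x; apply: (spin_frame_orthonormal hP). Qed.

Let gT x : (g c (pt x))^T = g c (pt x).
Proof. by have [_ cx] := pt_in x; apply: (metric_sym (sas_metric hsas)). Qed.

Let FGF : F *m G *m F^T = 1%:M.
Proof.
apply: sfun_mx_eq => x; rewrite !evmxM evmx_tr evF evG -cmx_tr -!cmxM.
by rewrite FgF cmx1 evmx1.
Qed.

Let Gsym : G^T = G.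
Proof. by apply: sfun_mx_eq => x; rewrite evmx_tr evG -cmx_tr gT. Qed.

Let HF : H *m F = 1%:M.
Proof.
apply: sfun_mx_eq => x; rewrite !evmxM evmx_tr evF evG -cmx_tr -!cmxM.
by rewrite (frame_inv (FgF x)) cmx1 evmx1.
Qed.

Let evH x : evmx x H = cpx (g c (pt x) *m (frame j c (pt x))^T).
Proof. by rewrite evmxM evmx_tr evF evG -cmx_tr -cmxM. Qed.

Let LC := lc D F G h.

Let mxev p q (B : 'M[K]_(p, q)) (T : M -> 'M[R]_(p, q)) x a b :
  (forall x, evmx x B = cpx (T (pt x))) -> ev x (B a b) = (T (pt x) a b)%:C.
Proof. by move=> e; rewrite -evmxE e cmxE. Qed.

Let evDG x i a b : ev x (D i (G a b)) = (pd c i (fun q => g c q a b) (pt x))%:C.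
Proof. by apply: (ev_sderR i (f := fun q => g c q a b)) => y; exact: mxev. Qed.

Let evLC x i : evmx x (LC i) =
  cpx (\matrix_(k, l) christoffel g c (pt x) i k l).
Proof.
apply/matrixP => k l; rewrite evmxE cmxE [LC i k l]mxE [X in _ = X%:C]mxE.
rewrite /christoffel rmorphM [RHS]rmorphM; congr (_ * _).
rewrite rmorph_sum [RHS]rmorph_sum; apply: eq_bigr => r _.
transitivity (ev x ((F^T *m F) l r) * (ev x (D i (G k r)) +
  ev x (D k (G i r)) - ev x (D r (G i k)))); first by [].
rewrite !evDG [RHS]rmorphM [in RHS]rmorphB [in RHS]rmorphD; congr (_ * _).
have e : evmx x (F^T *m F) = cpx (invmx (g c (pt x))).
  by rewrite evmxM evmx_tr evF -cmx_tr -cmxM (invmx_frame (FgF x)).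
by have := congr1 (fun Z : 'M[R[i]]_n => Z l r) e; rewrite evmxE cmxE.
Qed.

Let evCurv x i k : evmx x (curv D LC i k) =
  cpx (\matrix_(a, b) curvature g c (pt x) i k a b).
Proof.
rewrite (ev_curv i k x (T := fun i p => \matrix_(a, b) christoffel g c p i a b));
  last by move=> *; exact: evLC.
congr cmx.
apply/matrixP => a b; rewrite !mxE /curvature -sumrB.
congr (_ - _ + _).
- by congr (pd c i _ _); apply/funext => q; rewrite mxE.
- by congr (pd c k _ _); apply/funext => q; rewrite mxE.
by apply: eq_bigr => r _; rewrite !mxE mulrC [X in _ - X]mulrC.
Qed.

Let evRic x : evmx x (ric_mx D F G h) = cpx (ricci g c (pt x)).
Proof.
apply/matrixP => a b; rewrite evmxE cmxE mxE [X in _ = X%:C]mxE.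
rewrite rmorph_sum [RHS]rmorph_sum; apply: eq_bigr => i _.
have := congr1 (fun Z : 'M[R[i]]_n => Z b i) (evCurv x i a).
by rewrite evmxE cmxE [X in _ = X%:C -> _]mxE.
Qed.

Let nabla_delta i (Y : M -> 'rV[R]_n) p :
  nabla g c (delta_mx 0 i) Y p = \row_l pd c i (fun q => Y q 0 l) p +
    Y p *m \matrix_(k, l) christoffel g c p i k l.
Proof.
apply/rowP => l; rewrite !mxE; congr (_ + _).
  rewrite (bigD1 i) //= mxE !eqxx mul1r big1 ?addr0 // => k ki.
  by rewrite mxE (negPf ki) andbF mul0r.
rewrite (bigD1 i) //= [X in _ + X]big1 ?addr0 => [|k ki].
  by apply: eq_bigr => k _; rewrite !mxE !eqxx mul1r.
by rewrite big1 // => r _; rewrite mxE (negPf ki) andbF !mul0r.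
Qed.

Let OM := Om D F G H h.

Let evOM x i : evmx x (OM i) =
  cpx (\matrix_(a, b) ip g c (pt x)
    (nabla g c (delta_mx 0 i) (fun q => row a (frame j c q)) (pt x))
    (row b (frame j c (pt x)))).
Proof.
rewrite /OM /Om evmxM evmxD [evmx x (F *m _)]evmxM evLC evF evH.
rewrite (ev_dmxR i (F := frame j c)); last exact: evF.
rewrite -cmxM -cmxD -cmxM; congr cmx.
apply/matrixP => a b; rewrite [RHS]mxE /ip nabla_delta.
have -> : \row_l pd c i (fun q => row a (frame j c q) 0 l) (pt x) =
    row a (\matrix_(k, l) pd c i (fun q => frame j c q k l) (pt x)).
  apply/rowP => l; rewrite !mxE; congr (pd c i _ _).
  by apply/funext => q; rewrite mxE.
rewrite mulmxA tr_row -row_mul -linearD /= -row_mul.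
rewrite [LHS]mxE [RHS]mxE; apply: eq_bigr => k _.
by rewrite [X in _ = X * _]mxE [X in _ = _ * X]mxE.
Qed.

(** Row k is the Sasakian condition for d_i and d_k. The field d_k is constant in the chart, so only
    Christoffel terms remain in its covariant derivative. *)
Let cov_phi i : cov D (fun i => - LC i) LC i Ph = col i G *m X - Et *m delta_mx 0 i.
Proof.
apply: sfun_mx_eq => x; have [_ cx] := pt_in x.
rewrite /cov !(evmxD, evmxN) [evmx x (- LC i *m Ph)]evmxM.
rewrite [evmx x (Ph *m LC i)]evmxM [evmx x (col i G *m X)]evmxM.
rewrite [evmx x (Et *m _)]evmxM evmxN !evLC evPh evX evEt.
have -> : evmx x (col i G) = cpx (col i (g c (pt x))).
  apply/colP => k; rewrite evmxE cmxE [col i G k 0]mxE [col i _ k 0]mxE.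
  exact: mxev.
have -> : evmx x (delta_mx 0 i) = cpx (delta_mx (0 : 'I_1) i).
  by apply/rowP => k; rewrite evmxE cmxE !mxE; case: (k == i); rewrite ?rmorph1 ?rmorph0.
rewrite (ev_dmxR i (F := phi c)); last exact: evPh.
rewrite -!cmxN -!cmxM -!cmxN -!cmxD; congr cmx.
apply/row_matrixP => k.
have sY : smooth_mx_in c setT (fun=> delta_mx 0 k : 'rV[R]_n).
  move=> a b; apply: Cinfty_cst; rewrite setTI.
  by apply: mfd_img_open hM _.
have := sas_nabla_phi hsas cx (delta_mx 0 i) sY.
rewrite /nabla_endo !nabla_delta.
set Ga := \matrix_(k, l) christoffel _ _ _ _ _ _.
have -> : (\row_l pd c i (fun=> (delta_mx 0 k : 'rV[R]_n) 0 l) (pt x))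
    = 0 :> 'rV[R]_n.
  by apply/rowP => l; rewrite !mxE; exact: derive_cst.
have -> : (\row_l pd c i (fun q => ((delta_mx 0 k : 'rV[R]_n) *m phi c q) 0 l)
    (pt x)) = row k (\matrix_(a, b) pd c i (fun q => phi c q a b) (pt x)).
  apply/rowP => l; rewrite !mxE; congr (pd c i _ _).
  by apply/funext => q; rewrite -rowE mxE.
have -> : ip g c (pt x) (delta_mx 0 i) (delta_mx 0 k) = g c (pt x) k i.
  by rewrite /ip -rowE trmx_delta -colE !mxE -[in LHS](gT x) mxE.
move: (\matrix_(a, b) _) => d.
rewrite add0r => e; rewrite !linearB /= linearD /= !row_mul.
rewrite (_ : row k (col i _) = (g c (pt x) k i)%:M); last first.
  by apply/matrixP => u v; rewrite !ord1 !mxE eqxx.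
rewrite mul_scalar_mx (scal11 (row k (eta c _))) [row k (eta c _) 0 0]mxE.
have -> : eta c (pt x) k 0 =
    ((delta_mx 0 k : 'rV[R]_n) *m eta c (pt x)) 0 0.
  by rewrite -rowE mxE.
rewrite -e linearD /= !row_mul linearN /= mulNmx -!rowE.
by rewrite addrAC.
Qed.

Let sasx x : let p := pt x in
  [/\ phi c p *m phi c p = - 1%:M + eta c p *m xi c p, xi c p *m eta c p = 1%:M,
      xi c p *m phi c p = 0, phi c p *m eta c p = 0 &
      g c p *m (xi c p)^T = eta c p /\ (phi c p *m g c p)^T = - (phi c p *m g c p)].
Proof.
have [_ cx] := pt_in x; move=> p.
have H1 := sas_eta_xi hsas cx; have H2 := sas_phi2 hsas cx.
have H3 := sas_compat hsas cx; have H4 := gT x.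
split; last split.
- exact: sas_phi_sq.
- exact: sas_xi_eta_mx.
- exact: sas_xi_phi H1 H2.
- exact: sas_phi_eta H1 H2.
- exact: (sas_g_xi H1 H2 H3 H4).
- exact: (sas_phi_g H1 H2 H3 H4).
Qed.

Let phi2 : Ph *m Ph = - 1%:M + Et *m X.
Proof.
apply: sfun_mx_eq => x; have [e _ _ _ _] := sasx x.
by rewrite evmxD evmxN evmx1 !evmxM evPh evEt evX -!cmxM e cmxD cmxN cmx1.
Qed.

Let xi_eta : X *m Et = 1%:M.
Proof.
apply: sfun_mx_eq => x; have [_ e _ _ _] := sasx x.
by rewrite evmx1 evmxM evEt evX -cmxM e cmx1.
Qed.

Let xi_phi : X *m Ph = 0.
Proof.
apply: sfun_mx_eq => x; have [_ _ e _ _] := sasx x.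
by rewrite evmx0 evmxM evPh evX -cmxM e cmx0.
Qed.

Let phi_eta : Ph *m Et = 0.
Proof.
apply: sfun_mx_eq => x; have [_ _ _ e _] := sasx x.
by rewrite evmx0 evmxM evPh evEt -cmxM e cmx0.
Qed.

Let G_xi : G *m X^T = Et.
Proof.
apply: sfun_mx_eq => x; have [_ _ _ _ [e _]] := sasx x.
by rewrite evmxM evmx_tr evG evX evEt -cmx_tr -cmxM e.
Qed.

Let phiG : (Ph *m G)^T = - (Ph *m G).
Proof.
apply: sfun_mx_eq => x; have [_ _ _ _ [_ e]] := sasx x.
by rewrite evmx_tr evmxN evmxM evPh evG -cmxM -cmx_tr e cmxN.
Qed.

Let xf := X *m H.
Let ff := F *m Ph *m H.

Let xf_unit : xf *m xf^T = 1%:M.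
Proof. exact: (x_unit Gsym erefl HF xi_eta G_xi). Qed.
Let ff_skew : ff^T = - ff.
Proof. exact: (f_skew erefl phiG). Qed.
Let xf_ff : xf *m ff = 0.
Proof. exact: (x_f Gsym erefl HF phi_eta G_xi phiG). Qed.
Let ff_sq : ff *m ff = - 1%:M + xf^T *m xf.
Proof. exact: (f_sq FGF Gsym erefl HF phi2 G_xi). Qed.
Let cov_ff i :
  cov D (fun i => - OM i) OM i ff = (row i H)^T *m xf - xf^T *m row i H.
Proof. exact: (cov_f DM FGF Gsym erefl HF G_xi cov_phi). Qed.

Let EE a b : EK a *m EK b + EK b *m EK a = (- 2 * (a == b)%:R)%:M.
Proof.
rewrite -!map_mxM -map_mxD (cliff_rel hE) map_scalar_mx.
by rewrite rmorphM rmorphN !rmorph_nat.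
Qed.

Let DE k a : dmx D k (EK a) = 0.
Proof. by apply/matrixP => u v; rewrite !mxE; exact: sder_cst. Qed.

Let qq := cst (4^-1).
Let q4 : qq * 4 = 1.
Proof.
apply: sfun_eq => x; rewrite sfunM -[_ x in LHS]/((4^-1)%:C).
rewrite -[_ x in LHS]/(ev x 4) rmorph_nat.
by rewrite -(rmorph_nat (real_complex R)) -rmorphM mulVf ?pnatr_eq0 ?rmorph1.
Qed.

Let evEK x a : evmx x (EK a) = E a.
Proof. by apply/matrixP => u v; rewrite evmxE mxE. Qed.

Let ev_gam x (v : 'rV[K]_n) : evmx x (gam EK v) = gam E (evmx x v).
Proof.
apply/matrixP => u w; rewrite evmxE !summxE rmorph_sum; apply: eq_bigr => a _.
by rewrite [LHS]/= -evmxE evmxZ evEK !mxE.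
Qed.

Let ev_bivec x (B : 'M[K]_n) : evmx x (bivec EK B) = bivec E (evmx x B).
Proof.
apply/matrixP => u w; rewrite evmxE !summxE rmorph_sum; apply: eq_bigr => a _.
rewrite !summxE rmorph_sum; apply: eq_bigr => b _.
by rewrite [LHS]/= -evmxE evmxZ evmxM !evEK evmxE.
Qed.

Let Sp := som D F G H h EK qq.

Let nabla_spinor_delta x i :
  nabla_spinor g E j c (delta_mx 0 i) psi (pt x) =
  evmx x (cov D Sp (fun=> 0) i Ps).
Proof.
rewrite /cov mulmx0 addr0 evmxD evmxM evPs evmxZ ev_bivec evOM evcst.
rewrite (ev_dmxC i (F := psi j)) //; congr (_ + _).
  apply/matrixP => r s; rewrite !mxE ord1 (bigD1 i) //= big1 ?addr0 => [|k ki].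
    by rewrite mxE !eqxx mul1r.
  by rewrite mxE (negPf ki) andbF mul0r.
rewrite -scalemxAl; congr (_ *: _); rewrite mulmx_suml; apply: eq_bigr => a _.
rewrite mulmx_suml; apply: eq_bigr => b _.
by rewrite -scalemxAl cmxE mxE.
Qed.

Let u := H *m xf^T.
Let uE : u = Et.
Proof.
by rewrite /u /xf trmx_mul mulmxA (HHt Gsym erefl HF) G_xi.
Qed.

Let ev_g x (v : 'rV[K]_n) (B : 'cV[K]_(spin_dim n)) :
  evmx x (gam EK v *m B) = gam E (evmx x v) *m evmx x B.
Proof. by rewrite evmxM ev_gam. Qed.

Let ev_comb x (k1 k2 : K) (v w : 'rV[K]_n) (B : 'cV[K]_(spin_dim n)) :
  evmx x ((k1 *: gam EK v + k2 *: gam EK w) *m B) =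
  ev x k1 *: (gam E (evmx x v) *m evmx x B) +
  ev x k2 *: (gam E (evmx x w) *m evmx x B).
Proof. by rewrite mulmxDl -!scalemxAl evmx_lin2 !ev_g. Qed.

Let ev_rowH x i : evmx x (row i H) =
  cpx (delta_mx 0 i *m (g c (pt x) *m (frame j c (pt x))^T)).
Proof.
rewrite -rowE; apply/rowP => k; rewrite evmxE cmxE [row i H 0 k]mxE.
rewrite [row i _ 0 k]mxE.
exact: (mxev (T := fun p => g c p *m (frame j c p)^T) x i k evH).
Qed.

Let ev_xf x : evmx x xf =
  cpx (xi c (pt x) *m (g c (pt x) *m (frame j c (pt x))^T)).
Proof. by rewrite /xf evmxM evX evH -cmxM. Qed.

Let ev_u x i : ev x (cst be * u i 0) =
  (be * ((delta_mx 0 i : 'rV[R]_n) *m eta c (pt x)) 0 0)%:C.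
Proof.
have e : ev x (u i 0) = (((delta_mx 0 i : 'rV[R]_n) *m eta c (pt x)) 0 0)%:C.
  by rewrite uE -rowE [row i _ 0 0]mxE; exact: (mxev x i 0 evEt).
have -> : ev x (cst be * u i 0) = be%:C * ev x (u i 0) by [].
by rewrite e rmorphM.
Qed.

Let qkK i : cov D Sp (fun=> 0) i Ps =
  (cst al *: gam EK (row i H) + (cst be * u i 0) *: gam EK xf) *m Ps.
Proof.
apply: sfun_mx_eq => x; rewrite -nabla_spinor_delta ev_comb.
have [Wx cx] := pt_in x; have [_ _ ->] := hpsi; rewrite // !cmulE.
by rewrite ev_rowH ev_xf ev_u evPs.
Qed.

Let RM := Rm D F G H h.
Let RM_anti a b : RM b a = - RM a b. Proof. exact: Rm_anti. Qed.
Let RM_skew a b : (RM a b)^T = - RM a b.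
Proof. exact: (Rm_skew DM h2 FGF Gsym erefl HF). Qed.
Let RM_bianchi a b k l : RM a b k l + RM b k a l + RM k a b l = 0.
Proof. exact: (Rm_bianchi DM DC h FGF Gsym erefl HF). Qed.
Let RM_x a b : xf *m RM a b = xf 0 b *: delta_mx 0 a - xf 0 a *: delta_mx 0 b.
Proof. exact: (x_Rm DM DC h2 FGF Gsym erefl HF xf_unit xf_ff ff_sq cov_ff). Qed.
Let RM_qk a b : bivec EK (RM a b) *m Ps =
  4 *: ((cst be *: (- (2 * ff a b) *: gam EK xf - xf 0 b *: gam EK (row a ff)
       + xf 0 a *: gam EK (row b ff))
   + ((cst al *: EK b + (cst be * xf 0 b) *: gam EK xf) *m
        (cst al *: EK a + (cst be * xf 0 a) *: gam EK xf)
    - (cst al *: EK a + (cst be * xf 0 a) *: gam EK xf) *m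
        (cst al *: EK b + (cst be * xf 0 b) *: gam EK xf))) *m Ps).
Proof.
exact: (Rm_qk DM DC h2 FGF Gsym erefl HF xf_unit ff_skew xf_ff ff_sq cov_ff EE
  DE q4 (Dcst ^~ _) (Dcst ^~ _) (Dcst ^~ _) qkK).
Qed.

Let t3 : cst (3^-1) * 3 = 1.
Proof.
apply: sfun_eq => x; rewrite sfunM -[_ x in LHS]/((3^-1)%:C).
rewrite -[_ x in LHS]/(ev x 3) rmorph_nat.
by rewrite -(rmorph_nat (real_complex R)) -rmorphM mulVf ?pnatr_eq0 ?rmorph1.
Qed.

Let ff_xf : ff *m xf^T = 0.
Proof. by rewrite -[ff]opprK -ff_skew mulNmx -trmx_mul xf_ff trmx0 oppr0. Qed.

Let alK2 : 4 * cst al ^+ 2 = 1.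
Proof.
have e : 4 * al%:C ^+ 2 = 1 :> R[i].
  by rewrite -(rmorph_nat (real_complex R)) -rmorphXn -rmorphM al2 rmorph1.
by rewrite /cst -rmorphXn -(rmorph_nat (sfun_cst V)) -rmorphM e rmorph1.
Qed.

Let biv_eq := bivec_qk h2 EE xf_unit ff_xf t3 RM_anti RM_skew RM_bianchi RM_x
  alK2 ff_skew RM_qk.
Let ric_eq := ricci_qk h2 EE xf_unit ff_xf t3 RM_anti RM_skew RM_bianchi RM_x
  alK2 ff_skew RM_qk.

Let ev_ff x : evmx x ff = cpx (frame j c (pt x) *m phi c (pt x) *m
  (g c (pt x) *m (frame j c (pt x))^T)).
Proof. by rewrite /ff evmxM [evmx x (F *m Ph)]evmxM evF evPh evH -!cmxM. Qed.

Let ev_row x a (B : 'M[K]_n) : evmx x (row a B) = row a (evmx x B).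
Proof. by apply/rowP => k; rewrite evmxE [row a B 0 k]mxE [RHS]mxE evmxE. Qed.

Let ev_nat (x : point) (k : nat) : ev x k%:R = k%:R. Proof. exact: rmorph_nat. Qed.
Let evD (x : point) (a b : K) : ev x (a + b) = ev x a + ev x b. Proof. by []. Qed.
Let evN (x : point) (a : K) : ev x (- a) = - ev x a. Proof. by []. Qed.
Let evM (x : point) (a b : K) : ev x (a * b) = ev x a * ev x b. Proof. by []. Qed.

(** The ring identities [biv_eq] and [ric_eq] are evaluated at [x], where [ricci_form] can use
    positivity and psi != 0. *)
Let frame_ricci (x : point) : psi j (pt x) != 0 ->
  let Hr := g c (pt x) *m (frame j c (pt x))^T in
  let xr := xi c (pt x) *m Hr in
  frame j c (pt x) *m ricci g c (pt x) *m (frame j c (pt x))^T =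
  (n%:R - 1 + 8 * al * be)%:M - (8 * al * be) *: (xr^T *m xr).
Proof.
move=> psi0 Hr xr.
pose fr := frame j c (pt x) *m phi c (pt x) *m Hr.
have ex := ev_xf x; have ef := ev_ff x.
have F1 : xr *m xr^T = 1%:M.
  apply: cmx_inj; rewrite cmxM cmx_tr -ex -evmx_tr -evmxM xf_unit.
  by rewrite evmx1 cmx1.
have F2 : fr^T = - fr.
  by apply: cmx_inj; rewrite cmx_tr cmxN -ef -evmx_tr ff_skew evmxN.
have F3 : xr *m fr = 0.
  by apply: cmx_inj; rewrite cmxM -ex -ef -evmxM xf_ff evmx0 cmx0.
have F4 : fr *m fr = - 1%:M + xr^T *m xr.
  apply: cmx_inj; rewrite [LHS]cmxM cmxD cmxN cmx1 [cmx (xr^T *m xr)]cmxM cmx_tr.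
  rewrite -ex -ef -evmxM ff_sq.
  by rewrite evmxD evmxN evmx1 evmxM evmx_tr.
have F5 : (2 * be%:C) *: (bivec E (cpx fr) *m psi j (pt x)) =
    (4 * al%:C * be%:C * (n%:R - 1)) *: (gam E (cpx xr) *m psi j (pt x)).
  have := congr1 (fun Z => evmx x Z) biv_eq.
  rewrite [LHS]evmxZ [RHS]evmxZ [evmx x (bivec _ _ *m _)]evmxM.
  rewrite [evmx x (gam _ _ *m _)]evmxM ev_bivec ev_gam evPs ex ef.
  by rewrite !(evM, evD, evN) !ev_nat.
have eR : evmx x (contraction RM) =
    cpx (frame j c (pt x) *m ricci g c (pt x) *m (frame j c (pt x))^T).
  rewrite (contraction_Rm DM DC G h HF).
  by rewrite evmxM [evmx x (F *m _)]evmxM evmx_tr evF evRic -cmx_tr -!cmxM.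
have F6 a := congr1 (fun Z => evmx x Z) (ric_eq a).
have {}F6 a : gam E (row a (cpx (frame j c (pt x) *m ricci g c (pt x)
      *m (frame j c (pt x))^T))) *m psi j (pt x) =
    (n%:R - 1 + 4 * al%:C * be%:C) *: (E a *m psi j (pt x))
    - (4 * al%:C * be%:C * cpx xr 0 a) *: (gam E (cpx xr) *m psi j (pt x))
    + (2 * be%:C) *: (gam E (row a (cpx fr)) *m
        (gam E (cpx xr) *m psi j (pt x))).
  move: (F6 a); rewrite [LHS]ev_g ev_row eR evPs => ->.
  rewrite evmx_lin3.
  have -> : ev x (n%:R - 1 + 4 * cst al * cst be) =
      n%:R - 1 + 4 * al%:C * be%:C by rewrite !(evM, evD, evN) !ev_nat.
  have -> : ev x (4 * cst al * cst be * xf 0 a) =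
      4 * al%:C * be%:C * cpx xr 0 a.
    by rewrite !evM ev_nat -[ev x (xf 0 a)]evmxE ex.
  have -> : ev x (2 * cst be) = 2 * be%:C by rewrite evM ev_nat.
  have -> : evmx x (gam EK xf *m Ps) = gam E (cpx xr) *m psi j (pt x).
    by rewrite ev_g ex evPs.
  have -> : evmx x (gam EK (row a ff) *m (gam EK xf *m Ps)) =
      gam E (row a (cpx fr)) *m (gam E (cpx xr) *m psi j (pt x)).
    by rewrite ev_g ev_g ex ev_row ef evPs.
  by rewrite evmxM evEK evPs.
exact: (ricci_form (cliff_rel hE) (cliff_skew hE) psi0 F1 F2 F3 F4 al2 be0 F5 F6).
Qed.

Lemma ricci_qk_sasakian p : sdom j p -> dom c p -> psi j p != 0 ->
  ricci g c p = (n%:R - 1 + 8 * al * be) *: g c p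
    - (8 * al * be) *: (eta c p *m (eta c p)^T).
Proof.
move=> Wp cp; have [x <-] := pt_surj hM oW Wp cp => psi0.
have := frame_ricci psi0; have := frame_inv (FgF x).
have [_ _ _ _ [gxi _]] := sasx x.
have HrT : g c (pt x) *m (frame j c (pt x))^T *m
    (g c (pt x) *m (frame j c (pt x))^T)^T = g c (pt x).
  rewrite [X in _ *m X]trmx_mul trmxK gT !mulmxA.
  by rewrite (frame_inv (FgF x)) mul1mx.
move: HrT gxi; set Hr := g c (pt x) *m _; move: (frame j c (pt x)) Hr.
move=> Fr Hr HrT gxi HrF.
(* Back to coordinates: [Hr] inverts the frame, [Hr *m Hr^T] is the metric, and [xr] pulls back to
   eta. *)
move/(congr1 (fun Z => Hr *m Z *m Hr^T)).
rewrite !mulmxA HrF mul1mx -mulmxA -trmx_mul HrF trmx1 mulmx1 => ->.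
rewrite mulmxBr mulmxBl mul_mx_scalar -scalemxAl HrT; congr (_ - _).
rewrite -scalemxAr -scalemxAl; congr (_ *: _).
have a1 : Hr *m (xi c (pt x) *m Hr)^T = eta c (pt x).
  by rewrite trmx_mul mulmxA HrT gxi.
have a2 : xi c (pt x) *m Hr *m Hr^T = (eta c (pt x))^T.
  by rewrite -a1 trmx_mul trmxK.
by rewrite -a2 !mulmxA a1.
Qed.

Notation cj := (@sfun_conj R n V).

Let cj_real1 (a : K) : (forall x : point, exists r, ev x a = r%:C) -> cj a = a.
Proof.
move=> ar; apply: sfun_eq => x; have [r ax] := ar x.
by rewrite -[LHS]/((ev x a)^*) -[RHS]/(ev x a) ax conjc_real.
Qed.

Let cj_real p q (B : 'M[K]_(p, q)) :
  (forall x, exists T, evmx x B = cpx T) -> map_mx cj B = B.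
Proof.
move=> BT; apply: sfun_mx_eq => x; have [T BE] := BT x.
rewrite BE; apply/matrixP => a b; rewrite evmxE mxE -[LHS]/((ev x (B a b))^*).
by rewrite -evmxE BE cmxE conjc_real.
Qed.

Let EK_skew a : adj cj (EK a) = - EK a.
Proof.
apply: sfun_mx_eq => x; rewrite evmxN evEK -(cliff_skew hE).
by apply/matrixP => k l; rewrite evmxE !mxE.
Qed.

Let cj_cst r : cj (cst r) = cst r.
Proof. by apply: sfun_eq => x; exact: conjc_real. Qed.

Let adj_comb (cm : {rmorphism K -> K}) (k1 k2 k3 : K) (v w : 'rV[K]_n)
    (B : 'M[K]_n) : (forall a, adj cm (EK a) = - EK a) ->
  cm k1 = k1 -> cm k2 = k2 -> cm k3 = k3 ->
  map_mx cm v = v -> map_mx cm w = w -> map_mx cm B = B -> B^T = - B ->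
  adj cm (k1 *: gam EK v + k2 *: gam EK w - k3 *: bivec EK B) =
  - (k1 *: gam EK v + k2 *: gam EK w - k3 *: bivec EK B).
Proof.
move=> sE e1 e2 e3 ev ew eB sB; rewrite !(adjD, adjN, adjZ) e1 e2 e3.
by rewrite (adj_gam sE ev) (adj_gam sE ew) (adj_bivec sE eB sB) !scalerN -!opprD.
Qed.

(** The derivative of psi is [S *m Ps], where [S] is the quasi-Killing endomorphism minus the spin
    connection form. It is skew-Hermitian, so the two terms of the product rule cancel. *)
Let d_norm k : dmx D k (adj cj Ps *m Ps) = 0.
Proof.
pose S := (cst al *: gam EK (row k H) + (cst be * u k 0) *: gam EK xf) - Sp k.
have dPs : dmx D k Ps = S *m Ps.
  have := qkK k; rewrite /cov mulmx0 addr0 => /eqP.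
  by rewrite -subr_eq0 -addrA addr_eq0 opprB => /eqP ->; rewrite mulmxBl.
have adS : adj cj S = - S.
  have rH : map_mx cj (row k H) = row k H.
    by apply: cj_real => x; eexists; exact: ev_rowH.
  have rx : map_mx cj xf = xf by apply: cj_real => x; eexists; exact: ev_xf.
  have rO : map_mx cj (OM k) = OM k by apply: cj_real => x; eexists; exact: evOM.
  have cc : cj (cst be * u k 0) = cst be * u k 0.
    by apply: cj_real1 => x; eexists; exact: ev_u.
  have OMs : (OM k)^T = - OM k by exact: (Om_skew DM h2 FGF Gsym erefl).
  exact: (adj_comb EK_skew (cj_cst al) cc (cj_cst _) rH rx rO OMs).
have dadj : dmx D k (adj cj Ps) = adj cj (dmx D k Ps).
  by apply/matrixP => a b; rewrite !mxE; exact: sder_conj.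
by rewrite (dmxM DM) dadj dPs adjM adS mulmxN mulNmx mulmxA addNr.
Qed.

Let nu : K := (adj cj Ps *m Ps) 0 0.

Let ev_adj x p q (B : 'M[K]_(p, q)) :
  evmx x (adj cj B) = adj (@conjc R) (evmx x B).
Proof. by apply/matrixP => a b; rewrite evmxE !mxE. Qed.

Let ev_nu x : ev x nu = (adj (@conjc R) (psi j (pt x)) *m psi j (pt x)) 0 0.
Proof.
by rewrite -evmxE evmxM ev_adj evPs.
Qed.

Let D_nu k : D k nu = 0.
Proof.
by have := congr1 (fun Z : 'M[K]_1 => Z 0 0) (d_norm k); rewrite mxE [RHS]mxE.
Qed.

(** The real function |psi|^2 has zero gradient, hence is constant on a ball of the chart image, and
    its zeros are those of psi. *)
Lemma spinor_zero_near p : sdom j p -> dom c p ->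
  \forall q \near p, sdom j q /\ (psi j q == 0) = (psi j p == 0).
Proof.
move=> Wp cp.
have Vp : pts V (chart c p) := ex_intro2 _ _ p (conj Wp cp) erefl.
have /nbhs_ballP[r r0 rV] : nbhs (chart c p) (pts V).
  exact: (open_nbhs_nbhs (conj (@open_pts _ V) Vp)).
have cst_nu y : ball (chart c p) r y ->
    extend (@complex.Re R) nu y = extend (@complex.Re R) nu (chart c p).
  apply: (cube_const r0) => z k zr; have Vz := rV _ zr.
  split; first exact: (@Cinfty_derivable _ _ _ _ k _ (sfun_Re nu) Vz).
  have := congr1 (fun a : K => complex.Re (a (exist _ z Vz))) (D_nu k).
  by [].
have Nb : \forall q \near p, ball (chart c p) r (chart c q).
  have /= := @mfd_chart_cont _ _ _ _ hM c p.
  by apply; [rewrite inE|exact: nbhsx_ballx].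
have NW : nbhs p (sdom j) := open_nbhs_nbhs (conj (spin_open hP j) Wp).
have Nc : nbhs p (dom c) := open_nbhs_nbhs (conj (@mfd_dom_open _ _ _ _ hM c) cp).
apply: filterS (filterI Nb (filterI NW Nc)) => q [bq [Wq cq]].
split; first exact: Wq.
rewrite [LHS]adjc_mul_Re_eq0 [RHS]adjc_mul_Re_eq0.
have nuE z : W z -> dom c z -> complex.Re ((adj (@conjc R) (psi j z) *m psi j z) 0 0)
    = extend (@complex.Re R) nu (chart c z).
  move=> Wz cz; have [x xz] := pt_surj hM oW Wz cz.
  by rewrite -xz chart_pt extendE -ev_nu.
by rewrite (nuE q Wq cq) (nuE p Wp cp) (cst_nu _ bq).
Qed.

End Local.

Lemma spinor_nowhere_zero j p : sdom j p -> psi j p != 0.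
Proof.
have [[_ psiT] [j0 [p0 [jp0 psi0]]] _] := hpsi.
pose Z := [set p | exists j, sdom j p /\ psi j p != 0].
(* Vanishing is independent of the spin frame, since the frames are related by [strans]; thus [Z] is
   locally determined, and both open and closed by [near_Z]. *)
have ZE j' p' : sdom j' p' -> Z p' <-> psi j' p' != 0.
  move=> jp; split=> [[k [kp]]|nz]; last by exists j'.
  by apply: contra => /eqP e; rewrite (psiT k j') // e mulmx0.
have near_Z p' : \forall q \near p', Z q <-> Z p'.
  have [j' jp] := spin_cover hP p'; have [c cp] := mfd_cover hM p'.
  apply: filterS (spinor_zero_near jp cp) => q [jq e].
  by rewrite (ZE j' q jq) (ZE j' p' jp) e.
have oZ : open Z.
  by rewrite openE => q Zq; apply: filterS (near_Z q) => y [_]; apply.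
have cZ : closed Z.
  rewrite -openC openE => q nZq; apply: filterS (near_Z q) => y [yq _] Zy.
  exact/nZq/yq.
move=> jp; apply/(ZE j p jp).
suff -> : Z = setT by [].
apply: (mfd_connected hM); first by exists p0, j0.
  by exists Z; rewrite ?setTI.
by exists Z; rewrite ?setTI.
Qed.

End QuasiKilling.

(** * The weak Killing equation *)

(** With k = 2m + 4eb and S = k(2m+1) - 4eb, the value of b is equivalent to 4 + 2k = S, the
    relation left once the WK-number is eliminated. *)
Lemma wk_type_eq (R : realFieldType) (m e b : R) :
  m - 1 != 0 -> e * e = 1 ->
  b = - e * ((2 * m ^+ 2 - m - 2) / (4 * (m - 1))) <->
  4 + 2 * (2 * m + 4 * e * b) = (2 * m + 4 * e * b) * (2 * m + 1) - 4 * e * b.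
Proof.
move=> m1 e2; split=> [->|H].
  have -> : 4 * e * (- e * ((2 * m ^+ 2 - m - 2) / (4 * (m - 1)))) =
     - (e * e) * ((2 * m ^+ 2 - m - 2) / (m - 1)) by field.
  by rewrite e2; field.
have E : 4 * (m - 1) * (e * b) = - (2 * m ^+ 2 - m - 2) by clear e2; lra.
apply: (mulfI (_ : 4 * (m - 1) != 0)); first by rewrite mulf_neq0 ?pnatr_eq0.
transitivity (e * (4 * (m - 1) * (e * b))).
  by rewrite -[LHS]mulr1 -e2; ring.
by rewrite E; field.
Qed.

Lemma wk_type_of_eqs (R : realFieldType) (m e b l k d S : R) :
  m - 1 != 0 -> 2 * m - 1 != 0 -> e * e = 1 -> b != 0 ->
  k = 2 * m + 4 * e * b -> d = 4 * e * b -> S = k * (2 * m + 1) - d -> S != 0 ->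
  e / 2 - 2 * l / ((2 * m + 1 - 2) * S) * k + l / (2 * m + 1 - 2) = 0 ->
  b + 2 * l / ((2 * m + 1 - 2) * S) * d = 0 ->
  b = - e * ((2 * m ^+ 2 - m - 2) / (4 * (m - 1))).
Proof.
move=> m1 m21 e2 b0 kE dE SE S0.
have -> : 2 * m + 1 - 2 = 2 * m - 1 by ring.
set c := 2 * l / _ => H1 H2; apply/(wk_type_eq _ m1 e2).
rewrite -kE -dE -SE.
have lE : l / (2 * m - 1) = c * S / 2 by rewrite /c; field; rewrite S0 m21.
(* The second equation is b (1 + 4 e c) = 0, and b != 0. *)
have cE : c = - (e / 4).
  apply: (mulfI b0); have : (b + c * d) * e = 0 by rewrite H2 mul0r.
  rewrite dE => H; have : b * e + 4 * c * b * (e * e) = 0.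
    by rewrite -[RHS]H; ring.
  by rewrite e2; clear => ?; lra.
move: H1; rewrite lE cE => H1.
(* Multiplying by e removes the sign and leaves 1/2 + k/4 - S/8 = 0. *)
have : e * (e / 2 - - (e / 4) * k + - (e / 4) * S / 2) = 0 by rewrite H1 mulr0.
have -> : e * (e / 2 - - (e / 4) * k + - (e / 4) * S / 2) =
  (e * e) * (1 / 2 + k / 4 - S / 8) by field.
by rewrite e2 mul1r; clear => ?; lra.
Qed.

(** The value of [l] solves 2l/((2m-1)S) = -e/4, as the second equation forces. For the given b one
    gets S = 2m/(m-1), which is nonzero, and so is l. *)
Lemma wk_eqs_of_type (R : realFieldType) (m e b l k d S : R) :
  m != 0 -> m - 1 != 0 -> 2 * m - 1 != 0 -> e * e = 1 ->
  k = 2 * m + 4 * e * b -> d = 4 * e * b -> S = k * (2 * m + 1) - d ->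
  b = - e * ((2 * m ^+ 2 - m - 2) / (4 * (m - 1))) ->
  l = - e * (2 * m - 1) * S / 8 ->
  [/\ S != 0, l != 0,
   e / 2 - 2 * l / ((2 * m + 1 - 2) * S) * k + l / (2 * m + 1 - 2) = 0 &
   b + 2 * l / ((2 * m + 1 - 2) * S) * d = 0].
Proof.
move=> m0 m1 m21 e2 kE dE SE bE lE.
have kS : 4 + 2 * k = S by rewrite SE kE dE; apply/(wk_type_eq _ m1 e2).
have -> : 2 * m + 1 - 2 = 2 * m - 1 by ring.
have SE' : S = 2 * m / (m - 1).
  rewrite -kS kE bE.
  have -> : 4 * e * (- e * ((2 * m ^+ 2 - m - 2) / (4 * (m - 1)))) =
     - (e * e) * ((2 * m ^+ 2 - m - 2) / (m - 1)) by field.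
  by rewrite e2; field.
have S0 : S != 0 by rewrite SE' !mulf_neq0 ?invr_eq0 ?pnatr_eq0.
have e0 : e != 0.
  by apply/eqP => e0; move/eqP: e2; rewrite e0 mul0r eq_sym oner_eq0.
have cE : 2 * l / ((2 * m - 1) * S) = - (e / 4).
  by rewrite lE; field; rewrite S0 m21.
have lE' : l / (2 * m - 1) = - e * S / 8 by rewrite lE; field; rewrite m21.
split=> //.
- by rewrite lE !mulf_neq0 ?oppr_eq0 ?invr_eq0 ?pnatr_eq0.
- by rewrite cE lE' -kS; field.
- rewrite cE dE.
  have -> : b + - (e / 4) * (4 * e * b) = b - (e * e) * b by field.
  by rewrite e2 mul1r subrr.
Qed.

Lemma invmx_eta_einstein (R : fieldType) (n : nat) (g : 'M[R]_n)
    (xi : 'rV[R]_n) (eta : 'cV[R]_n) (k d : R) :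
  g \in unitmx -> g^T = g -> g *m xi^T = eta ->
  (k *: g - d *: (eta *m eta^T)) *m invmx g = k%:M - d *: (eta *m xi).
Proof.
move=> gu gT gxi.
have -> : eta^T = xi *m g by rewrite -gxi trmx_mul trmxK gT.
by rewrite mulmxBl -!scalemxAl -!mulmxA mulmxV // mulmx1 scalemx1.
Qed.

Lemma mxtrace_eta_einstein (R : numFieldType) (n : nat) (xi : 'rV[R]_n) (eta : 'cV[R]_n)
    (k d : R) : xi *m eta = 1%:M ->
  \tr (k%:M - d *: (eta *m xi)) = k * n%:R - d.
Proof.
move=> xe; rewrite linearB linearZ /= mxtrace_scalar mxtrace_mulC xe mxtrace1.
by rewrite mulr_natr mulr1.
Qed.

(** Evaluation at xi gives k = d; the trace kn - d then becomes k(n-1), so k = 0. *)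
Lemma eta_umbilic_eq0 (R : numFieldType) (n : nat) (xi : 'rV[R]_n)
    (eta : 'cV[R]_n) (k d : R) : (1 < n)%N -> xi *m eta = 1%:M ->
  (forall v : 'rV[R]_n, k *: v - (d * (v *m eta) 0 0) *: xi = 0) ->
  k = 0 /\ d = 0.
Proof.
move=> n1 xe H.
have K : k%:M - d *: (eta *m xi) = 0.
  apply/row_matrixP => i; rewrite rowE row0 mulmxBr mul_mx_scalar -scalemxAr.
  by rewrite mulmxA scal11 scalerA H.
have kd : k = d.
  have := congr1 (fun Z => (xi *m Z *m eta) 0 0) K.
  rewrite mulmx0 mul0mx mulmxBr mul_mx_scalar -scalemxAr mulmxA xe mul1mx.
  rewrite mulmxBl -!scalemxAl xe => /eqP; rewrite !mxE eqxx !mulr1 subr_eq0.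
  by move/eqP.
have := congr1 mxtrace K; rewrite (mxtrace_eta_einstein _ _ xe) mxtrace0 -kd.
have -> : k * n%:R - k = k * (n%:R - 1) by ring.
move/eqP; rewrite mulf_eq0 subr_eq0 (eqr_nat R n 1) gtn_eqF // orbF => /eqP.
by move->.
Qed.

(** * The weak Killing equation when Ric = k g - d eta (x) eta *)

Section EtaEinstein.
Variables (R : realType) (n : nat) (M : topologicalType) (A : atlas R n M).
Hypothesis hM : oriented_manifold A.
Variables (g phi : idx A -> M -> 'M[R]_n).
Variables (xi : idx A -> M -> 'rV[R]_n) (eta : idx A -> M -> 'cV[R]_n).
Hypothesis hsas : sasakian g phi xi eta.
Variables k d : R.
Hypothesis ricciE : forall c p, dom c p ->
  ricci g c p = k *: g c p - d *: (eta c p *m (eta c p)^T).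
Implicit Types (c : idx A) (p : M).

Lemma metric_unit c p : dom c p -> g c p \in unitmx.
Proof.
move=> cp; rewrite -row_free_unit -kermx_eq0; apply/rowV0P => v /sub_kermxP vg.
apply/eqP; apply: contraT => /(metric_pos (sas_metric hsas) cp).
by rewrite vg mul0mx mxE ltxx.
Qed.

Lemma metric_xi c p : dom c p -> g c p *m (xi c p)^T = eta c p.
Proof.
move=> cp; apply: (sas_g_xi (sas_eta_xi hsas cp) (sas_phi2 hsas cp)).
- exact: (sas_compat hsas cp).
- exact: (metric_sym (sas_metric hsas) cp).
Qed.

Lemma xi_eta c p : dom c p -> xi c p *m eta c p = 1%:M.
Proof. by move=> cp; apply: sas_xi_eta_mx; exact: (sas_eta_xi hsas cp). Qed.

Lemma ricci_invmx c p : dom c p ->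
  ricci g c p *m invmx (g c p) = k%:M - d *: (eta c p *m xi c p).
Proof.
move=> cp; rewrite ricciE //; apply: invmx_eta_einstein.
- exact: metric_unit.
- exact: (metric_sym (sas_metric hsas) cp).
- exact: metric_xi.
Qed.

Lemma Ric_eta_einstein c p v : dom c p ->
  Ric g c p v = k *: v - (d * (v *m eta c p) 0 0) *: xi c p.
Proof.
move=> cp; rewrite /Ric -mulmxA ricci_invmx // mulmxBr mul_mx_scalar.
by rewrite -scalemxAr mulmxA scal11 scalerA.
Qed.

Lemma scal_eta_einstein c p : dom c p -> scal g c p = k * n%:R - d.
Proof. by move=> cp; rewrite /scal ricci_invmx // mxtrace_eta_einstein // xi_eta. Qed.

Lemma pd_scal c p l : dom c p -> pd c l (scal g c) p = 0.
Proof.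
move=> cp; rewrite /pd.
rewrite (@derive_eq_on _ _ _ (@mfd_img_open _ _ _ _ hM c) _ (cst (k * n%:R - d))).
- by rewrite derive_cst.
- move=> _ /set_mem[q cq <-] /=.
  by rewrite (mfd_chartK hM cq) scal_eta_einstein.
- by rewrite inE; exists p.
Qed.

Lemma dscal_eta_einstein c p v : dom c p -> dscal g c p v = 0.
Proof.
by move=> cp; rewrite /dscal big1 // => l _; rewrite pd_scal // mulr0.
Qed.

Lemma grad_scal_eta_einstein c p : dom c p -> grad_scal g c p = 0.
Proof.
move=> cp; rewrite /grad_scal [X in X *m _](_ : _ = 0) ?mul0mx //.
by apply/rowP => l; rewrite !mxE pd_scal.
Qed.

Variable E : 'I_n -> 'M[R[i]]_(spin_dim n).
Hypothesis hE : clifford_rep E.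
Variable P : spin_data A.
Hypothesis hP : spin_structure g E P.
Variable psi : sidx P -> M -> 'cV[R[i]]_(spin_dim n).
Variables al be : R.
Hypothesis hpsi : quasi_killing g E xi eta al be psi.
Implicit Types (j : sidx P).

Lemma cmulZ j c p (a : R) v :
  cmul g E j c p (a *: v) = a%:C *: cmul g E j c p v.
Proof.
rewrite !cmulE -scalemxAl /cmx map_mxZ.
exact: linearZ.
Qed.

Lemma cmulB j c p v w :
  cmul g E j c p (v - w) = cmul g E j c p v - cmul g E j c p w.
Proof.
rewrite !cmulE mulmxBl /cmx map_mxB.
exact: linearB.
Qed.

Lemma cmul0 j c p : cmul g E j c p 0 = 0.
Proof. by rewrite -(subrr (0 : 'rV[R]_n)) cmulB subrr. Qed.

Lemma cmul_psi_inj j c p v : sdom j p -> dom c p -> psi j p != 0 ->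
  cmul g E j c p v *m psi j p = 0 -> v = 0.
Proof.
move=> jp cp p0; rewrite cmulE => /(gam_psi_inj (cliff_rel hE) p0) vH.
rewrite -[v]mulmx1 -(frame_inv (spin_frame_orthonormal hP jp cp)).
by rewrite mulmxA vH mul0mx.
Qed.

(** The vector whose Clifford product with psi is the difference of the quasi-Killing and weak
    Killing right-hand sides; the double sign puts it in the form required by [eta_umbilic_eq0]. *)
Definition wk_defect (S lambda : R) c p (v : 'rV[R]_n) : 'rV[R]_n :=
  (al - 2 * lambda / ((n%:R - 2) * S) * k + lambda / (n%:R - 2)) *: v
  - (- (be + 2 * lambda / ((n%:R - 2) * S) * d) * (v *m eta c p) 0 0) *: xi c p.

Lemma wk_equationE lambda :
  wk_equation g E lambda psi <->
  forall j c p, sdom j p -> dom c p -> forall v : 'rV[R]_n,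
    cmul g E j c p (wk_defect (k * n%:R - d) lambda c p v) *m psi j p = 0.
Proof.
have [_ _ qk] := hpsi.
suff H j c p : sdom j p -> dom c p -> forall v : 'rV[R]_n,
    let S := scal g c p in
    nabla_spinor g E j c v psi p - (
      (n%:R / (2 * (n%:R - 1) * S) * dscal g c p v)%:C *: psi j p
      + (2 * lambda / ((n%:R - 2) * S))%:C *:
          (cmul g E j c p (Ric g c p v) *m psi j p)
      - (lambda / (n%:R - 2))%:C *: (cmul g E j c p v *m psi j p)
      + (1 / (2 * (n%:R - 1) * S))%:C *:
          (cmul g E j c p v *m (cmul g E j c p (grad_scal g c p) *m psi j p)))
    = cmul g E j c p (wk_defect (k * n%:R - d) lambda c p v) *m psi j p.
  split=> W j c p jp cp v.
  - by rewrite -H // W // subrr.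
  - by apply/eqP; rewrite -subr_eq0 H // W.
move=> jp cp v S; rewrite {}/S qk // scal_eta_einstein // dscal_eta_einstein //.
rewrite grad_scal_eta_einstein // cmul0 mul0mx mulmx0 scaler0 addr0.
rewrite mulr0 scale0r add0r Ric_eta_einstein // /wk_defect !cmulB !cmulZ.
move: (2 * lambda / _) (lambda / _) ((v *m _) 0 0) => u w h.
rewrite !mulmxBl -!scalemxAl.
rewrite !(rmorphM, rmorphD, rmorphB, rmorphN) /=.
move: (cmul g E j c p v *m psi j p) (cmul g E j c p (xi c p) *m psi j p) => X Y.
apply/colP => r; rewrite !mxE; ring.
Qed.

(** A nonzero spinor is killed by no nonzero real vector, so the defect vanishes for all directions
    at one point, which already determines the two constant coefficients. *)
Lemma wk_equation_eqs lambda : (1 < n)%N ->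
  (forall j p, sdom j p -> psi j p != 0) ->
  let S := k * n%:R - d in
  wk_equation g E lambda psi <->
  al - 2 * lambda / ((n%:R - 2) * S) * k + lambda / (n%:R - 2) = 0 /\
  be + 2 * lambda / ((n%:R - 2) * S) * d = 0.
Proof.
move=> n1 psi0 S; have [_ [j [p [jp _]]] _] := hpsi.
rewrite wk_equationE /wk_defect -/S; split=> [W|[-> ->] i c q iq cq v].
  have [c cp] := mfd_cover hM p.
  have W0 v := cmul_psi_inj jp cp (psi0 _ _ jp) (W j c p jp cp v).
  have [-> /eqP] := eta_umbilic_eq0 n1 (xi_eta cp) W0.
  by rewrite oppr_eq0 => /eqP ->.
by rewrite scale0r oppr0 mul0r scale0r subrr cmul0 mul0mx.
Qed.
End EtaEinstein.

Theorem theorem6p7 (R : realType) (m : nat) (hm : (2 <= m)%N)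
    (M : topologicalType) (A : atlas R m.*2.+1 M)
    (hM : oriented_manifold A)
    (g phi : idx A -> M -> 'M[R]_(m.*2.+1))
    (xi : idx A -> M -> 'rV[R]_(m.*2.+1))
    (eta : idx A -> M -> 'cV[R]_(m.*2.+1))
    (hsas : sasakian g phi xi eta)
    (E : 'I_(m.*2.+1) -> 'M[R[i]]_(spin_dim m.*2.+1))
    (hE : clifford_rep E)
    (P : spin_data A) (hP : spin_structure g E P)
    (psi : sidx P -> M -> 'cV[R[i]]_(spin_dim m.*2.+1))
    (s : bool) (b : R) (hb : b != 0)
    (hpsi : quasi_killing g E xi eta ((-1) ^+ s / 2) b psi) :
  wk_spinor g E psi <->
  b = - (-1) ^+ s * ((2 * m%:R ^+ 2 - m%:R - 2) / (4 * (m%:R - 1))).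
Proof.
have [spinor_psi nz_psi _] := hpsi.
move: (hpsi); set e : R := (-1) ^+ s => qk.
have e2 : e * e = 1 by rewrite /e -signr_addb addbb.
have al2 : 4 * (e / 2) ^+ 2 = 1 by rewrite -[RHS]e2; field.
have psi0 := spinor_nowhere_zero hM hsas hE hP qk.
(* These are n - 1 + 8 al b and 8 al b for al = e/2 and n = 2m + 1. *)
pose k := 2 * m%:R + 4 * e * b; pose d := 4 * e * b.
have nE : m.*2.+1%:R = 2 * m%:R + 1 :> R by rewrite -mul2n -natr1 natrM.
have ricE c p : dom c p ->
    ricci g c p = k *: g c p - d *: (eta c p *m (eta c p)^T).
  move=> cp; have [j jp] := spin_cover hP p.
  rewrite (ricci_qk_sasakian hM hsas hE hP qk al2 hb jp cp (psi0 _ _ jp)) nE.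
  by congr (_ *: _ - _ *: _); rewrite /k /d; field.
pose S := k * (2 * m%:R + 1) - d.
have scalE c p : dom c p -> scal g c p = S.
  by move=> cp; rewrite (scal_eta_einstein hsas ricE cp) nE.
have n2 : (2 < m.*2.+1)%N by rewrite ltnS -addnn (leq_trans hm) ?leq_addr.
have n1 := ltnW n2.
have wkE l := wk_equation_eqs hM hsas ricE hE hP qk l n1 psi0.
have m0 : m%:R != 0 :> R by rewrite pnatr_eq0 -lt0n ltnW.
have m1 : m%:R - 1 != 0 :> R by rewrite subr_eq0 (eqr_nat R m 1) gtn_eqF.
have m21 : 2 * m%:R - 1 != 0 :> R.
  by rewrite subr_eq0 -natrM (eqr_nat R _ 1) gtn_eqF // mul2n -ltnS n2.
split=> [[_ S0 _ _ [l [_ /wkE]]]|bE].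
  rewrite nE -/S => -[H1 H2].
  (* A point of M is needed to read S != 0 off the pointwise hypothesis. *)
  have [j [p _]] := nz_psi; have [c cp] := mfd_cover hM p.
  by apply: (wk_type_of_eqs m1 m21 e2 hb erefl erefl erefl _ H1 H2);
    rewrite -/S -(scalE c p cp) S0.
pose l := - e * (2 * m%:R - 1) * S / 8.
have [S0 l0 H1 H2] := wk_eqs_of_type m0 m1 m21 e2 erefl erefl erefl bE
  (erefl : l = _).
split=> //.
- by move=> c p cp; rewrite scalE.
- by exists l; split=> //; apply/wkE; rewrite nE.
Qed.
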